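(* Let $\lambda_1<\dots<\lambda_k$ be real, $I=(i_1,\dots,i_k)$ positive integers with sum $n$, and $\Lambda$ the diagonal matrix with $\lambda_j$ appearing $i_j$ times, in increasing order. Let $G={\rm SO}(n,\mathbb R)\cap({\rm O}(i_1)\times\dots\times{\rm O}(i_k))$ and let $\xi_I$ be the vector field on ${\rm Fl}_I(\mathbb R)={\rm SO}(n,\mathbb R)/G$ induced by the right-$G$-invariant vector field $M(\Psi)=\big((\Psi\Lambda\Psi^{-1})_+-(\Psi\Lambda\Psi^{-1})_-\big)\Psi$ on ${\rm SO}(n,\mathbb R)$. For $\tau\in S_n^I$ let $p_\tau\in{\rm Fl}_I(\mathbb R)$ be the singular point of $\xi_I$ given by the coset $[\Psi]$ with $\Psi\Lambda\Psi^{-1}=\operatorname{diag}(\lambda_{\tau(1)},\dots,\lambda_{\tau(n)})$. Let $\psi\neq\omega$ in $S_n^I$. Then $p_\psi$ and $p_\omega$ are connected by a trajectory of $\xi_I$ (i.e. there is an integral curve tending to one of them as $t\to-\infty$ and to the other as $t\to+\infty$) if and only if $\psi$ and $\omega$ are comparable in the Bruhat order on $S_n^I$. Moreover, when $\psi\preceq\omega$, the dimension of the subset of ${\rm Fl}_I(\mathbb R)$ swept out by the trajectories connecting $p_\psi$ and $p_\omega$ equals the length of the path from $\psi$ to $\omega$ in the Hasse diagram of the Bruhat order on $S_n^I$.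
   Context: For a square matrix $X$, $X_+$ (resp. $X_-$) is its strictly upper (resp. strictly lower) triangular part. $S_n^I$ is the set of surjective maps $\tau\colon\{1,\dots,n\}\to\{1,\dots,k\}$ with $|\tau^{-1}(j)|=i_j$ for all $j$. Put $r_\tau[p,q]=\#\{j\le p:\ \tau(j)\ge q\}$; the Bruhat order on $S_n^I$ is $\tau\preceq\upsilon$ iff $r_\tau[p,q]\le r_\upsilon[p,q]$ for all $1\le p\le n$, $1\le q\le k$. The Hasse diagram is the graph with an edge $a\to b$ whenever $a\prec b$ and there is no $c$ with $a\prec c\prec b$; the length of a path is its number of edges. *)

(* Defs.v *)
From HB Require Import structures.
From mathcomp Require Import all_boot all_order all_algebra.
From mathcomp Require Import all_classical all_reals all_analysis.
Set Implicit Arguments. Unset Strict Implicit. Unset Printing Implicit Defensive.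
Import Order.TTheory GRing.Theory Num.Theory.
Import numFieldTopology.Exports numFieldNormedType.Exports.
Local Open Scope classical_set_scope.
Local Open Scope ring_scope.

(* ---------- Combinatorics: S_n^I and its Bruhat order (0-based indices) ----------
   Positions 1..n are 'I_n (shifted by one), values 1..k are 'I_k (shifted by one). *)

(* tau : 'I_n -> 'I_k lies in S_n^I : |tau^{-1}(j)| = I j for all j
   (surjectivity then follows from positivity of the I j; we state it anyway). *)
Definition in_SnI (n k : nat) (I : 'I_k -> nat) (tau : {ffun 'I_n -> 'I_k}) : Prop :=
  (forall j : 'I_k, exists i : 'I_n, tau i = j) /\
  (forall j : 'I_k, #|[set i : 'I_n | tau i == j]| = I j).

(* r_tau[p, q] = #{ j <= p : tau(j) >= q }  (1-based p, q);
   here p is the 1-based position bound and q : 'I_k is the 0-based value q-1. *)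
Definition rk (n k : nat) (tau : {ffun 'I_n -> 'I_k}) (p : nat) (q : 'I_k) : nat :=
  #|[set j : 'I_n | (j < p)%N && (q <= tau j)%N]|.

Definition bruhat_le (n k : nat) (tau ups : {ffun 'I_n -> 'I_k}) : Prop :=
  forall (p : 'I_n) (q : 'I_k), (rk tau p.+1 q <= rk ups p.+1 q)%N.

Definition bruhat_lt (n k : nat) (tau ups : {ffun 'I_n -> 'I_k}) : Prop :=
  bruhat_le tau ups /\ tau <> ups.

Definition hasse_edge (n k : nat) (I : 'I_k -> nat) (a b : {ffun 'I_n -> 'I_k}) : Prop :=
  bruhat_lt a b /\
  ~ (exists c : {ffun 'I_n -> 'I_k}, in_SnI I c /\ bruhat_lt a c /\ bruhat_lt c b).

(* A path a = x_0 -> x_1 -> ... -> x_l = b in the Hasse diagram, given as the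
   list [x_1; ...; x_l] of its vertices after a; its length is l = size s. *)
Fixpoint hasse_path (n k : nat) (I : 'I_k -> nat) (a : {ffun 'I_n -> 'I_k})
    (s : seq {ffun 'I_n -> 'I_k}) (b : {ffun 'I_n -> 'I_k}) : Prop :=
  match s with
  | [::] => a = b
  | x :: s' => in_SnI I x /\ hasse_edge I a x /\ hasse_path I x s' b
  end.

Definition blk_start (k : nat) (I : 'I_k -> nat) (j : 'I_k) : nat :=
  (\sum_(l < k | (l < j)%N) I l)%N.

Definition Lam (R : realType) (n k : nat) (I : 'I_k -> nat) (lam : 'I_k -> R) : 'M[R]_n :=
  \matrix_(i < n, j < n)
     (if i == j then
        \sum_(l < k | (blk_start I l <= i < blk_start I l + I l)%N) lam l
      else 0).

Definition SOn (R : realType) (n : nat) (Psi : 'M[R]_n) : Prop :=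
  Psi *m Psi^T = 1%:M /\ \det Psi = 1.

Definition upper_part (R : realType) (n : nat) (X : 'M[R]_n) : 'M[R]_n :=
  \matrix_(i, j) (if (i < j)%N then X i j else 0).
Definition lower_part (R : realType) (n : nat) (X : 'M[R]_n) : 'M[R]_n :=
  \matrix_(i, j) (if (j < i)%N then X i j else 0).

Definition conjL (R : realType) (n : nat) (L Psi : 'M[R]_n) : 'M[R]_n :=
  Psi *m L *m invmx Psi.

Definition todaM (R : realType) (n : nat) (L Psi : 'M[R]_n) : 'M[R]_n :=
  (upper_part (conjL L Psi) - lower_part (conjL L Psi)) *m Psi.

Definition integral_curve (R : realType) (n : nat) (L : 'M[R]_n) (Psi : R -> 'M[R]_n) : Prop :=
  (forall t, SOn (Psi t)) /\
  (forall (t : R) (i j : 'I_n), is_derive t (1 : R) (fun s => Psi s i j) (todaM L (Psi t) i j)).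

(* Fl_I = SO(n)/G is identified (homeomorphically, G being the stabiliser of
   Lambda in SO(n)) with the orbit { Psi Lambda Psi^-1 } via [Psi] |-> Psi Lambda Psi^-1.
   The singular point p_tau is the coset with Psi Lambda Psi^-1 = diag(lambda_tau(i)),
   represented by that matrix. *)
Definition ptau (R : realType) (n k : nat) (lam : 'I_k -> R) (tau : {ffun 'I_n -> 'I_k})
  : 'M[R]_n := \matrix_(i, j) (if i == j then lam (tau i) else 0).

(* A trajectory of xi_I (projection of an integral curve of M) going from
   the point P (t -> -oo) to the point Q (t -> +oo). *)
Definition traj_from_to (R : realType) (n : nat) (L : 'M[R]_n) (Psi : R -> 'M[R]_n)
    (P Q : 'M[R]_n) : Prop :=
  integral_curve L Psi /\
  (conjL L (Psi t) @[t --> -oo%R] --> P) /\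
  (conjL L (Psi t) @[t --> +oo%R] --> Q).

Definition connected_by_traj (R : realType) (n : nat) (L : 'M[R]_n) (P Q : 'M[R]_n) : Prop :=
  exists Psi : R -> 'M[R]_n, traj_from_to L Psi P Q \/ traj_from_to L Psi Q P.

Definition swept (R : realType) (n : nat) (L : 'M[R]_n) (P Q : 'M[R]_n) : set 'M[R]_n :=
  [set X | exists Psi : R -> 'M[R]_n,
           (traj_from_to L Psi P Q \/ traj_from_to L Psi Q P) /\
           exists t, X = conjL L (Psi t)].

Definition manifold_dim (R : realType) (n : nat) (S : set 'M[R]_n) (d : nat) : Prop :=
  forall x, S x ->
    exists (U : set 'M[R]_n) (V : set 'rV[R]_d) (f : 'M[R]_n -> 'rV[R]_d)
           (g : 'rV[R]_d -> 'M[R]_n),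
      open U /\ U x /\ open V /\
      f @` (S `&` U) = V /\ g @` V = S `&` U /\
      (forall y, (S `&` U) y -> g (f y) = y) /\ (forall v, V v -> f (g v) = v) /\
      {within S `&` U, continuous f} /\ {within V, continuous g}.

(* Main.v *)
Require Import Defs.
From HB Require Import structures.
From mathcomp Require Import all_boot all_order all_algebra.
From mathcomp Require Import all_classical all_reals all_analysis.
From mathcomp Require Import perm zify ring lra.
Set Implicit Arguments. Unset Strict Implicit. Unset Printing Implicit Defensive.
Import Order.TTheory GRing.Theory Num.Theory.
Import numFieldTopology.Exports numFieldNormedType.Exports.
Local Open Scope classical_set_scope.
Local Open Scope ring_scope.

(** Along an integral curve Psi of the Toda field, C(t) = Psi(0) exp(s t Lambda) Psi(t)^T
    solves C' = C K with K lower triangular for s = 1 and upper triangular for s = -1,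
    so C stays triangular: the flag of Psi(t) never leaves its Bruhat cells with respect
    to the lower and the upper Borel subgroup. Conversely Gram-Schmidt applied to
    Psi(0) exp(t Lambda) produces an integral curve through every point. The lower cell
    determines the limit at +oo and the upper one the limit at -oo, hence the trajectories
    from p_psi to p_omega fill the open Richardson variety, the intersection of the upper
    cell of psi with the lower cell of omega.

    A point of this intersection amounts to a matrix g, with g i j = 0 whenever
    psi i < omega j, that is a product of an upper and a lower triangular matrix. Its corner minors
    do not vanish, and a nonzero term of each of them is a permutation that forces
    psi <= omega; when psi <= omega, such a g is built by induction along exchanges of two
    values. Every edge of the Hasse diagram increases the number of inversions by one, so
    a path from psi to omega has as many edges as omega has inversions in excess of psi.

    Near g0, every matrix with the same vanishing entries is uniquely
    (1 + u) (g0 + w) (1 + v) with u strictly upper triangular and of level psi, v lower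
    triangular and of level omega, and w in a linear complement of u g0 + g0 v; this is
    the inversion of a perturbation of the identity. The flag depends only on w, which is
    the chart, and counting entries gives dim w = inv omega - inv psi. *)

(** A point of the flag manifold is seen only through the symmetric matrix Psi Lambda Psi^-1, so a
    frame P matters only up to right factors compatible with the blocks of Lambda. Writing Lambda as
    the diagonal of lam along the nondecreasing word [blk] turns these into matrices block
    triangular for [level blk]; an orthogonal one is block diagonal and commutes with Lambda.

    Limits determine cells as well as conversely: every frame lies in some cell of each direction,
    and different words have different limit points. Trajectories therefore run only from the
    smaller word to the larger.

    The dimension asks for a homeomorphism around each point. The matrix g of a point is not
    canonical, because its frame and its triangular factors are not; a continuous chart needs a
    continuous choice of frame (spectral projectors) and of normalization (row reduction relative to
    the base point). The chart and its inverse are then explicit maps, whose compositions are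
    computed by uniqueness of triangular factorizations. Inverses are written by Cramer's rule, so
    that regularity reduces to closure properties of scalar functions. *)

(** * Inversions and the covering relation of the Bruhat order *)

Definition inversions (n k : nat) (tau : {ffun 'I_n -> 'I_k}) : nat :=
  (\sum_(x < n) \sum_(y < n) ((x < y)%N && (tau y < tau x)%N : nat))%N.

Definition same_content (n k : nat) (tau ups : {ffun 'I_n -> 'I_k}) : Prop :=
  forall v, #|[pred i | tau i == v]| = #|[pred i | ups i == v]|.

Definition swap_positions (n k : nat) (i j : 'I_n) (tau : {ffun 'I_n -> 'I_k}) :=
  [ffun x => tau (tperm i j x)].

Lemma card_classical_set (T : finType) (P : pred T) :
  #|[set x : T | P x]%classic| = #|[pred x | P x]|.
Proof. by apply: eq_card => x; rewrite !inE; apply: asboolb. Qed.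

Lemma rkE (n k : nat) (tau : {ffun 'I_n -> 'I_k}) p q :
  rk tau p q = (\sum_(x < n) ((x < p)%N && (q <= tau x)%N : nat))%N.
Proof.
rewrite /rk card_classical_set -sum1_card big_mkcond /=; apply: eq_bigr => x _.
by rewrite inE; case: (_ && _).
Qed.

Lemma sum_ord2 (n : nat) (i j : 'I_n) (F : 'I_n -> nat) : i != j ->
  (\sum_(x < n) F x = F i + F j + \sum_(x < n | (x != i) && (x != j)) F x)%N.
Proof.
move=> ij; rewrite (bigD1 i) //= (bigD1 j) /=; last by rewrite eq_sym.
by rewrite addnA.
Qed.

(** The two counts differ only at positions i and j. When the swapped word is compared with a larger
    one, strict slack is thus needed only on the rectangle i <= p < j, psi i < q <= psi j. *)
Lemma rk_swap_le (n k : nat) (psi : {ffun 'I_n -> 'I_k}) (i j p : 'I_n) q :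
  (i < j)%N -> (psi i < psi j)%N ->
  (rk (swap_positions i j psi) p.+1 q <=
   rk psi p.+1 q + ((i <= p)%N && (p < j)%N && (psi i < q)%N && (q <= psi j)%N))%N.
Proof.
move=> ij psiij; have ne : i != j by rewrite neq_ltn ij.
rewrite !rkE !(sum_ord2 _ ne) !ffunE tpermL tpermR.
rewrite [X in (_ + _ + X <= _)%N](eq_bigr
  (fun x : 'I_n => ((x < p.+1)%N && (q <= psi x)%N : nat))); last first.
  by move=> x /andP[xi xj]; rewrite ffunE tpermD // eq_sym.
set S := (\sum_(x < n | _) _)%N.
by move: ij psiij; rewrite !ltnS; lia.
Qed.

Lemma rk_le_swap (n k : nat) (psi : {ffun 'I_n -> 'I_k}) (i j : 'I_n) :
  (i < j)%N -> (psi i < psi j)%N -> bruhat_le psi (swap_positions i j psi).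
Proof.
move=> ij psiij p q; have ne : i != j by rewrite neq_ltn ij.
rewrite !rkE !(sum_ord2 _ ne) !ffunE tpermL tpermR.
rewrite [X in (_ <= _ + _ + X)%N](eq_bigr
  (fun x : 'I_n => ((x < p.+1)%N && (q <= psi x)%N : nat))); last first.
  by move=> x /andP[xi xj]; rewrite ffunE tpermD // eq_sym.
set S := (\sum_(x < n | _) _)%N.
by move: ij psiij; rewrite !ltnS; lia.
Qed.

(** The pair (i, j) is the new inversion. For a third position m the contributions against i and j
    balance; they would fail to do so only for m between i and j with a value in the closed
    interval, so ties must be excluded too. *)
Lemma inversions_swap (n k : nat) (psi : {ffun 'I_n -> 'I_k}) (i j : 'I_n) :
  (i < j)%N -> (psi i < psi j)%N ->
  (forall m : 'I_n, (i < m < j)%N -> ~~ (psi i <= psi m <= psi j)%N) ->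
  inversions (swap_positions i j psi) = (inversions psi).+1.
Proof.
move=> ij psiij gap; have ne : i != j by rewrite neq_ltn ij.
rewrite /inversions !(sum_ord2 _ ne).
under [X in (_ + X)%N = _]eq_bigr => x _ do rewrite (sum_ord2 _ ne).
under [X in _ = (_ + X).+1]eq_bigr => x _ do rewrite (sum_ord2 _ ne).
rewrite !big_split /= !ffunE tpermL tpermR !ltnn /=.
set cc := (X in (_ + (_ + X) = _)%N).
set pp := (X in (_ = (_ + (_ + X)).+1)%N).
have -> : cc = pp.
  apply: eq_bigr => x /andP[xi xj]; apply: eq_bigr => y /andP[yi yj].
  by rewrite !ffunE !tpermD // eq_sym.
rewrite ij psiij (ltnNge j) (ltnW ij) /= (ltnNge (psi j)) (ltnW psiij) /=.
set a1 := (\sum_(x < n | _) _)%N; set a2 := (\sum_(x < n | _) _)%N.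
set a3 := (\sum_(x < n | _) _)%N; set a4 := (\sum_(x < n | _) _)%N.
set b1 := (\sum_(x < n | _) _)%N; set b2 := (\sum_(x < n | _) _)%N.
set b3 := (\sum_(x < n | _) _)%N; set b4 := (\sum_(x < n | _) _)%N.
suff : (a1 + a2 + a3 + a4 = b1 + b2 + b3 + b4)%N by lia.
rewrite /a1 /a2 /a3 /a4 /b1 /b2 /b3 /b4 -!big_split /=.
apply: eq_bigr => m /andP[mi mj]; rewrite !ffunE !tpermD; first last.
- by rewrite eq_sym.
- by rewrite eq_sym.
have := gap m; move: mi mj ij psiij; rewrite -!(inj_eq val_inj) /=.
lia.
Qed.

Lemma same_content_swap (n k : nat) (psi : {ffun 'I_n -> 'I_k}) (i j : 'I_n) :
  same_content (swap_positions i j psi) psi.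
Proof.
move=> v; rewrite -(on_card_preimset (f := tperm i j) (R := [pred x | psi x == v])).
  by apply: eq_card => x; rewrite !inE ffunE.
by exists (tperm i j) => x _; rewrite tpermK.
Qed.

(** The exchange is found greedily from the first disagreement i0: j is the first later place whose
    value in psi lies in (psi i0, omega i0], and i is the last place before j carrying the value psi
    i0. Minimality of j and maximality of i rule out intermediate values, repeated ones included. *)
Lemma bruhat_step (n k : nat) (psi omega : {ffun 'I_n -> 'I_k}) :
  same_content psi omega -> bruhat_le psi omega -> psi <> omega ->
  exists i j : 'I_n, [/\ (i < j)%N, (psi i < psi j)%N,
    forall m : 'I_n, (i < m < j)%N -> ~~ (psi i <= psi m <= psi j)%N &
    bruhat_le (swap_positions i j psi) omega].
Proof.
move=> sc le ne.
have [i0 ni0 min0] : exists2 i0 : 'I_n, psi i0 != omega i0 &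
    forall x : 'I_n, (x < i0)%N -> psi x = omega x.
  have [x nx] : exists x, psi x != omega x.
    apply/existsP; rewrite -negb_forall; apply/negP => /forallP h.
    by apply: ne; apply/ffunP => x; apply/eqP/h.
  case: (arg_minnP (P := fun x => psi x != omega x) (fun x : 'I_n => x : nat) nx) => i Pi mini.
  exists i => // y yi; apply/eqP; apply: contraLR yi => /mini.
  by rewrite -leqNgt.
have lt0 : (psi i0 < omega i0)%N.
  have := le i0 (psi i0); rewrite !rkE (bigD1 i0) //= [leqRHS](bigD1 i0) //=.
  set a := (\sum_(x < n | _) _)%N; set b := (\sum_(x < n | _) _)%N.
  have -> : a = b.
    apply: eq_bigr => x xi0; case: (ltnP x i0) => h.
      by rewrite ltnS (ltnW h) (min0 _ h).
    have : (i0 < x)%N by rewrite ltn_neqAle h andbT eq_sym.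
    by rewrite ltnNge ltnS => /negbTE ->.
  rewrite ltnS leqnn /= leq_add2r leqnn /= lt0b.
  by move: ni0; rewrite -(inj_eq val_inj) /=; lia.
(* The value omega i0 must occur in psi after i0, since otherwise psi would contain it fewer times
   than omega. *)
have [j1 ij1 pj1] : exists2 j : 'I_n, (i0 < j)%N & psi j = omega i0.
  apply: contrapT => hno.
  have : [pred x | psi x == omega i0] \proper [pred x | omega x == omega i0].
    apply/properP; split.
      apply/fintype.subsetP => x; rewrite !inE => /eqP px.
      case: (ltngtP x i0) => h.
      - by rewrite -min0 // px.
      - by case: hno; exists x.
      - by rewrite (val_inj h).
    by exists i0; rewrite !inE.
  by move/proper_card; rewrite sc ltnn.
pose Pj (j : 'I_n) := (i0 < j)%N && (psi i0 < psi j <= omega i0)%N.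
have Pj1 : Pj j1 by rewrite /Pj ij1 pj1 lt0 leqnn.
case: (arg_minnP (P := Pj) (fun x : 'I_n => x : nat) Pj1) => j Pjj minj.
have [i0j /andP[pij pjo]] := andP Pjj.
pose Pi (i : 'I_n) := (i0 <= i < j)%N && (psi i == psi i0).
have Pi0 : Pi i0 by rewrite /Pi leqnn i0j eqxx.
case: (arg_maxnP (P := Pi) (fun x : 'I_n => x : nat) Pi0) => i Pii maxi.
have /andP[/andP[i0i ij] /eqP pii] := Pii.
have gapj (m : 'I_n) : (i0 < m < j)%N -> ~~ (psi i0 < psi m <= omega i0)%N.
  move=> /andP[h1 h2]; apply/negP => h3.
  have /minj : Pj m by rewrite /Pj h1 h3.
  by rewrite leqNgt h2.
exists i, j; split => //; first by rewrite pii.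
  move=> m /andP[im mj]; apply/negP; rewrite pii => /andP[h1 h2].
  have := gapj m; rewrite mj andbT (leq_ltn_trans i0i im) => /(_ isT).
  have /eqP pne : psi m != psi i0.
    apply/negP => h; have /maxi : Pi m by rewrite /Pi h mj (leq_trans i0i) // ltnW.
    by rewrite /geq /= leqNgt im.
  have : (psi m : nat) <> psi i0 by move=> E; apply: pne; apply: val_inj.
  by lia.
have lij : (psi i < psi j)%N by rewrite pii.
move=> p q; apply: (leq_trans (@rk_swap_le n k psi i j p q ij lij)).
rewrite pii.
case: (boolP ((i <= p)%N && (p < j)%N && (psi i0 < q)%N && (q <= psi j)%N)) => [|_];
  last by rewrite addn0.
move=> /andP[/andP[/andP[ip pj] aq] qb]; rewrite addn1.
(* Only the positions from i0 to p matter, as the two words agree before i0. *)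
pose T (tau : {ffun 'I_n -> 'I_k}) (r : nat) :=
  (\sum_(x < n) ((i0 <= x <= p)%N && (r <= tau x)%N : nat))%N.
pose H (tau : {ffun 'I_n -> 'I_k}) (r : nat) :=
  (\sum_(x < n) ((x < i0)%N && (r <= tau x)%N : nat))%N.
have HT tau r : rk tau p.+1 r = (H tau r + T tau r)%N.
  rewrite rkE /H /T -big_split /=; apply: eq_bigr => x _.
  by rewrite ltnS; lia.
have HE r : H psi r = H omega r.
  by apply: eq_bigr => x _; case: ltnP => // h; rewrite min0.
rewrite !HT HE ltn_add2l.
(* No value of psi on these positions lies in [q, omega i0], so the threshold can rise to omega i0 +
   1 at no loss for psi, whereas omega loses the position i0. This is the strict slack. *)
have T1 : T psi q = T psi (omega i0).+1.
  apply: eq_bigr => x _; case: (boolP (i0 <= x <= p)%N) => //= /andP[h1 h2].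
  have : x = i0 \/ (i0 < x < j)%N.
    by case: (ltngtP i0 x) h1 => // h _; [right; lia|left; apply: val_inj].
  by move=> [->|/gapj]; lia.
have T2 : (T psi (omega i0).+1 <= T omega (omega i0).+1)%N.
  case: (ltnP (omega i0).+1 k) => hk.
    have := le p (Ordinal hk).
    by rewrite (HT psi (Ordinal hk)) (HT omega (Ordinal hk)) /= HE leq_add2l.
  rewrite /T big1 // => x _.
  have : (psi x < k)%N by [].
  by lia.
rewrite T1; apply: leq_ltn_trans T2 _.
rewrite /T (bigD1 i0) //= [ltnRHS](bigD1 i0) //=.
rewrite leqnn (leq_trans i0i ip) /= ltnn add0n (leq_trans qb pjo) add1n ltnS.
by apply: leq_sum => x _; lia.
Qed.

Lemma in_SnI_same_content (n k : nat) (I : 'I_k -> nat) (tau ups : {ffun 'I_n -> 'I_k}) :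
  in_SnI I ups -> same_content tau ups -> in_SnI I tau.
Proof.
move=> [surj cnt] sc; split=> v; last first.
  by rewrite card_classical_set [LHS]sc -(cnt v) card_classical_set.
have [x xv] := surj v.
have : (0 < #|[pred i | tau i == v]|)%N.
  by rewrite sc; apply/card_gt0P; exists x; rewrite inE xv.
by move=> /card_gt0P[y]; rewrite inE => /eqP yv; exists y.
Qed.

Lemma in_SnI_content (n k : nat) (I : 'I_k -> nat) (tau ups : {ffun 'I_n -> 'I_k}) :
  in_SnI I tau -> in_SnI I ups -> same_content tau ups.
Proof.
move=> [_ h1] [_ h2] v; have := h1 v; have := h2 v; rewrite !card_classical_set => e2 e1.
by rewrite [LHS]e1 [RHS]e2.
Qed.

(** The exchange supplied by [bruhat_step] is strictly above a and weakly below b, so on a covering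
    edge it equals b. *)
Lemma hasse_edge_inversions (n k : nat) (I : 'I_k -> nat) (a b : {ffun 'I_n -> 'I_k}) :
  in_SnI I a -> in_SnI I b -> hasse_edge I a b -> inversions b = (inversions a).+1.
Proof.
move=> Ia Ib [[le ne] cov].
have [i [j [ij aij gap lec]]] := bruhat_step (in_SnI_content Ia Ib) le ne.
have [cb|cb] := pselect (swap_positions i j a = b); first by rewrite -cb inversions_swap.
case: cov; exists (swap_positions i j a); split; last split => //.
  exact: in_SnI_same_content Ia (same_content_swap _ _ _).
split; first exact: rk_le_swap.
by move=> /ffunP/(_ i); rewrite ffunE tpermL => E; move: aij; rewrite -E ltnn.
Qed.

Lemma hasse_path_inversions (n k : nat) (I : 'I_k -> nat) s (a b : {ffun 'I_n -> 'I_k}) :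
  in_SnI I a -> hasse_path I a s b -> inversions b = (inversions a + size s)%N.
Proof.
elim: s a => [|x s IH] a Ia /=; first by move=> ->; rewrite addn0.
by move=> [Ix [/(hasse_edge_inversions Ia Ix) E /(IH _ Ix) ->]]; rewrite E addSnnS.
Qed.

Lemma rk_ltS (n k : nat) (tau : {ffun 'I_n -> 'I_k}) (p : 'I_n) (q : 'I_k) :
  rk tau p.+1 q = (rk tau p q + (q <= tau p))%N.
Proof.
rewrite !rkE (bigD1 p) //= [in RHS](bigD1 p) //= ltnn ltnS leqnn /= addnC.
congr (_ + _)%N; apply: eq_bigr => x xp; rewrite ltnS leq_eqVlt.
by move: xp; rewrite -(inj_eq val_inj) => /negbTE ->.
Qed.

Lemma bruhat_le_anti (n k : nat) (psi omega : {ffun 'I_n -> 'I_k}) :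
  bruhat_le psi omega -> bruhat_le omega psi -> psi = omega.
Proof.
move=> h1 h2.
have E p q : (p <= n)%N -> rk psi p q = rk omega p q.
  case: p => [_|p pn]; first by rewrite !rkE !big1.
  by apply/eqP; rewrite eqn_leq (h1 (Ordinal pn) q) (h2 (Ordinal pn) q).
apply/ffunP => p; apply/val_inj/eqP; rewrite eqn_leq.
have H (q : 'I_k) : (q <= psi p)%N = (q <= omega p)%N.
  move: (ltnW (ltn_ord p)) (ltn_ord p) => /(E _ q) E1 /(E _ q).
  by rewrite !rk_ltS E1 => /addnI; case: (q <= psi p)%N; case: (q <= omega p)%N.
by rewrite -H leqnn H leqnn.
Qed.

(** * Triangular patterns and factorizations *)

Section Patterns.
Variables (F : fieldType) (n : nat).
Implicit Types (f h e : 'I_n -> nat) (A B : 'M[F]_n) (P : pred 'I_n).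

(** Rows are graded by [f] and columns by [h]. Equal injective gradings give triangular matrices,
    equal gradings with ties give block triangular ones, and two different gradings describe maps
    between coordinate flags. *)
Definition pat f h A := forall i j, (f i < h j)%N -> A i j = 0.

Lemma pat_mul f e h A B : pat f e A -> pat e h B -> pat f h (A *m B).
Proof.
move=> pA pB i j fh; rewrite mxE big1 // => m _.
have [hm|hm] := ltnP (f i) (e m); first by rewrite pA // mul0r.
by rewrite pB ?mulr0 // (leq_ltn_trans hm).
Qed.

Lemma pat_add f h A B : pat f h A -> pat f h B -> pat f h (A + B).
Proof. by move=> pA pB i j ij; rewrite mxE pA // pB // addr0. Qed.

Lemma pat_opp f h A : pat f h A -> pat f h (- A).
Proof. by move=> pA i j ij; rewrite mxE pA // oppr0. Qed.

Lemma pat_diag f (d : 'rV[F]_n) : pat f f (diag_mx d).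
Proof.
move=> i j ij; rewrite mxE; case: eqP => [E|]; last by rewrite mulr0n.
by move: ij; rewrite E ltnn.
Qed.

Lemma pat1 f : pat f f 1%:M.
Proof. by rewrite -diag_const_mx; exact: pat_diag. Qed.

Lemma unitmx_of_ker A : (forall y : 'cV_n, A *m y = 0 -> y = 0) -> A \in unitmx.
Proof.
move=> kA; rewrite -unitmx_tr -row_free_unit; apply: inj_row_free => v vA.
by apply: trmx_inj; rewrite trmx0; apply: kA; apply: trmx_inj; rewrite trmx_mul trmxK trmx0.
Qed.

Lemma unitmx_ker A (y : 'cV_n) : A \in unitmx -> A *m y = 0 -> y = 0.
Proof. by move=> uA yA; rewrite -(mulKmx uA y) yA mulmx0. Qed.

Lemma unitmx_left A B : A *m B = 1%:M -> A \in unitmx /\ invmx A = B.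
Proof.
move=> AB; have [uA _] := mulmx1_unit AB; split=> //.
by rewrite -[LHS]mulmx1 -AB mulKmx.
Qed.

(** Its determinant is the principal minor of [A] outside [P]; this form expresses nonvanishing
    minors without matrices of varying size. *)
Definition mixrows P A : 'M[F]_n :=
  \matrix_(a, b) if P a then (a == b)%:R else A a b.

Lemma mixrows_mul P A m (Y : 'M[F]_(n, m)) a c :
  (mixrows P A *m Y) a c = if P a then Y a c else (A *m Y) a c.
Proof.
rewrite mxE; under eq_bigr do rewrite mxE; case: ifP => Pa; last by rewrite mxE.
by rewrite (bigD1 a) //= eqxx mul1r big1 ?addr0 // => b /negbTE ba; rewrite eq_sym ba mul0r.
Qed.

Lemma mixrows_unit P A :
  (forall y : 'cV_n, (forall a, P a -> y a 0 = 0) ->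
     (forall a, ~~ P a -> (A *m y) a 0 = 0) -> y = 0) -> mixrows P A \in unitmx.
Proof.
move=> h; apply: unitmx_of_ker => y /matrixP y0.
apply: h => a Pa; have := y0 a 0; rewrite mixrows_mul [X in _ = X -> _]mxE.
  by rewrite Pa.
by rewrite (negbTE Pa).
Qed.

Lemma mixrows_ker P A (y : 'cV_n) : mixrows P A \in unitmx ->
  (forall a, P a -> y a 0 = 0) -> (forall a, ~~ P a -> (A *m y) a 0 = 0) -> y = 0.
Proof.
move=> u h1 h2; apply: (unitmx_ker u); apply/matrixP => a b.
by rewrite (ord1 b) mixrows_mul [RHS]mxE; case: ifP => Pa; [exact: h1|apply: h2; rewrite Pa].
Qed.

Lemma mixrows1 P : mixrows P 1%:M = 1%:M.
Proof. by apply/matrixP => a b; rewrite !mxE; case: ifP. Qed.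

(** Since [f] may have ties, [A] is only block triangular. Its diagonal block on the levels at least
    f j is invertible, and the part of row i of the inverse that lies there is annihilated by this
    block. *)
Lemma pat_inv f A : A \in unitmx -> pat f f A -> pat f f (invmx A).
Proof.
move=> uA pA i j ij; pose P b := (f b < f j)%N; set B := invmx A.
have uP : mixrows P A \in unitmx.
  apply: mixrows_unit => y y0 Ay0; apply: (unitmx_ker uA).
  apply/matrixP => a b; rewrite (ord1 b) [RHS]mxE; have [Pa|Pa] := boolP (P a); last exact: Ay0.
  rewrite mxE big1 // => m _; have [Pm|Pm] := boolP (P m); first by rewrite y0 ?mulr0.
  by rewrite pA ?mul0r // (leq_trans Pa) // leqNgt.
(* The entries of z inside [P] are chosen so that the product with [mixrows P A] vanishes on the
   columns of [P] too. *)
pose z : 'rV_n := \row_b if P b then - \sum_(a | ~~ P a) B i a * A a b else B i b.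
suff z0 : z = 0 by move: z0 => /matrixP/(_ 0 j); rewrite !mxE /P ltnn.
rewrite -[z](mulmxK uP); suff -> : z *m mixrows P A = 0 by rewrite mul0mx.
apply/matrixP => a b; rewrite (ord1 a) [RHS]mxE mxE (bigID P) /=.
have [Pb|Pb] := boolP (P b).
  rewrite (bigD1 b) //= [X in _ + X + _]big1 ?addr0; last first.
    by move=> m /andP[Pm mb]; rewrite mxE [X in _ * X]mxE Pm (negbTE mb) mulr0.
  rewrite !mxE Pb eqxx mulr1 -[RHS](addNr (\sum_(a | ~~ P a) B i a * A a b)); congr (_ + _).
  by apply: eq_bigr => m /negbTE Pm; rewrite !mxE Pm.
rewrite big1 ?add0r; last first.
  move=> m Pm; rewrite [X in _ * X]mxE Pm; case: eqP => [E|]; last by rewrite mulr0.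
  by move: Pb; rewrite -E Pm.
have /matrixP/(_ i b) := mulVmx uA; rewrite !mxE (bigID P) /= big1 ?add0r; last first.
  by move=> m Pm; rewrite pA ?mulr0 // (leq_trans Pm) // leqNgt.
have /negbTE -> : i != b by apply: contra Pb => /eqP <-.
by rewrite mulr0n => H; rewrite -[RHS]H; apply: eq_bigr => m /negbTE Pm; rewrite !mxE Pm.
Qed.

Lemma pat_perm f h A (s : 'S_n) : (forall i, f i = h (s i)) ->
  pat f h A -> pat f f (col_perm s A).
Proof. by move=> fh pA i j ij; rewrite mxE pA // -fh. Qed.

Lemma pat_inv_perm f h A (s : 'S_n) : (forall i, f i = h (s i)) ->
  A \in unitmx -> pat f h A -> pat h f (invmx A).
Proof.
move=> fh uA pA; have p := pat_perm fh pA.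
have us : perm_mx s^-1 \in @unitmx F n by exact: unitmx_perm.
have ucp : col_perm s A \in unitmx by rewrite col_permE unitmx_mul uA.
have AB : A *m (perm_mx s^-1 *m invmx (col_perm s A)) = 1%:M.
  by rewrite mulmxA -col_permE mulmxV.
rewrite (unitmx_left AB).2 -row_permE => i j ij; rewrite mxE.
by apply: pat_inv ucp p _ _ _; rewrite fh permKV.
Qed.

(** Agrees with [invmx] on invertible matrices, but is a single rational formula without case
    distinction, so continuity and differentiability pass through it. *)
Definition cramer A := (\det A)^-1 *: \adj A.

Lemma cramerE A : A \in unitmx -> cramer A = invmx A.
Proof. by rewrite /invmx => ->. Qed.

(* Solving for one column at a time yields a triangular right factor N with
   g N unitriangular of the opposite type. *)
Definition tri_factor (e : 'I_n -> nat) A : 'M[F]_n :=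
  \matrix_(i, j) cramer (mixrows [pred a | e a < e j]%N A) i j.

Lemma col_tri_factor e A j : mixrows [pred a | e a < e j]%N A \in unitmx ->
  mixrows [pred a | e a < e j]%N A *m col j (tri_factor e A) = col j 1%:M.
Proof.
move=> u; have -> : col j (tri_factor e A) =
    cramer (mixrows [pred a | (e a < e j)%N] A) *m col j 1%:M.
  by rewrite [in RHS]colE mul1mx -colE; apply/matrixP => a b; rewrite !mxE.
by rewrite cramerE // mulKVmx.
Qed.

Lemma tri_factor_pat e A : (forall j, mixrows [pred a | e a < e j]%N A \in unitmx) ->
  pat e e (tri_factor e A).
Proof.
move=> u i j ij; have /matrixP/(_ i 0) := col_tri_factor (u j).
rewrite mixrows_mul /= ij !mxE => ->; case: eqP => // E.
by move: ij; rewrite E ltnn.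
Qed.

Lemma tri_factor_mul e A : (forall j, mixrows [pred a | e a < e j]%N A \in unitmx) ->
  forall i j, (e j <= e i)%N -> (A *m tri_factor e A) i j = (i == j)%:R.
Proof.
move=> u i j ij; have /matrixP/(_ i 0) := col_tri_factor (u j).
by rewrite mixrows_mul /= ltnNge ij /= colE mulmxA -colE [LHS]mxE => ->; rewrite !mxE.
Qed.

(* The factorization A = U W with U, W of opposite triangular types makes the
   corresponding minors of A nonzero. *)
Lemma mixrows_UL e e' U W (p : nat) : (forall i j, (e i < e j)%N -> (e' j < e' i)%N) ->
  U \in unitmx -> W \in unitmx -> pat e' e' U -> pat e e W ->
  mixrows [pred a | e a < p]%N (U *m W) \in unitmx.
Proof.
move=> ee' uU uW pU pW; apply: mixrows_unit => y y0 Ay0.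
have Wy a : (e a < p)%N -> (W *m y) a 0 = 0.
  move=> ap; rewrite mxE big1 // => m _.
  have [am|ma] := ltnP (e a) (e m); first by rewrite pW ?mul0r.
  by rewrite y0 ?mulr0 //= (leq_ltn_trans ma).
apply: (unitmx_ker uW); rewrite -(mulKmx uU (W *m y)).
apply/matrixP => a b; rewrite (ord1 b) [RHS]mxE.
have [ap|ap] := ltnP (e a) p; first by rewrite mulKmx // Wy.
rewrite mxE big1 // => m _; have [mp|mp] := ltnP (e m) p; last first.
  by rewrite [X in _ * X](_ : _ = 0) ?mulr0 // mulmxA Ay0 //= -leqNgt.
by rewrite (pat_inv uU pU) ?mul0r // ee' // (leq_trans mp).
Qed.

End Patterns.

(** * Continuity and differentiability of matrix-valued functions *)

(* Closure properties shared by continuity and by differentiability at x0, so that one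
   argument gives both for the entries of Gram-Schmidt factors. *)
Record regular_class (R : realType) (T : Type) (x0 : T) (good : (T -> R) -> Prop) : Prop := {
  reg_cst : forall c, good (fun=> c);
  reg_add : forall f g, good f -> good g -> good (fun x => f x + g x);
  reg_mul : forall f g, good f -> good g -> good (fun x => f x * g x);
  reg_inv : forall f, good f -> f x0 != 0 -> good (fun x => (f x)^-1);
  reg_sqrt : forall f, good f -> 0 < f x0 -> good (fun x => Num.sqrt (f x)) }.

Lemma regular_class_continuous (R : realType) (T : topologicalType) (x0 : T) :
  regular_class x0 (fun f : T -> R => {for x0, continuous f}).
Proof.
split.
- by move=> c; exact: cvg_cst.
- by move=> f g cf cg; exact: cvgD.
- by move=> f g cf cg; exact: cvgM.
- by move=> f cf f0; exact: cvgV.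
- by move=> f cf f0; apply: continuous_comp => //; exact: sqrt_continuous.
Qed.

Lemma regular_class_derivable (R : realType) (x0 : R) :
  regular_class x0 (fun f : R -> R => derivable f x0 1).
Proof.
split.
- by move=> c; exact: derivable_cst.
- by move=> f g cf cg; exact: derivableD.
- by move=> f g cf cg; exact: (derivableM cf cg).
- by move=> f cf f0; exact: derivableV.
- move=> f cf f0; apply/derivable1_diffP; apply: differentiable_comp.
    by apply/derivable1_diffP.
  apply/derivable1_diffP; exact: (@ex_derive _ _ _ _ _ _ _ (is_derive1_sqrt f0)).
Qed.

Section RegularEntries.
Variables (R : realType) (T : Type) (x0 : T) (good : (T -> R) -> Prop).
Hypothesis G : regular_class x0 good.

Definition good_mx m n (A : T -> 'M[R]_(m, n)) := forall i j, good (fun t => A t i j).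

Lemma good_ext f g : f =1 g -> good f -> good g.
Proof. by move=> /funext ->. Qed.

Lemma good_sum (I : Type) (r : seq I) (P : pred I) (f : I -> T -> R) :
  (forall i, good (f i)) -> good (fun t => \sum_(i <- r | P i) f i t).
Proof.
move=> gf; elim: r => [|i r IH].
  by apply: good_ext (reg_cst G 0) => t; rewrite big_nil.
case: (boolP (P i)) => Pi.
  by apply: good_ext (reg_add G (gf i) IH) => t; rewrite big_cons Pi.
by apply: good_ext IH => t; rewrite big_cons (negbTE Pi).
Qed.

Lemma good_prod (I : Type) (r : seq I) (P : pred I) (f : I -> T -> R) :
  (forall i, good (f i)) -> good (fun t => \prod_(i <- r | P i) f i t).
Proof.
move=> gf; elim: r => [|i r IH].
  by apply: good_ext (reg_cst G 1) => t; rewrite big_nil.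
case: (boolP (P i)) => Pi.
  by apply: good_ext (reg_mul G (gf i) IH) => t; rewrite big_cons Pi.
by apply: good_ext IH => t; rewrite big_cons (negbTE Pi).
Qed.

Lemma good_cmx m n (A : 'M[R]_(m, n)) : good_mx (fun=> A).
Proof. by move=> i j; exact: (reg_cst G). Qed.

Lemma good_addmx m n (A B : T -> 'M[R]_(m, n)) :
  good_mx A -> good_mx B -> good_mx (fun t => A t + B t).
Proof.
by move=> gA gB i j; apply: good_ext (reg_add G (gA i j) (gB i j)) => t; rewrite mxE.
Qed.

Lemma good_mulmx m n p (A : T -> 'M[R]_(m, n)) (B : T -> 'M[R]_(n, p)) :
  good_mx A -> good_mx B -> good_mx (fun t => A t *m B t).
Proof.
move=> gA gB i j; have h k := reg_mul G (gA i k) (gB k j).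
by apply: good_ext (good_sum _ xpredT h) => t; rewrite mxE.
Qed.

Lemma good_trmx m n (A : T -> 'M[R]_(m, n)) : good_mx A -> good_mx (fun t => (A t)^T).
Proof. by move=> gA i j; apply: good_ext (gA j i) => t; rewrite mxE. Qed.

Lemma good_det n (A : T -> 'M[R]_n) : good_mx A -> good (fun t => \det (A t)).
Proof.
move=> gA; apply: good_sum => s; apply: (reg_mul G) => //; first exact: (reg_cst G).
by apply: good_prod => i; exact: gA.
Qed.

Lemma good_cramer n (A : T -> 'M[R]_n) : good_mx A -> A x0 \in unitmx ->
  good_mx (fun t => cramer (A t)).
Proof.
move=> gA; rewrite unitmxE unitfE => u i j.
have gd := reg_inv G (good_det gA) u.
have gc : good (fun t => cofactor (A t) j i).
  apply: (reg_mul G) => //; first exact: (reg_cst G).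
  apply: good_det => a b; apply: good_ext (gA (lift j a) (lift i b)) => t.
  by rewrite !mxE.
by apply: good_ext (reg_mul G gd gc) => t; rewrite !mxE.
Qed.

Lemma good_mixrows n (P : pred 'I_n) (A : T -> 'M[R]_n) :
  good_mx A -> good_mx (fun t => mixrows P (A t)).
Proof.
move=> gA i j; case: (boolP (P i)) => Pi.
  by apply: good_ext (reg_cst G (i == j)%:R) => t; rewrite mxE Pi.
by apply: good_ext (gA i j) => t; rewrite mxE (negbTE Pi).
Qed.

Lemma good_tri_factor n (e : 'I_n -> nat) (A : T -> 'M[R]_n) : good_mx A ->
  (forall j, mixrows [pred a | e a < e j]%N (A x0) \in unitmx) ->
  good_mx (fun t => tri_factor e (A t)).
Proof.
move=> gA u i j; have h := good_cramer (good_mixrows _ gA) (u j).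
by apply: good_ext (h i j) => t; rewrite !mxE.
Qed.

End RegularEntries.

(** * Gram-Schmidt orthogonalization by triangular factorization *)

Section GramSchmidt.
Variables (R : realType) (n : nat) (e e' : 'I_n -> nat).
Hypothesis einj : injective e.
Hypothesis ee' : forall i j, (e i < e j)%N = (e' j < e' i)%N.
Implicit Types A S : 'M[R]_n.

(* For S = A A^T this is the triangular matrix N such that N A is orthogonal. *)
Definition gram_schmidt S : 'M[R]_n :=
  \matrix_(i, j) (tri_factor e' S j i * (Num.sqrt (tri_factor e' S i i))^-1).

Lemma dotmx_eq0 m (y : 'cV[R]_m) : (y^T *m y) 0 0 = 0 -> y = 0.
Proof.
rewrite mxE => /eqP; rewrite psumr_eq0; last by move=> i _; rewrite mxE -expr2 sqr_ge0.
move=> /allP h; apply/matrixP => i j; rewrite (ord1 j) [RHS]mxE.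
by have := h i (mem_index_enum _); rewrite mxE -expr2 sqrf_eq0 => /eqP.
Qed.

Lemma gram_ker A (y : 'cV_n) : A \in unitmx -> (y^T *m (A *m A^T) *m y) 0 0 = 0 -> y = 0.
Proof.
move=> uA h; apply: (@unitmx_ker _ _ A^T); first by rewrite unitmx_tr.
by apply: dotmx_eq0; rewrite trmx_mul trmxK !mulmxA in h *.
Qed.

Lemma gram_mixrows_unit A P : A \in unitmx -> mixrows P (A *m A^T) \in unitmx.
Proof.
move=> uA; apply: mixrows_unit => y y0 Sy0; apply: (gram_ker uA).
rewrite -mulmxA mxE big1 // => a _; rewrite mxE.
by have [Pa|Pa] := boolP (P a); [rewrite y0 ?mul0r|rewrite Sy0 ?mulr0].
Qed.

Lemma col_quad S (B : 'M[R]_n) i : ((col i B)^T *m S *m col i B) 0 0 = (B^T *m S *m B) i i.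
Proof.
by rewrite tr_col -row_mul [X in _ *m X]colE mulmxA -row_mul -colE 2!mxE.
Qed.

Section Spec.
Variable A : 'M[R]_n.
Hypothesis uA : A \in unitmx.
Let S := A *m A^T.
Let N' := tri_factor e' S.

Let St : S^T = S.
Proof. by rewrite /S trmx_mul trmxK. Qed.

Let uS j : mixrows [pred a | e' a < e' j]%N S \in unitmx.
Proof. exact: gram_mixrows_unit. Qed.

Let pN' i j : (e j < e i)%N -> N' i j = 0.
Proof. by rewrite ee' => h; apply: (tri_factor_pat uS). Qed.

Let SN' i j : (e i <= e j)%N -> (S *m N') i j = (i == j)%:R.
Proof. by rewrite leqNgt ee' -leqNgt => h; apply: (tri_factor_mul uS). Qed.

(** [S *m N'] and [N'^T] are triangular of the same type, hence so is their product N'^T S N';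
    symmetry will then make it diagonal. *)
Let D_lt i j : (e i <= e j)%N -> (N'^T *m S *m N') i j = (i == j)%:R * N' i i.
Proof.
move=> ij; rewrite -mulmxA mxE (bigD1 i) //= mxE SN' // mulrC.
rewrite big1 ?addr0 // => m mi; rewrite mxE.
have [h|h] := ltnP (e i) (e m); first by rewrite pN' ?mul0r.
have : (e m < e i)%N by rewrite ltn_neqAle h andbT (inj_eq einj).
move=> h'; rewrite SN' ?(leq_trans h) //.
case: eqP => [E|]; last by rewrite mulr0.
by move: ij; rewrite -E leqNgt h'.
Qed.

Let Dsym : (N'^T *m S *m N')^T = N'^T *m S *m N'.
Proof. by rewrite trmx_mul [(N'^T *m S)^T]trmx_mul trmxK St mulmxA. Qed.

Let D_eq i j : (N'^T *m S *m N') i j = (i == j)%:R * N' i i.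
Proof.
have [ij|ij] := leqP (e i) (e j); first exact: D_lt.
rewrite -Dsym mxE D_lt ?(ltnW ij) //.
case: (altP (i =P j)) => [->|ne]; first by rewrite eqxx.
by rewrite eq_sym (negbTE ne) !mul0r.
Qed.

(** The diagonal entry is the value of the positive form [S] at a column of [N'], and this column is
    nonzero because [S *m N'] has diagonal 1. *)
Let N'pos i : 0 < N' i i.
Proof.
have E : N' i i = ((col i N')^T *m S *m col i N') 0 0.
  by rewrite col_quad D_eq eqxx mul1r.
rewrite lt_def {2}E; apply/andP; split; last first.
  rewrite /S !mulmxA -mulmxA -{1}[A]trmxK -trmx_mul mxE; apply: sumr_ge0 => m _.
  by rewrite mxE -expr2 sqr_ge0.
apply/eqP => N0; have c0 : col i N' = 0 by apply: (gram_ker uA); rewrite -E.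
have := SN' (leqnn (e i)); rewrite eqxx mxE big1; first by move/eqP; rewrite eq_sym oner_eq0.
by move=> m _; move/matrixP/(_ m 0): c0; rewrite !mxE => ->; rewrite mulr0.
Qed.

Lemma gram_schmidt_pat : pat e e (gram_schmidt S).
Proof. by move=> i j ij; rewrite mxE -/N' pN' ?mul0r. Qed.

Lemma gram_schmidt_diag i : 0 < gram_schmidt S i i.
Proof. by rewrite mxE -/N' divr_gt0 // sqrtr_gt0. Qed.

Lemma gram_schmidt_orth : (gram_schmidt S *m A) *m (gram_schmidt S *m A)^T = 1%:M.
Proof.
pose d := \row_i (Num.sqrt (N' i i))^-1.
have dE x : d 0 x = (Num.sqrt (N' x x))^-1 by rewrite mxE.
have -> : gram_schmidt S = diag_mx d *m N'^T.
  by apply/matrixP => i j; rewrite mul_diag_mx !mxE mulrC.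
rewrite !trmx_mul trmxK tr_diag_mx -!mulmxA (mulmxA A) -/S (mulmxA S) (mulmxA N'^T) (mulmxA N'^T).
rewrite mulmxA; apply/matrixP => i j; rewrite mul_mx_diag mxE mul_diag_mx mxE D_eq !dE [RHS]mxE.
case: (altP (i =P j)) => [->|ne]; last by rewrite mul0r mulr0 mul0r.
rewrite mul1r mulrC mulrA -invfM -expr2 sqr_sqrtr ?(ltW (N'pos _)) // mulVf // gt_eqF //;
  exact: N'pos.
Qed.

End Spec.

Lemma gram_schmidt1 : gram_schmidt 1%:M = 1%:M.
Proof.
have E : tri_factor e' (1%:M : 'M[R]_n) = 1%:M.
  by apply/matrixP => i j; rewrite mxE mixrows1 cramerE ?unitmx1 // invmx1.
apply/matrixP => i j; rewrite mxE E !mxE eqxx sqrtr1 invr1 mulr1.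
by rewrite eq_sym.
Qed.

Lemma good_gram_schmidt (T : Type) (x0 : T) (good : (T -> R) -> Prop)
    (G : regular_class x0 good) (A : T -> 'M[R]_n) :
  A x0 \in unitmx -> good_mx good A -> good_mx good (fun t => gram_schmidt (A t *m (A t)^T)).
Proof.
move=> uA gA i j.
have uS j' : mixrows [pred a | e' a < e' j']%N (A x0 *m (A x0)^T) \in unitmx.
  exact: gram_mixrows_unit.
have gN := good_tri_factor G (good_mulmx G gA (good_trmx gA)) uS.
have : good (fun t => (tri_factor e' (A t *m (A t)^T)) j i *
    (Num.sqrt (tri_factor e' (A t *m (A t)^T) i i))^-1).
  apply: (reg_mul G) => //; apply: (reg_inv G).
    by apply: (reg_sqrt G) => //; have := gram_schmidt_diag uA i; rewrite mxE; 
       case: (ltrP 0 (tri_factor e' (A x0 *m (A x0)^T) i i)) => // h;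
         rewrite ler0_sqrtr // invr0 mulr0 ltxx.
  by apply/eqP => E; have := gram_schmidt_diag uA i; rewrite mxE E invr0 mulr0 ltxx.
by move=> h; apply: good_ext h => t; rewrite [RHS]mxE.
Qed.

End GramSchmidt.

Lemma invmx_orth (F : fieldType) n (P : 'M[F]_n) : P *m P^T = 1%:M -> P \in unitmx /\ invmx P = P^T.
Proof. by move=> /unitmx_left. Qed.

Lemma orthT (F : fieldType) n (P : 'M[F]_n) : P *m P^T = 1%:M -> P^T *m P = 1%:M.
Proof. exact: mulmx1C. Qed.

Lemma orth_le1 (R : realDomainType) n (P : 'M[R]_n) i j : P *m P^T = 1%:M -> `|P i j| <= 1.
Proof.
move=> /matrixP/(_ i i); rewrite !mxE eqxx (bigD1 j) //= mxE -expr2 => E.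
rewrite -(@ler_pXn2r _ 2) ?nnegrE // expr1n real_normK ?num_real //.
by rewrite -[leRHS]/(true%:R) -E lerDl; apply: sumr_ge0 => m _; rewrite mxE -expr2 sqr_ge0.
Qed.

(** * Differentiation rules and a scalar linear equation *)

Lemma nonneg_deriv_le (R : realType) (u du : R -> R) (a b : R) :
  (forall t, is_derive t (1 : R) u (du t)) -> (forall t, 0 <= du t) -> a <= b -> u a <= u b.
Proof.
move=> hu du0 ab.
have hd t : derivable u t 1 by apply: ex_derive; exact: hu.
apply: (@ger0_derive1_ndecr _ u a b) => //.
- by move=> x _; rewrite derive1E derive_val.
- apply: continuous_subspaceT => t; apply: differentiable_continuous.
  by apply/derivable1_diffP.
Qed.

Section DeriveRules.
Variables (R : realType) (t : R).
Implicit Types f g : R -> R.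

Lemma isd_mul f g df dg : is_derive t (1 : R) f df -> is_derive t (1 : R) g dg ->
  is_derive t (1 : R) (fun s => f s * g s) (df * g t + f t * dg).
Proof.
move=> hf hg; have h := is_deriveM hf hg; apply: (is_derive_eq h).
by rewrite addrC /GRing.scale /= [X in X + _]mulrC addrC [X in _ + X]mulrC addrC.
Qed.

Lemma isd_sum n (f : 'I_n -> R -> R) df : (forall i, is_derive t (1 : R) (f i) (df i)) ->
  is_derive t (1 : R) (fun s => \sum_i f i s) (\sum_i df i).
Proof.
move=> h; have := is_derive_sum h; congr (is_derive _ _ _ _).
by apply/funext => s; rewrite fct_sumE.
Qed.

Lemma isd_cmul (c : R) f df : is_derive t (1 : R) f df ->
  is_derive t (1 : R) (fun s => c * f s) (c * df).
Proof.
move=> hf; have := isd_mul (is_derive_cst c t (1 : R)) hf.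
by move=> h; apply: (is_derive_eq h); rewrite mul0r add0r.
Qed.

Lemma isd_exp (c : R) : is_derive t (1 : R) (fun s => expR (s * c)) (expR (t * c) * c).
Proof.
have h : is_derive t (1 : R) (fun s => s * c) c.
  by have := isd_mul (is_derive_id t (1 : R)) (is_derive_cst c t (1 : R)) => h;
     apply: (is_derive_eq h); rewrite mul1r mulr0 addr0.
have := @is_derive1_comp _ expR (fun s => s * c) t (expR (t * c)) c (is_derive_expR _) h.
by [].
Qed.

Lemma isd_unique f d1 d2 : is_derive t (1 : R) f d1 -> is_derive t (1 : R) f d2 -> d1 = d2.
Proof. by move=> h1 h2; rewrite -(@derive_val _ _ _ _ _ _ _ h1) -(@derive_val _ _ _ _ _ _ _ h2).
  Qed.

End DeriveRules.

(** Gronwall's argument: y^2 exp(-2Kt) is nonincreasing, y^2 exp(2Kt) is nondecreasing, and both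
    vanish at 0. The former settles t >= 0, the latter t < 0. *)
Lemma linear_ode_zero (R : realType) (y b : R -> R) (K : R) :
  (forall t, is_derive t (1 : R) y (y t * b t)) -> (forall t, `|b t| <= K) -> y 0 = 0 ->
  forall t, y t = 0.
Proof.
move=> hy hb y0 t.
have hu c s : is_derive s (1 : R) (fun s => y s * y s * expR (s * c))
    ((b s *+ 2 + c) * (y s * y s * expR (s * c))).
  apply: (is_derive_eq (isd_mul (isd_mul (hy s) (hy s)) (isd_exp s c))).
  by ring.
have pos s c : 0 <= y s * y s * expR (s * c) by rewrite mulr_ge0 ?expR_ge0 // -expr2 sqr_ge0.
suff [c hc] : exists c, y t * y t * expR (t * c) <= 0.
  have : y t * y t * expR (t * c) == 0 by rewrite eq_le hc pos.
  by rewrite mulf_eq0 (gt_eqF (expR_gt0 _)) orbF -expr2 sqrf_eq0 => /eqP.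
have [t0|t0] := leP 0 t.
  exists (- K *+ 2); rewrite -oppr_ge0.
  have hN s : is_derive s (1 : R) (fun s => - 1 * (y s * y s * expR (s * (- K *+ 2))))
     (-1 * ((b s *+ 2 + (- K *+ 2)) * (y s * y s * expR (s * (- K *+ 2))))).
    exact: isd_cmul.
  have := nonneg_deriv_le hN _ t0; rewrite y0 !mul0r mulr0 mulN1r; apply => s.
  rewrite mulN1r -mulNr; apply: mulr_ge0 => //; have := hb s; rewrite ler_norml => /andP[_ h].
  by rewrite oppr_ge0 mulNrn subr_le0 lerMn2r.
exists (K *+ 2).
have := nonneg_deriv_le (hu (K *+ 2)) _ (ltW t0); rewrite y0 !mul0r; apply => s.
apply: mulr_ge0 => //; have := hb s; rewrite ler_norml => /andP[h _].
by rewrite -mulrnDl mulrn_wge0 // addrC -lerBlDl sub0r.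
Qed.

(* pat (rank_dir b) (rank_dir b) means lower triangular for b = true and upper triangular
   for b = false. *)
Definition rank_dir (n : nat) (b : bool) (i : 'I_n) : nat := if b then (i : nat) else (n - i)%N.

Lemma rank_dir_inj n b : injective (@rank_dir n b).
Proof.
move=> i j; case: b => /= E; apply: val_inj => //=.
by have := ltn_ord i; have := ltn_ord j; lia.
Qed.

Lemma rank_dirC n b (i j : 'I_n) : (rank_dir b i < rank_dir b j)%N =
  (rank_dir (~~ b) j < rank_dir (~~ b) i)%N.
Proof. by case: b => /=; have := ltn_ord i; have := ltn_ord j; lia. Qed.

Lemma rank_dir_le n b (i : 'I_n) : (rank_dir b i <= n)%N.
Proof. by case: b => /=; have := ltn_ord i; lia. Qed.

(** The direction of time in which the limit is governed by the triangular group of direction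
    [b]. *)
Definition time_sign (R : pzRingType) (b : bool) : R := if b then 1 else -1.

Definition expd (R : realType) n (d : 'rV[R]_n) (t : R) : 'M[R]_n :=
  diag_mx (\row_i expR (t * d 0 i)).

Lemma skew_partE (R : realType) n (X : 'M[R]_n) i j :
  (upper_part X - lower_part X) i j = (if (i < j)%N then X i j else 0) - (if (j < i)%N then X i j
    else 0).
Proof. by rewrite mxE [upper_part _ _ _]mxE mxE [lower_part _ _ _]mxE. Qed.

Lemma conjL_orth (R : realType) n (L P : 'M[R]_n) : P *m P^T = 1%:M -> conjL L P = P *m L *m P^T.
Proof. by move=> o; rewrite /conjL (invmx_orth o).2. Qed.

Lemma conjL_sym (R : realType) n (d : 'rV[R]_n) (P : 'M[R]_n) :
  P *m P^T = 1%:M -> (conjL (diag_mx d) P)^T = conjL (diag_mx d) P.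
Proof. by move=> o; rewrite conjL_orth // !trmx_mul trmxK tr_diag_mx mulmxA. Qed.

(** * Integral curves of the Toda field *)

Section Toda.
Variables (R : realType) (n : nat) (d : 'rV[R]_n) (Psi : R -> 'M[R]_n).
Hypothesis curve : integral_curve (diag_mx d) Psi.
Let X t := conjL (diag_mx d) (Psi t).
Let M t := upper_part (X t) - lower_part (X t).

Let orth t : Psi t *m (Psi t)^T = 1%:M.
Proof. by case: curve => /(_ t)[]. Qed.

Let XE t : X t = Psi t *m diag_mx d *m (Psi t)^T.
Proof. exact: conjL_orth. Qed.

Let Xsym t : (X t)^T = X t.
Proof. exact: conjL_sym. Qed.

Let Manti t : (M t)^T = - M t.
Proof.
have Xji i j : X t j i = X t i j by rewrite -{1}Xsym mxE.
apply/matrixP => i j; rewrite mxE [RHS]mxE !skew_partE Xji.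
by case: ltngtP; rewrite ?subr0 ?sub0r ?opprK ?oppr0.
Qed.

(** One strict triangle of X cancels against M and the other doubles; the sign decides which. *)
Let K b t := time_sign R b *: X t - M t.

Let Kpat b t : pat (rank_dir b) (rank_dir b) (K b t).
Proof.
move=> i j; rewrite /K mxE [(- M t) i j]mxE skew_partE mxE; case: b => /=.
  by move=> ij; rewrite ij ltnNge (ltnW ij) /= mul1r subr0 subrr.
move=> h; have ij : (j < i)%N by have := ltn_ord i; have := ltn_ord j; lia.
by rewrite ij ltnNge (ltnW ij) /= mulN1r sub0r opprK addNr.
Qed.

(** A bound uniform in t, available because the entries of an orthogonal matrix are at most 1 in
    absolute value; [linear_ode_zero] requires such a constant. *)
Let Kdiag b t j : `|K b t j j| <= \sum_m `|d 0 m|.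
Proof.
have -> : K b t j j = time_sign R b * X t j j.
  by rewrite /K mxE [(- M t) j j]mxE skew_partE mxE ltnn !subr0.
rewrite normrM (_ : `|time_sign R b| = 1) ?mul1r; last by case: b; rewrite /= ?normrN normr1.
rewrite XE mxE; apply: le_trans (ler_norm_sum _ _ _) _; apply: ler_sum => m _.
rewrite mul_mx_diag mxE !mxE mulrAC normrM -[leRHS]mul1r; apply: ler_wpM2r => //.
by rewrite normrM mulr_ile1 // orth_le1.
Qed.

Definition factor_of b t := Psi 0 *m expd d (time_sign R b * t) *m (Psi t)^T.

Let factor_deriv b t i j :
  is_derive t (1 : R) (fun s => factor_of b s i j) ((factor_of b t *m K b t) i j).
Proof.
set s := time_sign R b.
have -> : (fun u => factor_of b u i j) =
    (fun u => \sum_m (Psi 0 i m * expR (u * (s * d 0 m))) * Psi u j m).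
  apply/funext => u; rewrite mxE; apply: eq_bigr => m _.
  by rewrite mul_mx_diag !mxE -/s (mulrCA u) (mulrA s).
have h m : is_derive t (1 : R) (fun u => (Psi 0 i m * expR (u * (s * d 0 m))) * Psi u j m)
   ((Psi 0 i m * (expR (t * (s * d 0 m)) * (s * d 0 m))) * Psi t j m +
    (Psi 0 i m * expR (t * (s * d 0 m))) * (M t *m Psi t) j m).
  by apply: isd_mul; [apply: isd_cmul; exact: isd_exp|case: curve => _; exact].
apply: (is_derive_eq (isd_sum h)).
have -> : factor_of b t *m K b t =
    Psi 0 *m expd d (s * t) *m (s *: diag_mx d) *m (Psi t)^T +
    Psi 0 *m expd d (s * t) *m (M t *m Psi t)^T.
  rewrite trmx_mul Manti mulmxN mulmxN /K mulmxBr XE -/s -!scalemxAr -!scalemxAl;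
    congr (_ *: _ - _).
    by rewrite /factor_of -/s -!mulmxA (mulmxA (Psi t)^T) (orthT (orth t)) mul1mx.
  by rewrite /factor_of mulmxA.
rewrite mxE big_split /=; congr (_ + _); rewrite mxE; apply: eq_bigr => m _.
  rewrite -scalemxAr [X in _ = X * _]mxE mul_mx_diag [X in _ = (_ * X) * _]mxE mul_mx_diag.
  by rewrite !mxE (mulrCA t) (mulrA s); ring.
by rewrite mul_mx_diag !mxE (mulrCA t) (mulrA s).
Qed.

(** Induction on the columns, starting from the highest rank. In C' = C K only ranks at least that
    of j contribute to the entry (i, j), and the higher ones vanish by induction; what remains is y'
    = y [K b t j j], with y = 0 at time 0 since C starts at the identity. *)
Lemma factor_of_pat b t : pat (rank_dir b) (rank_dir b) (factor_of b t).
Proof.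
suff H N i j : (n - rank_dir b j < N)%N -> (rank_dir b i < rank_dir b j)%N ->
    forall t, factor_of b t i j = 0.
  by move=> i j ij; exact: (H _ i j (ltnSn _)).
elim: N i j => // N IH i j jN ij.
apply: (@linear_ode_zero _ _ (fun t => K b t j j) (\sum_m `|d 0 m|)) => //.
  move=> u; apply: (is_derive_eq (factor_deriv b u i j)).
  rewrite mxE (bigD1 j) //= big1 ?addr0 // => m mj.
  have [mj'|mj'] := ltnP (rank_dir b m) (rank_dir b j); first by rewrite Kpat ?mulr0.
  have jm : (rank_dir b j < rank_dir b m)%N.
    by rewrite ltn_neqAle mj' andbT (inj_eq (@rank_dir_inj _ _)) eq_sym.
  rewrite IH ?mul0r //; last exact: ltn_trans jm.
  by have := rank_dir_le b m; lia.
rewrite /factor_of mulr0 (_ : expd d 0 = 1%:M) ?mulmx1 ?orth ?mxE.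
  by case: eqP => // E; move: ij; rewrite E ltnn.
apply/matrixP => a c; rewrite !mxE; case: eqP => [->|]; rewrite ?mul0r ?expR0 //.
Qed.

End Toda.

Lemma expd_det_gt0 (R : realType) n (d : 'rV[R]_n) t : 0 < \det (expd d t).
Proof. by rewrite det_diag; apply: prodr_gt0 => i _; rewrite mxE expR_gt0. Qed.

Lemma expd_unit (R : realType) n (d : 'rV[R]_n) t : expd d t \in unitmx.
Proof. by rewrite unitmxE unitfE gt_eqF // expd_det_gt0. Qed.

Lemma expd0 (R : realType) n (d : 'rV[R]_n) : expd d 0 = 1%:M.
Proof. by apply/matrixP => a c; rewrite !mxE; case: eqP => [->|]; rewrite ?mul0r ?expR0. Qed.

Lemma mul_expd (R : realType) m n (P : 'M[R]_(m, n)) d t i j :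
  (P *m expd d t) i j = P i j * expR (t * d 0 j).
Proof. by rewrite /expd mul_mx_diag !mxE. Qed.

Lemma orth_det1 (R : realType) n (P : 'M[R]_n) : P *m P^T = 1%:M -> 0 < \det P -> \det P = 1.
Proof.
move=> o p; have : \det P ^+ 2 = 1 by rewrite expr2 -{2}[P]trmxK det_tr -det_mulmx o det1.
move/eqP; rewrite sqrf_eq1 => /orP[/eqP //|/eqP E].
by move: p; rewrite E oppr_gt0 ltr10.
Qed.

Lemma pat_lower_det_gt0 (R : realType) n (N : 'M[R]_n) :
  pat (@rank_dir n true) (rank_dir true) N -> (forall i, 0 < N i i) -> 0 < \det N.
Proof.
move=> pN dN; rewrite det_trig; first exact: prodr_gt0.
by apply/is_trig_mxP => i j ij; exact: pN.
Qed.

(** * Existence of integral curves *)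

Section Existence.
Variables (R : realType) (n : nat) (d : 'rV[R]_n) (P0 : 'M[R]_n).
Hypothesis hP0 : SOn P0.
Let D := diag_mx d.
Let A (t : R) := P0 *m expd d t.
Let N t := gram_schmidt (rank_dir false) (A t *m (A t)^T).

Definition toda_curve (t : R) : 'M[R]_n := N t *m A t.
Notation Psi := toda_curve.

Let uA t : A t \in unitmx.
Proof. by rewrite unitmx_mul expd_unit andbT; exact: (invmx_orth hP0.1).1. Qed.

Let inj := @rank_dir_inj n true.
Let opp (i j : 'I_n) :
  (rank_dir true i < rank_dir true j)%N = (rank_dir false j < rank_dir false i)%N.
Proof. exact: (rank_dirC true). Qed.

Let pN t : pat (rank_dir true) (rank_dir true) (N t).
Proof. exact: (gram_schmidt_pat opp (uA t)). Qed.

Let detN t : 0 < \det (N t).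
Proof. by apply: pat_lower_det_gt0 => // i; exact: (gram_schmidt_diag inj opp (uA t)). Qed.

Let uN t : N t \in unitmx.
Proof. by rewrite unitmxE unitfE gt_eqF. Qed.

Let orth t : Psi t *m (Psi t)^T = 1%:M.
Proof. exact: (gram_schmidt_orth inj opp (uA t)). Qed.

Let SO t : SOn (Psi t).
Proof.
split=> //; apply: orth_det1 => //; rewrite det_mulmx mulr_gt0 //.
by rewrite det_mulmx hP0.2 mul1r expd_det_gt0.
Qed.

Lemma toda_curve0 : Psi 0 = P0.
Proof.
have A0 : A 0 = P0 by rewrite /A expd0 mulmx1.
by rewrite /Psi /N A0 hP0.1 gram_schmidt1 mul1mx.
Qed.

Let dA t i j : is_derive t (1 : R) (fun s => A s i j) ((A t *m D) i j).
Proof.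
have -> : (fun s => A s i j) = (fun s => P0 i j * expR (s * d 0 j)).
  by apply/funext => s; rewrite mul_expd.
apply: (is_derive_eq (isd_cmul _ (isd_exp t (d 0 j)))).
by rewrite /D mul_mx_diag mxE mul_expd mulrA.
Qed.

Let derN t i j : derivable (fun s => N s i j) t 1.
Proof.
apply: (good_gram_schmidt inj opp (regular_class_derivable t)) => //.
by move=> a b; apply: ex_derive; exact: dA.
Qed.

Let dN t : 'M[R]_n := \matrix_(i, j) 'D_1 (fun s => N s i j) t.

Let dNP t i j : is_derive t (1 : R) (fun s => N s i j) (dN t i j).
Proof. by rewrite mxE; apply: derivableP; exact: derN. Qed.

Let pdN t : pat (rank_dir true) (rank_dir true) (dN t).
Proof.
move=> i j ij; apply: (isd_unique (dNP t i j)).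
have -> : (fun s => N s i j) = cst 0 by apply/funext => s; exact: pN.
exact: is_derive_cst.
Qed.

Let dPsi t := dN t *m A t + Psi t *m D.

Let dPsiP t i j : is_derive t (1 : R) (fun s => Psi s i j) (dPsi t i j).
Proof.
have -> : (fun s => Psi s i j) = (fun s => \sum_m N s i m * A s m j).
  by apply/funext => s; rewrite mxE.
apply: (is_derive_eq (isd_sum (fun m => isd_mul (dNP t i m) (dA t m j)))).
by rewrite big_split /= /dPsi /Psi -mulmxA [RHS]mxE; congr (_ + _); rewrite [RHS]mxE.
Qed.

Let K t := dPsi t *m (Psi t)^T.

Let Kanti t i j : K t i j = - K t j i.
Proof.
have h : is_derive t (1 : R) (fun s => \sum_m Psi s i m * Psi s j m) (K t i j + K t j i).
  apply: (is_derive_eq (isd_sum (fun m => isd_mul (dPsiP t i m) (dPsiP t j m)))).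
  rewrite big_split /= !mxE; congr (_ + _); apply: eq_bigr => m _; rewrite [(Psi t)^T _ _]mxE //.
  by rewrite mulrC.
apply/eqP; rewrite -addr_eq0; apply/eqP; apply: (isd_unique h).
have -> : (fun s => \sum_m Psi s i m * Psi s j m) = cst (i == j)%:R.
  apply/funext => s; have /matrixP/(_ i j) := orth s.
  rewrite [X in X = _ -> _]mxE [X in _ = X -> _]mxE /= => <-.
  by apply: eq_bigr => m _; rewrite [(Psi s)^T m j]mxE.
exact: is_derive_cst.
Qed.

Let KE t : K t = dN t *m invmx (N t) + conjL D (Psi t).
Proof.
rewrite (conjL_orth _ (orth t)) /K /dPsi mulmxDl; congr (_ + _).
have -> : A t = invmx (N t) *m Psi t by rewrite /Psi mulKmx.
by rewrite -(mulmxA (dN t)) -(mulmxA (invmx _)) orth mulmx1.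
Qed.

(** The term from N is lower triangular, so above the diagonal only X remains. An antisymmetric
    matrix is determined by its strict upper part, which identifies [K t] with the Toda field. *)
Let Kup t (i j : 'I_n) : (i < j)%N -> K t i j = conjL D (Psi t) i j.
Proof.
move=> ij; rewrite KE mxE [X in X + _](_ : _ = 0) ?add0r //.
by apply: (pat_mul (@pdN t) (pat_inv (uN t) (@pN t))).
Qed.

Lemma toda_curveP : integral_curve D Psi.
Proof.
split=> // t i j; apply: (is_derive_eq (dPsiP t i j)).
have -> : dPsi t = K t *m Psi t by rewrite /K -mulmxA (orthT (orth t)) mulmx1.
rewrite /todaM; congr ((_ *m _) _ _); apply/matrixP => a b; rewrite skew_partE.
have Xsym x y : conjL D (Psi t) y x = conjL D (Psi t) x y.
  by rewrite -{1}(conjL_sym d (orth t)) mxE.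
case: (ltngtP a b) => ab; rewrite ?subr0 ?sub0r.
- exact: Kup.
- by rewrite Kanti Kup // Xsym.
- rewrite (val_inj ab); have := Kanti t b b => /eqP.
  by rewrite -addr_eq0 -mulr2n mulrn_eq0 /= => /eqP.
Qed.

End Existence.

(** * Entrywise convergence of matrices *)

Lemma cvg_mx (R : numFieldType) m n (T : Type) (F : set_system T) (FF : Filter F)
    (f : T -> 'M[R]_(m, n)) (M : 'M[R]_(m, n)) :
  (forall i j, f t i j @[t --> F] --> M i j) -> f t @[t --> F] --> M.
Proof.
move=> h A [P M_P sPA]; rewrite nbhs_simpl /=.
have : \forall t \near F, forall i j, P i j (f t i j).
  apply: filter_forall => i; apply: filter_forall => j.
  exact: (h i j _ (M_P i j)).
by apply: filterS => t ht; apply: sPA.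
Qed.

Lemma cvg_mx_entry (R : numFieldType) m n (T : Type) (F : set_system T) (FF : Filter F)
    (f : T -> 'M[R]_(m, n)) (M : 'M[R]_(m, n)) i j :
  f t @[t --> F] --> M -> f t i j @[t --> F] --> M i j.
Proof. move=> h; apply: (cvg_comp f (fun N : 'M[R]_(m, n) => N i j) h).
exact: (@coord_continuous R m n i j M). Qed.

Lemma cvg_mulmx (R : realType) m n p (T : Type) (F : set_system T) (FF : Filter F)
    (f : T -> 'M[R]_(m, n)) (g : T -> 'M[R]_(n, p)) (A : 'M[R]_(m, n)) (B : 'M[R]_(n, p)) :
  f t @[t --> F] --> A -> g t @[t --> F] --> B -> f t *m g t @[t --> F] --> A *m B.
Proof.
move=> hf hg; apply: cvg_mx => i j; rewrite mxE.
have -> : (fun t => (f t *m g t) i j) = (fun t => \sum_k f t i k * g t k j).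
  by apply/funext => t; rewrite mxE.
apply: cvg_big => [|k _]; first exact: add_continuous.
by apply: cvgM; apply: cvg_mx_entry.
Qed.

Lemma good_mx_continuous (R : realType) (T : topologicalType) (x0 : T) m n
    (A : T -> 'M[R]_(m, n)) :
  good_mx (fun f : T -> R => {for x0, continuous f}) A -> {for x0, continuous A}.
Proof. by move=> h; apply: cvg_mx => i j; exact: h. Qed.

Lemma continuous_good_mx (R : realType) (T : topologicalType) (x0 : T) m n
    (A : T -> 'M[R]_(m, n)) :
  {for x0, continuous A} -> good_mx (fun f : T -> R => {for x0, continuous f}) A.
Proof. by move=> h i j; exact: cvg_mx_entry. Qed.

Lemma cramer_continuous (R : realType) n (M : 'M[R]_n) : M \in unitmx ->
  {for M, continuous (@cramer R n)}.
Proof.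
move=> uM; apply: good_mx_continuous.
apply: (good_cramer (A := id) (regular_class_continuous R M)) => //.
by apply: continuous_good_mx.
Qed.

Lemma det_continuous (R : realType) n : continuous (fun M : 'M[R]_n => \det M).
Proof.
move=> M; apply: (good_det (A := id) (regular_class_continuous R M)) => //.
by apply: continuous_good_mx.
Qed.

Lemma expR_decay (R : realType) (c : R) : c < 0 -> expR (t * c) @[t --> +oo] --> (0 : R).
Proof.
move=> c0; apply/cvgrPdist_lt => e e0.
exists (ln e / c); split; first exact: num_real.
move=> t ht /=; rewrite sub0r normrN gtr0_norm ?expR_gt0 //.
by rewrite -ltr_ln ?posrE ?expR_gt0 // expRK -ltr_ndivrMr.
Qed.

Lemma expR_decay_dir (R : realType) b (c : R) : c < 0 ->
  expR (time_sign R b * t * c) @[t --> if b then +oo else -oo] --> (0 : R).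
Proof.
move=> c0; case: b => /=.
  have -> : (fun t => expR (1 * t * c)) = (fun t => expR (t * c)).
    by apply/funext => t; rewrite mul1r.
  exact: expR_decay.
apply/cvgNy_compNP; have -> : (fun t => expR (-1 * t * c)) \o -%R = (fun t => expR (t * c)).
  by apply/funext => t /=; rewrite mulN1r opprK.
exact: expR_decay.
Qed.

(** * Bruhat cells and limits *)

Definition level (n k : nat) (tau : {ffun 'I_n -> 'I_k}) (i : 'I_n) : nat := tau i.

(* The columns of P, taken modulo matrices that are block triangular for blk, lie in the
   orbit of the coordinate flag tau under the triangular group of direction b. *)
Definition in_cell (F : fieldType) (n k : nat) (b : bool) (blk tau : {ffun 'I_n -> 'I_k})
    (P : 'M[F]_n) : Prop :=
  exists C Y : 'M[F]_n, [/\ C \in unitmx, pat (rank_dir b) (rank_dir b) C, Y \in unitmx,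
    pat (level tau) (level blk) Y & P = C *m Y].

Lemma same_content_perm (n k : nat) (tau ups : {ffun 'I_n -> 'I_k}) :
  same_content tau ups -> exists s : 'S_n, forall i, tau i = ups (s i).
Proof.
move=> sc.
have cnt (f : {ffun 'I_n -> 'I_k}) v : count_mem v [tuple f i | i < n] = #|[pred i | f i == v]|.
  by rewrite /= count_map cardE size_filter enumT; apply: eq_count => x; rewrite /= inE.
have : perm_eq [tuple tau i | i < n] [tuple ups i | i < n].
  by apply/allP => v _; rewrite /= !cnt sc.
move=> /tuple_permP[s E]; exists s => i.
have := congr1 (fun t => nth (tau i) t i) E.
rewrite -!tnth_nth tnth_mktuple => ->.
by rewrite !tnth_mktuple.
Qed.

Lemma perm_same_content (n k : nat) (tau ups : {ffun 'I_n -> 'I_k}) (s : 'S_n) :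
  (forall i, tau i = ups (s i)) -> same_content tau ups.
Proof.
move=> h v; rewrite -(on_card_preimset (f := s) (R := [pred x | ups x == v])).
  by apply: eq_card => x; rewrite !inE h.
by exists (s^-1)%g => x _; rewrite ?permK ?permKV.
Qed.

Lemma det_neq0_perm (F : fieldType) n (A : 'M[F]_n) : \det A != 0 ->
  exists s : 'S_n, forall i, A i (s i) != 0.
Proof.
move=> dA; apply: contrapT => h; move/eqP: dA; apply.
rewrite /determinant big1 // => s _.
have [i /eqP Ai] : exists i, A i (s i) == 0.
  apply: contrapT => h2; apply: h; exists s => i; apply/negP => Ai.
  by apply: h2; exists i.
by rewrite (bigD1 i) //= Ai mul0r mulr0.
Qed.

Lemma not_unitmx_row_ker (F : fieldType) n (A : 'M[F]_n) : A \notin unitmx ->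
  exists2 x : 'rV_n, x != 0 & x *m A = 0.
Proof.
move=> nA; apply: contrapT => h; move/negP: nA; apply.
rewrite -row_free_unit; apply: inj_row_free => v vA; apply/eqP/negPn/negP => v0.
by apply: h; exists v.
Qed.

(** The graded part of Y, where row and column levels agree. It reappears below as the limit of the
    frame rescaled by the flow. *)
Definition leading (F : fieldType) (n k : nat) (blk tau : {ffun 'I_n ->
  'I_k}) (Y : 'M[F]_n) : 'M[F]_n :=
  \matrix_(i, j) if blk j == tau i then Y i j else 0.

(* Row reduction: as long as the leading blocks are dependent, some row can be
   replaced by a combination with earlier rows whose level is strictly lower. *)
Lemma bruhat_decomposition (F : fieldType) (n k : nat) (b : bool)
    (blk : {ffun 'I_n -> 'I_k}) (P : 'M[F]_n) : P \in unitmx ->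
  exists2 tau, same_content tau blk & in_cell b blk tau P.
Proof.
move=> uP.
suff H N (tau : {ffun 'I_n -> 'I_k}) (C Y : 'M[F]_n) : (\sum_i tau i < N)%N ->
    C \in unitmx -> pat (rank_dir b) (rank_dir b) C -> pat (level tau) (level blk) Y ->
    C *m P = Y -> exists2 tau, same_content tau blk & in_cell b blk tau P.
  case: (posnP k) => [k0|k0].
    exists blk => //; exists 1%:M, P; split => //; [exact: unitmx1|exact: pat1| |by rewrite mul1mx].
    by move=> i; have := ltn_ord (blk i); rewrite [X in (_ < X)%N]k0.
  have km : (k.-1 < k)%N by rewrite prednK.
  (* With every row at the top level the pattern condition is vacuous. The content is wrong at this
     stage and becomes that of [blk] only when the leading part is invertible. *)
  pose top : {ffun 'I_n -> 'I_k} := [ffun=> Ordinal km].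
  apply: (H _ top 1%:M P (ltnSn _)); rewrite ?unitmx1 ?mul1mx //; first exact: pat1.
  move=> i j; rewrite /level ffunE /=; have := ltn_ord (blk j).
  by move: (blk j : nat) => m; lia.
elim: N tau C Y => // N IH tau C Y; rewrite ltnS => sN uC pC pY CPY.
have uY : Y \in unitmx by rewrite -CPY unitmx_mul uC.
have [uL|nL] := boolP (leading blk tau Y \in unitmx).
  have : \det (leading blk tau Y) != 0 by rewrite -unitfE -unitmxE.
  move=> /det_neq0_perm[s hs]; exists tau.
    apply: (@perm_same_content _ _ _ _ s) => i; have := hs i; rewrite mxE.
    by case: (altP (blk (s i) =P tau i)) => [->|_] //; rewrite eqxx.
  exists (invmx C), Y; split => //; rewrite ?unitmx_inv //; first exact: pat_inv.
  by rewrite -CPY mulKmx.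
have [x x0 xL] := not_unitmx_row_ker nL.
have [i0 xi0] : exists i, x 0 i != 0.
  apply: contrapT => h; move/eqP: x0; apply; apply/matrixP => a i; rewrite (ord1 a) mxE.
  by apply/eqP/negPn/negP => xi; apply: h; exists i.
set q := tau i0.
pose S i := (tau i == q) && (x 0 i != 0).
have Si0 : S i0 by rewrite /S eqxx.
(* Among the rows of level q in the dependency, p has the highest rank, so it is modified by rows of
   lower rank only and the elimination matrix stays triangular of direction [b]. *)
case: (arg_maxnP (P := S) (rank_dir b) Si0) => p /andP[/eqP tp xp] maxp.
pose y i := if tau i == q then x 0 i / x 0 p else 0.
have yp : y p = 1 by rewrite /y tp eqxx divff.
have ybig m : (rank_dir b p < rank_dir b m)%N -> y m = 0.
  move=> pm; rewrite /y; case: eqP => // tm; have [-> | xm] := eqVneq (x 0 m) 0.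
    by rewrite mul0r.
  have : S m by rewrite /S tm eqxx.
  by move/maxp; rewrite /geq /= leqNgt pm.
pose E : 'M[F]_n := \matrix_(a, c) if a == p then y c else (a == c)%:R.
have pE : pat (rank_dir b) (rank_dir b) E.
  move=> a c ac; rewrite mxE; case: eqP => [ap|_]; first by rewrite ybig // -ap.
  by case: eqP => // E'; move: ac; rewrite E' ltnn.
have EY a c : (E *m Y) a c = if a == p then \sum_m y m * Y m c else Y a c.
  rewrite mxE; case: (eqVneq a p) => [->|ap]; first by apply: eq_bigr => m _; rewrite mxE eqxx.
  rewrite (bigD1 a) //= big1 ?addr0; first by rewrite mxE (negbTE ap) eqxx mul1r.
  by move=> m ma; rewrite mxE (negbTE ap) eq_sym (negbTE ma) mul0r.
have uE : E \in unitmx.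
  apply: unitmx_of_ker => v Ev; have va a : a != p -> v a 0 = 0.
    move=> ap; have /matrixP/(_ a 0) := Ev; rewrite !mxE (bigD1 a) //= big1 ?addr0.
      by rewrite mxE (negbTE ap) eqxx mul1r.
    by move=> m ma; rewrite mxE (negbTE ap) eq_sym (negbTE ma) mul0r.
  apply/matrixP => a z; rewrite (ord1 z) [RHS]mxE.
  have [->|] := eqVneq a p; last exact: va.
  have /matrixP/(_ p 0) := Ev; rewrite !mxE (bigD1 p) //= big1 ?addr0.
    by rewrite mxE eqxx yp mul1r.
  by move=> m mp; rewrite va ?mulr0.
have rowp c : (q <= blk c)%N -> \sum_m y m * Y m c = 0.
  rewrite leq_eqVlt => /orP[/eqP qc|qc].
    have /matrixP/(_ 0 c) := xL; rewrite !mxE => h.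
    transitivity ((x 0 p)^-1 * \sum_j x 0 j * leading blk tau Y j c); last by rewrite h mulr0.
    rewrite mulr_sumr; apply: eq_bigr => m _; rewrite mxE /y (_ : blk c = q); last exact: val_inj.
    by rewrite [q == _]eq_sym; case: ifP => _; rewrite ?mul0r ?mulr0 // mulrAC mulrC.
  rewrite big1 // => m _; rewrite /y; case: eqP => [tm|_]; last by rewrite mul0r.
  by rewrite pY ?mulr0 // /level tm.
(* At level 0 the reduced row would vanish entirely, contradicting invertibility; hence the level
   can drop by one. *)
have [q0|q0] := posnP q.
  have uEY : E *m Y \in unitmx by rewrite unitmx_mul uE.
  have : row p (E *m Y) = 0.
    by apply/matrixP => a c; rewrite mxE EY eqxx [RHS]mxE rowp // q0.
  move=> /(congr1 (mulmx^~ (invmx (E *m Y)))); rewrite mul0mx rowE -mulmxA mulmxV // mulmx1.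
  by move=> /matrixP/(_ 0 p); rewrite !mxE !eqxx => /eqP; rewrite oner_eq0.
have qk : (q.-1 < k)%N by apply: leq_ltn_trans (leq_pred _) (ltn_ord q).
pose tau' : {ffun 'I_n -> 'I_k} := [ffun i => if i == p then Ordinal qk else tau i].
apply: (IH tau' (E *m C) (E *m Y)).
- apply: leq_trans sN; rewrite (bigD1 p) //= [ltnRHS](bigD1 p) //= ffunE eqxx tp /=.
  rewrite (eq_bigr (fun i => (tau i : nat))) ?ltn_add2r ?prednK //.
  by move=> i /negbTE ip; rewrite ffunE ip.
- by rewrite unitmx_mul uE.
- exact: pat_mul pC.
- move=> a c; rewrite EY /level ffunE; case: (eqVneq a p) => [_|_] /=; last exact: pY.
  by move=> h; apply: rowp; rewrite -(prednK q0).
- by rewrite -CPY mulmxA.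
Qed.

Lemma pat_mul_diag (F : fieldType) n (e : 'I_n -> nat) (A B : 'M[F]_n) i : injective e ->
  pat e e A -> pat e e B -> (A *m B) i i = A i i * B i i.
Proof.
move=> einj pA pB; rewrite mxE (bigD1 i) //= big1 ?addr0 // => m mi.
have [h|h] := ltnP (e i) (e m); first by rewrite pA ?mul0r.
by rewrite pB ?mulr0 // ltn_neqAle h andbT (inj_eq einj).
Qed.

Lemma ptau_diag (R : realType) (n k : nat) (lam : 'I_k -> R) (tau : {ffun 'I_n -> 'I_k}) :
  ptau lam tau = diag_mx (\row_i lam (tau i)).
Proof. by apply/matrixP => i j; rewrite !mxE; case: eqP => [->|]; rewrite ?mulr1n ?mulr0n. Qed.

Section Limit.
Variables (R : realType) (n k : nat) (lam : 'I_k -> R) (blk tau : {ffun 'I_n -> 'I_k}).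
Hypothesis lam_incr : forall a b : 'I_k, (a < b)%N -> lam a < lam b.
Hypothesis content : same_content tau blk.
Let d : 'rV[R]_n := \row_i lam (blk i).
Variables (b : bool) (Psi : R -> 'M[R]_n) (F : set_system R).
Context {FF : ProperFilter F}.
Hypothesis curve : integral_curve (diag_mx d) Psi.
Hypothesis decay : forall c : R, c < 0 -> expR (time_sign R b * t * c) @[t --> F] --> (0 : R).
Variables C Y : 'M[R]_n.
Hypotheses (uC : C \in unitmx) (pC : pat (rank_dir b) (rank_dir b) C).
Hypotheses (uY : Y \in unitmx) (pY : pat (level tau) (level blk) Y) (PsiCY : Psi 0 = C *m Y).

Let orth t : Psi t *m (Psi t)^T = 1%:M.
Proof. by case: curve => /(_ t)[]. Qed.

Let dtau : 'rV[R]_n := \row_i lam (tau i).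
Let st t := time_sign R b * t.
(** The frame rescaled by the flow on both sides: entries with blk j < tau i decay, those with
    equality are constant, and those with blk j > tau i vanish by [pY]. *)
Let Yt t := expd (- dtau) (st t) *m Y *m expd d (st t).
Let Yl := leading blk tau Y.

Let YtE t i j : Yt t i j = Y i j * expR (st t * (lam (blk j) - lam (tau i))).
Proof.
by rewrite /Yt mul_expd mul_diag_mx !mxE mulrBr expRD mulrN; ring.
Qed.

Let Yt_cvg : Yt t @[t --> F] --> Yl.
Proof.
apply: cvg_mx => i j; rewrite mxE.
have -> : (fun t => Yt t i j) = (fun t => Y i j * expR (st t * (lam (blk j) - lam (tau i)))).
  by apply/funext => t; exact: YtE.
case: (ltngtP (blk j) (tau i)) => h.
- case: eqP => [E|_]; first by move: h; rewrite E ltnn.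
  rewrite -[X in _ --> X](mulr0 (Y i j)); apply: cvgM; first exact: cvg_cst.
  by apply: decay; rewrite subr_lt0 lam_incr.
- case: eqP => [E|_]; first by move: h; rewrite E ltnn.
  rewrite pY //; have -> : (fun t => 0 * expR (st t * (lam (blk j) - lam (tau i)))) = cst 0.
    by apply/funext => t; rewrite mul0r.
  exact: cvg_cst.
- rewrite (val_inj h) eqxx subrr.
  have -> : (fun t => Y i j * expR (st t * 0)) = cst (Y i j).
    by apply/funext => t; rewrite mulr0 expR0 mulr1.
  exact: cvg_cst.
Qed.

Let det_Yt t : \det (Yt t) = \det Y.
Proof.
rewrite !det_mulmx !det_diag mulrAC -big_split /=.
rewrite (eq_bigr (fun i => expR (st t * (lam (blk i) - lam (tau i))))); last first.
  by move=> i _; rewrite !mxE mulrBr expRD mulrN mulrC.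
rewrite -expR_sum -mulr_sumr sumrB.
have [s hs] := same_content_perm content.
rewrite [X in _ - X](eq_bigr (fun i => lam (blk (s i)))); last by move=> i _; rewrite hs.
by rewrite -(reindex_inj (@perm_inj _ s) (P := xpredT) (F :=
  fun i => lam (blk i))) subrr mulr0 expR0 mul1r.
Qed.

Let uYt t : Yt t \in unitmx.
Proof. by rewrite unitmxE det_Yt -unitmxE. Qed.

(** As tau and blk have the same content, the exponential factors cancel in the determinant of
    [Yt t], which is therefore constant and passes to the limit. *)
Let uYl : Yl \in unitmx.
Proof.
rewrite unitmxE (_ : \det Yl = \det Y) -?unitmxE //.
have h1 : \det (Yt t) @[t --> F] --> \det Yl.
  by apply: (cvg_comp _ _ Yt_cvg); exact: det_continuous.
have h2 : \det (Yt t) @[t --> F] --> \det Y.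
  rewrite (_ : (fun t => \det (Yt t)) = cst (\det Y)); first exact: cvg_cst.
  by apply/funext => t; exact: det_Yt.
exact: (cvg_unique _ h1 h2).
Qed.

Let T t := Yt t *m (Psi t)^T.

Let pT t : pat (rank_dir b) (rank_dir b) (T t).
Proof.
have -> : T t = expd (- dtau) (st t) *m (invmx C *m factor_of d Psi b t).
  by rewrite /factor_of PsiCY -/(st t) /T /Yt -!mulmxA mulKmx.
by apply: pat_mul (@pat_diag _ _ _ _) (pat_mul (pat_inv uC pC) (factor_of_pat curve _)).
Qed.

Let uT t : T t \in unitmx.
Proof. by rewrite unitmx_mul uYt unitmx_tr (invmx_orth (orth t)).1. Qed.

(** The failure of [Yt t] to intertwine the two diagonal matrices; it tends to zero because the
    leading part intertwines them exactly. *)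
Let E t := Yt t *m diag_mx d - diag_mx dtau *m Yt t.
Let H t := invmx (Yt t) *m E t.

Let H_cvg : H t @[t --> F] --> (0 : 'M[R]_n).
Proof.
have E0 : Yl *m diag_mx d - diag_mx dtau *m Yl = 0.
  apply/matrixP => i j; rewrite mul_mx_diag mul_diag_mx !mxE; case: eqP => [->|_].
    by rewrite mulrC subrr.
  by rewrite mul0r mulr0 subrr.
have E_cvg : E t @[t --> F] --> (0 : 'M[R]_n).
  rewrite -E0; apply: cvgB; apply: cvg_mulmx => //; exact: cvg_cst.
have : invmx (Yt t) @[t --> F] --> invmx Yl.
  rewrite -(cramerE uYl) (_ : (fun t => invmx (Yt t)) = (fun t => cramer (Yt t))).
    by apply: (cvg_comp _ _ Yt_cvg); exact: cramer_continuous.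
  by apply/funext => t; rewrite cramerE.
by move=> /cvg_mulmx /(_ E_cvg); rewrite mulmx0.
Qed.

Let Z t := Psi t *m H t *m (Psi t)^T.

Let Z_cvg i j : Z t i j @[t --> F] --> (0 : R).
Proof.
apply: norm_cvg0.
apply: (@squeeze_cvgr _ _ _ _ (cst 0) (fun t => \sum_m \sum_l `|H t l m|)).
- near=> t; apply/andP; split => //=.
  rewrite mxE; apply: le_trans (ler_norm_sum _ _ _) _; apply: ler_sum => m _.
  rewrite [(Psi t)^T _ _]mxE normrM -[leRHS]mulr1; apply: ler_pM => //; last exact: orth_le1.
  rewrite mxE; apply: le_trans (ler_norm_sum _ _ _) _; apply: ler_sum => l _.
  by rewrite normrM -[leRHS]mul1r; apply: ler_pM => //; exact: orth_le1.
- exact: cvg_cst.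
- rewrite [X in _ --> X](_ : 0 = \sum_(m < n) \sum_(l < n) (0 : R)); last first.
    by rewrite big1 // => m _; rewrite big1.
  apply: cvg_big => [|m _]; first exact: add_continuous.
  apply: cvg_big => [|l _]; first exact: add_continuous.
  have := cvg_norm (@cvg_mx_entry R n n R F _ H 0 l m H_cvg).
  by rewrite [(0 : 'M[R]_n) l m]mxE normr0 => h; apply: h; exact: filter_filter.
Unshelve. all: by end_near. Qed.

Let XE t : conjL (diag_mx d) (Psi t) = invmx (T t) *m diag_mx dtau *m T t + Z t.
Proof.
have PE : T t *m Psi t = Yt t by rewrite /T -mulmxA (orthT (orth t)) mulmx1.
have PV : invmx (T t) = Psi t *m invmx (Yt t).
  have [] // := @unitmx_left _ _ (T t) (Psi t *m invmx (Yt t)).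
  by rewrite mulmxA PE mulmxV.
rewrite conjL_orth // /Z /H /E PV mulmxBr mulmxA mulmxBr mulmxBl mulKmx //.
rewrite /T -!mulmxA addrC subrK //.
Qed.

(** X is a conjugate of [diag_mx dtau] by a triangular matrix, plus an error [Z t] that tends to
    zero. The conjugate is triangular with constant diagonal, so on one side of the diagonal X
    equals the error; symmetry of X carries this to the other side, although [T t] itself need not
    converge. *)
Lemma toda_limit : conjL (diag_mx d) (Psi t) @[t --> F] --> ptau lam tau.
Proof.
have pdt : pat (rank_dir b) (rank_dir b) (diag_mx dtau) by exact: pat_diag.
have pinv t := pat_inv (uT t) (@pT t).
have pM t := pat_mul (pat_mul (pinv t) pdt) (@pT t).
have Xsym t i j : conjL (diag_mx d) (Psi t) i j = conjL (diag_mx d) (Psi t) j i.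
  by rewrite -{1}(conjL_sym d (orth t)) mxE.
have einj := @rank_dir_inj n b.
have off i j : (rank_dir b i < rank_dir b j)%N ->
    (fun t => conjL (diag_mx d) (Psi t) i j) = (fun t => Z t i j).
  by move=> ij; apply/funext => t; rewrite XE mxE pM // add0r.
apply: cvg_mx => i j; rewrite ptau_diag -/dtau.
case: (ltngtP (rank_dir b i) (rank_dir b j)) => ij.
- rewrite off // [diag_mx _ _ _](_ : _ = 0); first exact: Z_cvg.
  exact: pdt.
- have -> : (fun t => conjL (diag_mx d) (Psi t) i j) = (fun t => Z t j i).
    by rewrite -(off _ _ ij); apply/funext => t; exact: Xsym.
  rewrite [diag_mx _ _ _](_ : _ = 0); first exact: Z_cvg.
  rewrite mxE; case: eqP => // E'; move: ij; by rewrite E' ltnn.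
- move/einj: ij => <-.
  have -> : (fun t => conjL (diag_mx d) (Psi t) i i) = (fun t => diag_mx dtau i i + Z t i i).
    apply/funext => t; rewrite XE mxE; congr (_ + _).
    rewrite (pat_mul_diag i einj (pat_mul (pinv t) pdt) (@pT t)) (pat_mul_diag i einj (pinv t) pdt).
    by rewrite mulrAC -(pat_mul_diag i einj (pinv t) (@pT t)) mulVmx // [1%:M i i]mxE eqxx mul1r.
  rewrite -[X in _ --> X]addr0; apply: cvgD; first exact: cvg_cst.
  exact: Z_cvg.
Qed.

End Limit.

(* A nonzero term in the expansion of a corner minor of C'^-1 C fixes the positions up to p
   and maps the others so that tau (s x) <= sigma x. *)
Lemma bruhat_le_of_cells (F : fieldType) (n k : nat) (blk sigma tau : {ffun 'I_n -> 'I_k})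
    (P : 'M[F]_n) :
  same_content sigma blk -> same_content tau blk ->
  in_cell false blk sigma P -> in_cell true blk tau P -> bruhat_le sigma tau.
Proof.
move=> sc tc [C' [Y' [uC' pC' uY' pY' PE']]] [C [Y [uC pC uY pY PE]]] p q.
have [s1 hs1] := same_content_perm sc; have [s2 hs2] := same_content_perm tc.
set g := invmx C' *m C.
have gE : g = Y' *m invmx Y.
  by rewrite /g -[C](mulmxK uY) -PE PE' -!mulmxA mulKmx.
have pg : pat (level sigma) (level tau) g.
  rewrite gE; apply: pat_mul pY' _; apply: (pat_inv_perm (s := s2)) => // i.
  by rewrite /level hs2.
have hdir (i j : 'I_n) : (rank_dir true i < rank_dir true j)%N ->
  (rank_dir false j < rank_dir false i)%N by rewrite (rank_dirC true).
have uCi : invmx C' \in unitmx by rewrite unitmx_inv.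
have := mixrows_UL p.+1 hdir uCi uC (pat_inv uC' pC') pC.
rewrite unitmxE unitfE => /det_neq0_perm[s hs].
have slow (x : 'I_n) : (x < p.+1)%N -> s x = x.
  move=> xp; have := hs x; rewrite mxE /= xp; case: (altP (x =P s x)) => [<- //|_]; by rewrite eqxx.
have shigh (x : 'I_n) : (p.+1 <= x)%N -> (tau (s x) <= sigma x)%N.
  move=> px; have := hs x; rewrite mxE /= ltnNge px /=; apply: contraR; rewrite -ltnNge => h.
  by apply/eqP; apply: pg.
have sp (x : 'I_n) : (p < s x)%N = (p < x)%N.
  have [h|h] := ltnP p x; last by rewrite slow // ltnNge h.
  apply/negPn/negP; rewrite -leqNgt -ltnS => sxp; have /perm_inj sx := slow _ sxp.
  by move: sxp; rewrite sx ltnS leqNgt h.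
(* The minor controls positions after p. Totals depend only on the content, so comparing these
   complementary counts reverses to the comparison of ranks. *)
pose co (t : {ffun 'I_n -> 'I_k}) := (\sum_(x < n) ((p < x)%N && (q <= t x)%N : nat))%N.
pose tot (t : {ffun 'I_n -> 'I_k}) := (\sum_(x < n) ((q <= t x)%N : nat))%N.
have rkco t : (rk t p.+1 q + co t = tot t)%N.
  rewrite rkE -big_split /=; apply: eq_bigr => x _.
  by rewrite ltnS; case: leqP => //=; rewrite ?addn0.
have totE (t : {ffun 'I_n -> 'I_k}) (s' : 'S_n) : (forall i, t i = blk (s' i)) -> tot t = tot blk.
  move=> h; rewrite /tot [RHS](reindex_inj (@perm_inj _ s')) /=.
  by apply: eq_bigr => x _; rewrite h.
have : (co tau <= co sigma)%N.
  rewrite /co (reindex_inj (@perm_inj _ s)) /=; apply: leq_sum => x _.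
  by rewrite sp; case: ltnP => //= h; have := shigh x h; lia.
by have := rkco sigma; have := rkco tau; rewrite (totE _ _ hs1) (totE _ _ hs2); lia.
Qed.

(** Let [h] serve the exchanged word. Swapping its rows i and j gives the pattern of psi, and row j,
    now of the higher level, may also receive a multiple of the other row. A corner minor starting
    at p stays nonzero if p <= i or p > j; for i < p <= j it is affine in the multiplier beta with
    nonzero slope, so it suffices that beta avoid finitely many roots. *)
Lemma exists_UL_pattern (F : numFieldType) (n k : nat) (psi omega : {ffun 'I_n -> 'I_k}) :
  same_content psi omega -> bruhat_le psi omega ->
  exists2 g : 'M[F]_n, pat (level psi) (level omega) g &
    forall p : nat, mixrows [pred a | rank_dir true a < p]%N g \in unitmx.
Proof.
have bound (t : {ffun 'I_n -> 'I_k}) : (inversions t <= n * n)%N.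
  apply: (@leq_trans (\sum_(x < n) \sum_(y < n) 1)%N).
    by apply: leq_sum => x _; apply: leq_sum => y _; case: (_ && _).
  by rewrite !big_const_ord !iter_addn_0 mul1n.
move: {2}(n * n - inversions psi)%N (leqnn (n * n - inversions psi)%N) => N.
elim: N psi => [|N IH] psi hN sc le.
all: have [->|ne] := pselect (psi = omega);
  first by exists 1%:M; [exact: pat1|move=> p; rewrite mixrows1 unitmx1].
all: have [i [j [ij pij gap lec]]] := bruhat_step sc le ne.
all: have inv := inversions_swap ij pij gap.
  by have := bound (swap_positions i j psi); lia.
have [] := IH (swap_positions i j psi) _ _ lec.
- by have := bound (swap_positions i j psi); lia.
- by move=> v; rewrite same_content_swap sc.
set c := swap_positions i j psi => h ph uh.
have ne_ij : i != j by rewrite neq_ltn ij.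
(* By Cramer's rule the entry i of [h *m v p] is the ratio of two corner minors, that is, minus the
   root to be avoided; beta exceeds the absolute values of all of these. *)
pose v (p : nat) : 'cV[F]_n := invmx (mixrows [pred a | rank_dir true a < p]%N h) *m delta_mx j 0.
pose beta : F := 1 + \sum_(p < n.+1) `|(h *m v p) i 0|.
pose g : 'M[F]_n := \matrix_(a, b)
  if a == i then h j b else if a == j then h i b + beta * h j b else h a b.
have gy (y : 'cV[F]_n) a : (g *m y) a 0 = if a == i then (h *m y) j 0
    else if a == j then (h *m y) i 0 + beta * (h *m y) j 0 else (h *m y) a 0.
  have [ai|ai] := eqVneq a i; last have [aj|aj] := eqVneq a j.
  - by rewrite !mxE; apply: eq_bigr => m _; rewrite !mxE ai eqxx.
  - rewrite !mxE mulr_sumr -big_split /=; apply: eq_bigr => m _.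
    by rewrite !mxE (negbTE ai) aj eqxx mulrDl mulrA.
  - by rewrite !mxE; apply: eq_bigr => m _; rewrite !mxE (negbTE ai) (negbTE aj).
have ci : level c i = level psi j by rewrite /level ffunE tpermL.
have cj : level c j = level psi i by rewrite /level ffunE tpermR.
exists g.
  move=> a b; rewrite mxE; have [->|ai] := eqVneq a i; first by rewrite -cj => /ph.
  have [->|aj] := eqVneq a j.
    by rewrite -ci => ib; rewrite !ph ?mulr0 ?addr0 // cj -/(level psi i) (ltn_trans _ ib) // ci.
  by move=> ab; apply: ph; rewrite /level ffunE tpermD // eq_sym.
move=> p; apply: mixrows_unit => y y0 gy0.
apply: (mixrows_ker (uh p) y0) => a /= ap.
have same (x : 'I_n) : ~~ (x < p)%N -> x != i -> x != j -> (h *m y) x 0 = 0.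
  by move=> xp xi xj; have := gy0 x xp; rewrite gy (negbTE xi) (negbTE xj).
suff hij : ((p <= j)%N -> (h *m y) j 0 = 0) /\ ((p <= i)%N -> (h *m y) i 0 = 0).
  have [aj|aj] := eqVneq a j; first by rewrite aj hij.1 // leqNgt -aj.
  have [ai|ai] := eqVneq a i; first by rewrite ai hij.2 // leqNgt -ai.
  exact: same.
have rowi : (p <= i)%N -> (h *m y) j 0 = 0.
  by move=> pi; have := gy0 i; rewrite /= -leqNgt => /(_ pi); rewrite gy eqxx.
have rowj : (p <= j)%N -> (h *m y) i 0 + beta * (h *m y) j 0 = 0.
  by move=> pj; have := gy0 j; rewrite /= -leqNgt => /(_ pj); rewrite gy eq_sym (negbTE ne_ij) eqxx.
have [pi|pi] := leqP p i.
  split=> _; first exact: rowi.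
  by have := rowj (leq_trans pi (ltnW ij)); rewrite rowi // mulr0 addr0.
split=> // pj; set kap := (h *m y) j 0.
(* A kernel vector satisfies the equations defining [v p] up to the scalar kap, so the last equation
   reads kap times a nonzero number. *)
have yE : y = kap *: v p.
  rewrite /v -[y in LHS](mulKmx (uh p)) scalemxAr; congr (_ *m _).
  apply/matrixP => x z; rewrite (ord1 z) mixrows_mul !mxE eqxx andbT /=.
  have [xp|xp] := ltnP x p.
    rewrite y0 //; case: eqP => [E|_]; last by rewrite mulr0.
    by move: xp; rewrite E ltnNge pj.
  have [->|xj] := eqVneq x j; first by rewrite mulr1 /kap mxE.
  rewrite mulr0 -[RHS](same x) ?mxE // -?leqNgt //.
  by apply/negP => /eqP xi; move: xp; rewrite xi leqNgt pi.
have pn : (p < n.+1)%N by rewrite ltnS (leq_trans pj) // ltnW.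
have : kap * ((h *m v p) i 0 + beta) = 0.
  have := rowj pj; rewrite -/kap {1}yE -scalemxAr mxE mulrDr (mulrC beta) //.
move/eqP; rewrite mulf_eq0 => /orP[/eqP //|/eqP E].
exfalso; have : `|(h *m v p) i 0| = beta.
  have b0 : 0 <= beta by rewrite addr_ge0 // sumr_ge0.
  by rewrite (_ : (h *m v p) i 0 = - beta) ?normrN ?ger0_norm //; apply/eqP; rewrite -addr_eq0 E.
move/eqP; rewrite /beta (bigD1 (Ordinal pn)) //= addrCA -subr_eq0 opprD addNKr oppr_eq0.
by rewrite gt_eqF // ltr_pwDl // sumr_ge0.
Qed.

Lemma in_cell_mulr (F : fieldType) (n k : nat) b (blk tau : {ffun 'I_n -> 'I_k}) (P m : 'M[F]_n) :
  m \in unitmx -> pat (level blk) (level blk) m -> in_cell b blk tau P ->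
    in_cell b blk tau (P *m m).
Proof.
move=> um pm [C [Y [uC pC uY pY ->]]]; exists C, (Y *m m); split => //.
- by rewrite unitmx_mul uY.
- exact: pat_mul pm.
- by rewrite mulmxA.
Qed.

Lemma in_cell_curve (R : realType) (n k : nat) b (blk tau : {ffun 'I_n -> 'I_k}) d
    (Psi : R -> 'M[R]_n) t :
  integral_curve (diag_mx d) Psi -> in_cell b blk tau (Psi 0) -> in_cell b blk tau (Psi t).
Proof.
move=> curve [C [Y [uC pC uY pY PE]]].
have o s : Psi s *m (Psi s)^T = 1%:M by case: curve => /(_ s)[].
have pf := factor_of_pat (b := b) curve t; set A := factor_of d Psi b t in pf.
have uA : A \in unitmx.
  by rewrite !unitmx_mul (invmx_orth (o 0)).1 expd_unit unitmx_tr (invmx_orth (o t)).1.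
exists (invmx A *m C), (Y *m expd d (time_sign R b * t)); split.
- by rewrite unitmx_mul unitmx_inv uA.
- exact: pat_mul (pat_inv uA pf) pC.
- by rewrite unitmx_mul uY expd_unit.
- by apply: pat_mul pY _; exact: pat_diag.
- rewrite -[LHS](mulKmx uA) -[RHS]mulmxA (mulmxA C) -PE; congr (_ *m _).
  by rewrite /A /factor_of -(mulmxA _ _ (Psi t)) (orthT (o t)) mulmx1.
Qed.

(** With N the triangular factor of g, the product g N is unitriangular of the opposite type. The
    frame N^-1 s, for a permutation matrix s, also equals (g N)^-1 (g s), and the two expressions
    place it in the two cells. *)
Lemma cells_meet (F : numFieldType) (n k : nat) (blk psi omega : {ffun 'I_n -> 'I_k}) :
  same_content psi blk -> same_content omega blk -> bruhat_le psi omega ->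
  exists P : 'M[F]_n, [/\ P \in unitmx, in_cell true blk omega P & in_cell false blk psi P].
Proof.
move=> pc oc le; have poc : same_content psi omega by move=> v; rewrite pc oc.
have [g pg ug] := exists_UL_pattern F poc le.
pose N := tri_factor (rank_dir true) g.
have pN : pat (rank_dir true) (rank_dir true) N by exact: tri_factor_pat.
have gN i j : (rank_dir true j <= rank_dir true i)%N -> (g *m N) i j = (i == j)%:R.
  by apply: tri_factor_mul.
have pU : pat (rank_dir false) (rank_dir false) (g *m N).
  move=> i j; rewrite (rank_dirC false) /= => ij; rewrite gN ?(ltnW ij) //.
  by case: eqP => // E; move: ij; rewrite E ltnn.
have ugN : g *m N \in unitmx.
  rewrite unitmxE -det_tr det_trig.
    rewrite unitfE; apply/prodf_neq0 => i _; rewrite mxE gN // eqxx.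
    exact: oner_neq0.
  by apply/is_trig_mxP => i j ij; rewrite mxE pU // (rank_dirC false).
have [ugg uN] : g \in unitmx /\ N \in unitmx by move: ugN; rewrite unitmx_mul => /andP.
have [s hs] := same_content_perm oc.
have pY : pat (level omega) (level blk) (perm_mx s : 'M[F]_n).
  move=> i j ij; rewrite !mxE; case: eqP => // E; move: ij.
  by rewrite /level hs E ltnn.
exists (invmx N *m perm_mx s); split.
- by rewrite unitmx_mul unitmx_inv uN unitmx_perm.
- exists (invmx N), (perm_mx s); split => //; [by rewrite unitmx_inv|exact: pat_inv|exact:
    unitmx_perm].
- exists (invmx (g *m N)), (g *m perm_mx s); split => //.
  + by rewrite unitmx_inv.
  + exact: pat_inv.
  + by rewrite unitmx_mul ugg unitmx_perm.
  + exact: pat_mul pY.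
  + have -> : g *m perm_mx s = (g *m N) *m (invmx N *m perm_mx s).
      by rewrite mulmxA mulmxK.
    by rewrite mulKmx.
Qed.

(** * Orthogonal frames and the sorted word of Lambda *)

(** Gram-Schmidt on the columns, starting from the last one: the factor is lower triangular, hence
    block triangular for the monotone word [blk], and multiplying by it on the right preserves the
    flag. *)
Definition qr_factor (R : realType) n (P : 'M[R]_n) : 'M[R]_n :=
  (gram_schmidt (rank_dir true) (P^T *m P))^T.

Section QR.
Variables (R : realType) (n k : nat) (blk : {ffun 'I_n -> 'I_k}).
Hypothesis blk_mono : forall i j : 'I_n, (i <= j)%N -> (blk i <= blk j)%N.

Let opp (i j : 'I_n) :
  (rank_dir false i < rank_dir false j)%N = (rank_dir true j < rank_dir true i)%N.
Proof. exact: (rank_dirC false). Qed.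

Lemma qr_factor_pat (P : 'M[R]_n) : P \in unitmx -> pat (level blk) (level blk) (qr_factor P).
Proof.
rewrite -unitmx_tr => u i j ij; rewrite mxE -{2}[P]trmxK.
apply: (gram_schmidt_pat opp u); rewrite opp /= ltnNge; apply/negP => /blk_mono.
by rewrite leqNgt ij.
Qed.

Lemma qr_factor_orth (P : 'M[R]_n) : P \in unitmx ->
  (P *m qr_factor P) *m (P *m qr_factor P)^T = 1%:M.
Proof.
rewrite -unitmx_tr => u; have h := gram_schmidt_orth (@rank_dir_inj n false) opp u.
rewrite trmxK in h; apply: mulmx1C; rewrite /qr_factor; move: (gram_schmidt _ _) h => N.
by rewrite !trmx_mul !trmxK.
Qed.

Lemma qr_factor_unit (P : 'M[R]_n) : P \in unitmx -> qr_factor P \in unitmx.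
Proof.
move=> u; have [h _] := unitmx_left (qr_factor_orth u).
by move: h; rewrite unitmx_mul => /andP[].
Qed.

(** Changing the sign of one column repairs the determinant. A diagonal sign matrix commutes with
    Lambda, so the point of the flag manifold is unchanged. *)
Lemma in_SO_sign (P : 'M[R]_n) : P *m P^T = 1%:M ->
  exists2 S : 'rV[R]_n, SOn (P *m diag_mx S) & forall i, S 0 i * S 0 i = 1.
Proof.
move=> o; have dP : \det P ^+ 2 = 1 by rewrite expr2 -{2}[P]trmxK det_tr -det_mulmx o det1.
have /orP[/eqP d1|/eqP d1] : (\det P == 1) || (\det P == -1) by rewrite -sqrf_eq1 dP.
  exists (const_mx 1); last by move=> i; rewrite !mxE mulr1.
  by rewrite diag_const_mx mulmx1.
case: n P o dP d1 => [|m] P o dP d1.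
  by move: d1; rewrite det_mx00 => /eqP; rewrite -subr_eq0 opprK -mulr2n pnatr_eq0.
exists (\row_i if i == ord0 then -1 else 1); last first.
  by move=> i; rewrite mxE; case: eqP => _; rewrite ?mulrNN mulr1.
split.
  rewrite trmx_mul tr_diag_mx !mulmxA -(mulmxA P) mulmx_diag.
  rewrite (_ : \row__ _ = const_mx 1) ?diag_const_mx ?mulmx1 //.
  by apply/matrixP => a i; rewrite !mxE; case: eqP => _; rewrite ?mulrNN mulr1.
rewrite det_mulmx d1 det_diag big_ord_recl mxE eqxx big1 ?mulr1 ?mulrNN ?mulr1 //.
by move=> i _; rewrite mxE.
Qed.

End QR.

Lemma conjL_sign (R : realType) n (d S : 'rV[R]_n) (P : 'M[R]_n) :
  P *m P^T = 1%:M -> (forall i, S 0 i * S 0 i = 1) ->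
    (P *m diag_mx S) *m (P *m diag_mx S)^T = 1%:M ->
  conjL (diag_mx d) (P *m diag_mx S) = conjL (diag_mx d) P.
Proof.
move=> o hS oS; rewrite !conjL_orth // trmx_mul tr_diag_mx !mulmxA; congr (_ *m _).
rewrite -!mulmxA !mulmx_diag; congr (_ *m diag_mx _); apply/matrixP => a i.
by rewrite !mxE (ord1 a) mulrCA hS mulr1.
Qed.

Lemma sum_interval (a c n : nat) : (a + c <= n)%N ->
  (\sum_(i < n) ((a <= i < a + c)%N : nat) = c)%N.
Proof.
elim: n c => [|n IH] c h; first by rewrite big_ord0; lia.
rewrite big_ord_recr /=; have [h'|h'] := leqP (a + c) n.
  by rewrite IH // andbF addn0.
case: c h h' => [|c] h h'; first by rewrite big1 //; [lia|move=> i _; lia].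
have acn : (a + c = n)%N by lia.
rewrite (eq_bigr (fun i : 'I_n => ((a <= i < a + c)%N : nat))) ?IH; [|lia|].
  by lia.
by move=> i _; have := ltn_ord i; lia.
Qed.

(** Replaces the interval sums defining [Lam] by a word: the nondecreasing element of S_n^I, used as
    the common reference for contents and for block triangularity. *)
Lemma exists_blocks (R : realType) (n k : nat) (I : 'I_k -> nat) (lam : 'I_k -> R) :
  (forall j, (0 < I j)%N) -> (\sum_(j < k) I j)%N = n ->
  exists blk : {ffun 'I_n -> 'I_k}, [/\ in_SnI I blk,
    forall i j : 'I_n, (i <= j)%N -> (blk i <= blk j)%N &
    Lam n I lam = diag_mx (\row_i lam (blk i))].
Proof.
move=> Ipos Isum.
pose S (m : nat) := (\sum_(l < k | (l < m)%N) I l)%N.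
have S0 : S 0%N = 0%N by rewrite /S big1.
have Sk m : (k <= m)%N -> S m = n.
  move=> km; rewrite /S -Isum; apply: eq_bigl => l.
  exact: leq_trans (ltn_ord l) km.
have SS (j : 'I_k) : S j.+1 = (S j + I j)%N.
  rewrite /S (bigD1 j) //= addnC; congr (_ + _)%N; apply: eq_bigl => l.
  by rewrite ltnS ltn_neqAle andbC.
have Smono m m' : (m <= m')%N -> (S m <= S m')%N.
  move=> mm; rewrite /S [leqRHS](bigID (fun l : 'I_k => (l < m)%N)) /=.
  rewrite (eq_bigl (fun l : 'I_k => (l < m')%N && (l < m)%N)) ?leq_addr // => l.
  by case: (ltnP l m) => h; rewrite ?andbF ?andbT //; symmetry; exact: leq_trans h mm.
pose cond (i : nat) (j : 'I_k) := (blk_start I j <= i < blk_start I j + I j)%N.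
have condS i (j : 'I_k) : cond i j = (S j <= i < S j.+1)%N by rewrite SS.
have uniq_lt i (j j' : 'I_k) : cond i j -> cond i j' -> (j <= j')%N.
  rewrite !condS => /andP[h1 h2] /andP[h3 h4]; rewrite leqNgt; apply/negP => jj.
  by have := Smono _ _ jj; lia.
have ex (i : 'I_n) : exists j, cond i j.
  have P0 : exists m, (S m <= i)%N by exists 0%N; rewrite S0.
  have Pb m : (S m <= i)%N -> (m <= k)%N.
    by move=> h; rewrite leqNgt; apply/negP => km; move: h; rewrite Sk ?(ltnW km) // leqNgt ltn_ord.
  case: (ex_maxnP P0 Pb) => m Sm maxm.
  have mk : (m < k)%N.
    by rewrite ltnNge; apply/negP => km; move: Sm; rewrite Sk // leqNgt ltn_ord.
  exists (Ordinal mk); rewrite condS Sm /= ltnNge; apply/negP => /maxm.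
  by rewrite ltnn.
have [f hf] := choice ex.
pose blk : {ffun 'I_n -> 'I_k} := [ffun i => f i].
have condE (i : 'I_n) j : cond i j = (blk i == j).
  apply/idP/eqP => [h|<-]; last by rewrite ffunE.
  by rewrite ffunE; apply: val_inj; apply/eqP; rewrite eqn_leq !(uniq_lt i).
have card j : #|[pred i | blk i == j]| = I j.
  rewrite -sum1_card big_mkcond /= -[RHS](@sum_interval (S j) (I j) n).
    by apply: eq_bigr => i _; rewrite inE -condE -SS -condS; case: (cond i j).
  by rewrite -SS -(Sk k (leqnn k)); apply: Smono.
exists blk; split.
- split=> j; last by rewrite card_classical_set card.
  have : (0 < #|[pred i | blk i == j]|)%N by rewrite card.
  by move=> /card_gt0P[i]; rewrite inE => /eqP ij; exists i.
- move=> i j ij; have := condE i (blk i); have := condE j (blk j); rewrite !eqxx !condS.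
  move=> /andP[h1 h2] /andP[h3 h4]; rewrite leqNgt; apply/negP => jj.
  by have := Smono _ _ jj; lia.
- apply/matrixP => i j; rewrite !mxE; case: eqP => _; last by rewrite mulr0n.
  by rewrite mulr1n; apply: big_pred1 => l; rewrite [LHS]condE eq_sym.
Qed.

(** * Trajectories and open Richardson varieties *)

Definition richardson (R : realType) (n k : nat) (d : 'rV[R]_n)
    (blk psi omega : {ffun 'I_n -> 'I_k}) : set 'M[R]_n :=
  [set X | exists P, [/\ SOn P, in_cell true blk omega P, in_cell false blk psi P &
    X = conjL (diag_mx d) P]].

Section Trajectories.
Variables (R : realType) (n k : nat) (lam : 'I_k -> R) (blk : {ffun 'I_n -> 'I_k}).
Hypothesis lam_incr : forall a b : 'I_k, (a < b)%N -> lam a < lam b.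
Hypothesis blk_mono : forall i j : 'I_n, (i <= j)%N -> (blk i <= blk j)%N.
Let d : 'rV[R]_n := \row_i lam (blk i).
Implicit Types (psi omega tau : {ffun 'I_n -> 'I_k}) (Psi : R -> 'M[R]_n).

Lemma lam_inj : injective lam.
Proof.
move=> a b E; apply: val_inj; case: (ltngtP a b) => // /lam_incr; by rewrite E ltxx.
Qed.

Lemma ptau_inj : injective (@ptau R n k lam).
Proof.
move=> s t /matrixP E; apply/ffunP => i; apply: lam_inj.
by have := E i i; rewrite !mxE eqxx.
Qed.

Lemma curve_limit b tau Psi : same_content tau blk -> integral_curve (diag_mx d) Psi ->
  in_cell b blk tau (Psi 0) ->
  conjL (diag_mx d) (Psi t) @[t --> if b then +oo%R else -oo%R] --> ptau lam tau.
Proof.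
move=> tc curve [C [Y [uC pC uY pY PE]]].
have FF : ProperFilter (if b then +oo%R : set_system R else -oo%R) by case: b {pC}; exact: _.
exact: (toda_limit lam_incr tc curve (@expR_decay_dir R b) uC pC uY pY PE).
Qed.

(** The cells cover all frames: the initial frame lies in the cell of some word, the curve tends to
    the point of that word, and limits are unique. *)
Lemma curve_cell b tau Psi : same_content tau blk -> integral_curve (diag_mx d) Psi ->
  conjL (diag_mx d) (Psi t) @[t --> if b then +oo%R else -oo%R] --> ptau lam tau ->
  in_cell b blk tau (Psi 0).
Proof.
move=> tc curve lim; have o : Psi 0 *m (Psi 0)^T = 1%:M by case: curve => /(_ 0)[].
have [sig sc cell] := bruhat_decomposition b blk (invmx_orth o).1.
have lim' := curve_limit sc curve cell.
have FF : ProperFilter (if b then +oo%R : set_system R else -oo%R).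
  by case: (b); exact: _.
by rewrite (ptau_inj (cvg_unique (@norm_hausdorff _ _) lim lim')).
Qed.

Lemma traj_cells psi omega Psi : same_content psi blk -> same_content omega blk ->
  traj_from_to (diag_mx d) Psi (ptau lam psi) (ptau lam omega) ->
  in_cell true blk omega (Psi 0) /\ in_cell false blk psi (Psi 0).
Proof.
by move=> pc oc [curve [lm lp]]; split; apply: curve_cell.
Qed.

Lemma traj_bruhat_le psi omega Psi : same_content psi blk -> same_content omega blk ->
  traj_from_to (diag_mx d) Psi (ptau lam psi) (ptau lam omega) -> bruhat_le psi omega.
Proof.
by move=> pc oc /(traj_cells pc oc)[c1 c2]; exact: (bruhat_le_of_cells pc oc c2 c1).
Qed.

Lemma cells_traj psi omega P : same_content psi blk -> same_content omega blk -> SOn P ->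
  in_cell true blk omega P -> in_cell false blk psi P ->
  traj_from_to (diag_mx d) (toda_curve d P) (ptau lam psi) (ptau lam omega).
Proof.
move=> pc oc so c1 c2; have curve := toda_curveP d so.
split=> //; split; [apply: (@curve_limit false)|apply: (@curve_limit true)] => //;
  by rewrite toda_curve0.
Qed.

(** Orthonormalizing the frame and correcting its determinant both multiply it on the right by block
    triangular matrices, so neither cell is left. *)
Lemma richardson_of_cells psi omega (P : 'M[R]_n) : P \in unitmx ->
  in_cell true blk omega P -> in_cell false blk psi P ->
  richardson d blk psi omega (conjL (diag_mx d) (P *m qr_factor P)).
Proof.
move=> uP c1 c2; have o := qr_factor_orth uP.
have [S so hS] := in_SO_sign o.
exists (P *m qr_factor P *m diag_mx S); split => //; last by rewrite conjL_sign //; case: so.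
all: rewrite -mulmxA; apply: in_cell_mulr => //.
2,4: by apply: pat_mul (qr_factor_pat blk_mono uP) _; exact: pat_diag.
all: rewrite unitmx_mul qr_factor_unit //=.
all: have [h _] := unitmx_left so.1; by move: h; rewrite unitmx_mul => /andP[].
Qed.

Lemma connected_bruhat psi omega : same_content psi blk -> same_content omega blk ->
  connected_by_traj (diag_mx d) (ptau lam psi) (ptau lam omega) <->
  (bruhat_le psi omega \/ bruhat_le omega psi).
Proof.
move=> pc oc.
have conn s t : same_content s blk -> same_content t blk -> bruhat_le s t ->
    exists Psi, traj_from_to (diag_mx d) Psi (ptau lam s) (ptau lam t).
  move=> sc tc le; have [P [uP c1 c2]] := cells_meet R sc tc le.
  have [P' [so c1' c2' _]] := richardson_of_cells uP c1 c2.
  by exists (toda_curve d P'); exact: cells_traj.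
split.
  by move=> [Psi [h|h]]; [left|right]; apply: traj_bruhat_le h.
by move=> [le|le]; [have [Psi h] := conn _ _ pc oc le; exists Psi; left
                  |have [Psi h] := conn _ _ oc pc le; exists Psi; right].
Qed.

(** A trajectory in the opposite direction would give omega <= psi, which antisymmetry excludes for
    distinct words. *)
Lemma swept_richardson psi omega : same_content psi blk -> same_content omega blk ->
  psi <> omega -> bruhat_le psi omega ->
  swept (diag_mx d) (ptau lam psi) (ptau lam omega) = richardson d blk psi omega.
Proof.
move=> pc oc ne le; apply/seteqP; split => X.
  move=> [Psi [[h|h] [t ->]]]; last first.
    by case: ne; apply: bruhat_le_anti => //; exact: traj_bruhat_le h.
  have [c1 c2] := traj_cells pc oc h; have curve := h.1.
  by exists (Psi t); split => //; [by case: curve|exact: (in_cell_curve t curve c1)|exact: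
    (in_cell_curve t curve c2)].
move=> [P [so c1 c2 ->]]; exists (toda_curve d P); split; first by left; exact: cells_traj.
by exists 0; rewrite toda_curve0.
Qed.

End Trajectories.

(** * Local inversion *)

Section PerturbedIdentity.
Variables (R : realType) (V : completeNormedModType R) (Q : V -> V) (r : R).
Hypothesis r0 : 0 < r.
Hypothesis Q0 : Q 0 = 0.
Hypothesis Qlip : forall x y, `|x| <= r -> `|y| <= r -> `|Q x - Q y| <= 2^-1 * `|x - y|.

Let Qle x : `|x| <= r -> `|Q x| <= 2^-1 * `|x|.
Proof. by move=> xr; have := Qlip xr (y := 0); rewrite Q0 !subr0 normr0; apply; exact: ltW. Qed.

(** Fixed point of x |-> y - Q x. On the ball of radius r the map Q at least halves norms, so
    right-hand sides of norm at most r / 2 keep the ball stable. *)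
Let solve y : `|y| <= r / 2 -> exists x, `|x| <= r /\ x + Q x = y.
Proof.
move=> yr; pose U : set V := [set x | `|x| <= r].
have fU : set_fun U U (fun x => y - Q x).
  move=> x /= Ux; apply: le_trans (ler_normB _ _) _; have := Qle Ux; move: yr Ux; rewrite /U /=.
  by lra.
have Uc : closed U.
  rewrite (_ : U = (fun x : V => `|x|) @^-1` [set t | t <= r]) //.
  by apply: preimage_closed; [move=> x _; exact: norm_continuous|exact: closed_le].
have [] := @banach_fixed_point R V U (mkfun_fun fU) _ Uc.
- have h2 : 0 <= (2^-1 : R) by [].
  exists (NngNum h2); split; first by rewrite /= invf_lt1 // ltr1n.
  move=> [x x'] [/= Ux Ux']; rewrite /mkfun opprB addrC addrA subrK distrC.
  exact: Qlip Ux Ux'.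
- by exists 0; rewrite /U /= normr0 ltW.
move=> x Ux E; exists x; split => //.
by rewrite {1}E /= /mkfun subrK.
Qed.

(** The identity plus Q contracts distances by a factor 2 at most, which gives both injectivity on
    the ball and continuity of the inverse. *)
Let dist x y : `|x| <= r -> `|y| <= r -> `|x - y| <= 2 * `|(x + Q x) - (y + Q y)|.
Proof.
move=> xr yr; have E : x - y = (x + Q x - (y + Q y)) - (Q x - Q y).
  by rewrite opprD addrACA addrK.
have h1 := ler_normB (x + Q x - (y + Q y)) (Q x - Q y); rewrite -E in h1.
have h2 := Qlip xr yr.
by move: h1 h2; set a := `|x - y|; set b := `|Q x - Q y|; set c := `|_|; lra.
Qed.

Lemma perturbed_identity_inverse : exists G : V -> V, [/\ G 0 = 0,
  (forall y, `|y| <= r / 2 -> G y + Q (G y) = y),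
  (forall x, `|x| <= r -> `|x + Q x| <= r / 2 -> G (x + Q x) = x) &
  (forall y, `|y| < r / 2 -> {for y, continuous G})].
Proof.
(* Outside the ball the value 0 is arbitrary; continuity is claimed only where |y| < r / 2. *)
have ex y : exists x, `|y| <= r / 2 -> `|x| <= r /\ x + Q x = y.
  have [/solve[x hx]|h] := boolP (`|y| <= r / 2); first by exists x.
  by exists 0.
have [G hG] := choice ex.
have GF x : `|x| <= r -> `|x + Q x| <= r / 2 -> G (x + Q x) = x.
  move=> xr yr; have [Gr GE] := hG _ yr; have := dist Gr xr.
  by rewrite GE subrr normr0 mulr0 normr_le0 subr_eq0 => /eqP.
exists G; split => //.
- have := GF 0; rewrite Q0 addr0 normr0; apply; first exact: ltW.
  by rewrite divr_ge0 // ltW.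
- by move=> y /hG[].
- move=> y yr; apply/cvgrPdist_lt => eps e0.
  near=> y'.
  have yr' : `|y'| <= r / 2.
    near: y'; apply: (@filterS _ _ _ [set z | `|z| < r / 2]) => [z /ltW //|].
    have := @norm_continuous _ V y _ => /(_ [set t | t < r / 2]); apply.
    by apply: open_nbhs_nbhs; split => //; exact: open_lt.
  have [a1 a2] := hG _ (ltW yr); have [b1 b2] := hG _ yr'.
  apply: le_lt_trans (dist a1 b1) _; rewrite a2 b2 mulrC -ltr_pdivlMr //.
  by near: y'; apply: cvgr_dist_lt => //; rewrite divr_gt0.
Unshelve. all: by end_near. Qed.

End PerturbedIdentity.

Section SmallMaps.
Variables (R : realType) (n : nat).
Local Notation M := 'M[R]_n.
Implicit Types f g : M -> M.

Lemma mx_norm_le (A : M) (c : R) : 0 <= c -> (forall i j, `|A i j| <= c) -> `|A| <= c.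
Proof.
move=> c0 h; rewrite /Num.Def.normr /= mx_normrE.
by apply: bigmax_le => // -[i j] _; exact: h.
Qed.

Lemma mx_entry_le (A : M) i j : `|A i j| <= `|A|.
Proof.
rewrite [leRHS]/Num.Def.normr /= mx_normrE.
exact: (@le_bigmax _ _ _ _ (fun ij : 'I_n * 'I_n => `|A ij.1 ij.2|) (i, j)).
Qed.

Lemma mulmx_norm_le (A B : M) : `|A *m B| <= n%:R * `|A| * `|B|.
Proof.
apply: mx_norm_le => [|i j]; first by rewrite !mulr_ge0.
rewrite mxE; apply: le_trans (ler_norm_sum _ _ _) _.
apply: (@le_trans _ _ (\sum_(k < n) `|A| * `|B|)).
  by apply: ler_sum => k _; rewrite normrM; apply: ler_pM => //; exact: mx_entry_le.
by rewrite sumr_const card_ord -mulrA mulr_natl.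
Qed.

Definition small1 f := f 0 = 0 /\ exists2 K, 0 <= K &
  forall x y, `|x| <= 1 -> `|y| <= 1 -> `|f x - f y| <= K * `|x - y|.

(** The estimate satisfied by quadratic maps: the Lipschitz constant is proportional to the distance
    from the origin, so it can be made as small as desired on a small ball. *)
Definition small2 f := f 0 = 0 /\ exists2 K, 0 <= K &
  forall x y, `|x| <= 1 -> `|y| <= 1 -> `|f x - f y| <= K * (`|x| + `|y|) * `|x - y|.

Lemma linear_small1 (f : {linear M -> M}) : small1 f.
Proof.
split; first exact: linear0.
exists (\sum_i \sum_j `|f (delta_mx i j)|) => [|x y _ _].
  by apply: sumr_ge0 => i _; apply: sumr_ge0.
rewrite -linearB; set z := x - y; rewrite {1}[z]matrix_sum_delta linear_sum.
apply: le_trans (ler_norm_sum _ _ _) _; rewrite mulr_suml; apply: ler_sum => i _.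
rewrite linear_sum; apply: le_trans (ler_norm_sum _ _ _) _; rewrite mulr_suml;
  apply: ler_sum => j _.
by rewrite linearZ /= normrZ mulrC; apply: ler_wpM2l => //; exact: mx_entry_le.
Qed.

Lemma small1_mul f g : small1 f -> small1 g -> small2 (fun x => f x *m g x).
Proof.
move=> [f0 [K K0 hK]] [g0 [L L0 hL]]; split; first by rewrite f0 mul0mx.
exists (n%:R * K * L) => [|x y x1 y1]; first by rewrite !mulr_ge0.
have fx : `|f x| <= K * `|x|.
  by have := hK x 0 x1; rewrite normr0 f0 !subr0; apply.
have gy : `|g y| <= L * `|y|.
  by have := hL y 0 y1; rewrite normr0 g0 !subr0; apply.
have -> : f x *m g x - f y *m g y = f x *m (g x - g y) + (f x - f y) *m g y.
  by rewrite mulmxBr mulmxBl addrA subrK.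
apply: le_trans (ler_normD _ _) _.
rewrite mulrDr mulrDl; apply: lerD; apply: le_trans (mulmx_norm_le _ _) _.
  have -> : n%:R * K * L * `|x| * `|x - y| = n%:R * (K * `|x|) * (L * `|x - y|) by ring.
  by apply: ler_pM; [rewrite mulr_ge0|by []|exact: ler_wpM2l|exact: hL].
have -> : n%:R * K * L * `|y| * `|x - y| = n%:R * (K * `|x - y|) * (L * `|y|) by ring.
by apply: ler_pM; [rewrite mulr_ge0|by []|apply: ler_wpM2l => //; exact: hK|].
Qed.

Lemma small2_small1 f : small2 f -> small1 f.
Proof.
move=> [f0 [K K0 hK]]; split => //; exists (2 * K) => [|x y x1 y1]; first by rewrite mulr_ge0.
apply: le_trans (hK x y x1 y1) _; apply: ler_wpM2r => //; rewrite mulrC ler_wpM2r //.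
by lra.
Qed.

Lemma small2_add f g : small2 f -> small2 g -> small2 (fun x => f x + g x).
Proof.
move=> [f0 [K K0 hK]] [g0 [L L0 hL]]; split; first by rewrite f0 g0 addr0.
exists (K + L) => [|x y x1 y1]; first by rewrite addr_ge0.
rewrite opprD addrACA; apply: le_trans (ler_normD _ _) _.
have -> : (K + L) * (`|x| + `|y|) * `|x - y| =
  K * (`|x| + `|y|) * `|x - y| + L * (`|x| + `|y|) * `|x - y| by ring.
by apply: lerD; [exact: hK|exact: hL].
Qed.

Lemma small2_small f : small2 f -> exists2 r, 0 < r <= 1 &
  forall x y, `|x| <= r -> `|y| <= r -> `|f x - f y| <= 2^-1 * `|x - y|.
Proof.
(* On this ball |x| + |y| is at most twice the radius, and 2K / (4(K + 1)) <= 1/2; the added 1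
   covers K = 0 and keeps the radius below 1. *)
move=> [f0 [K K0 hK]]; exists (4 * (K + 1))^-1.
  rewrite invr_gt0 invf_le1; first by apply/andP; split; lra.
  by lra.
have Kp : 0 < 4 * (K + 1) by lra.
move=> x y xr yr.
have r1 : (4 * (K + 1))^-1 <= 1 by rewrite invf_le1 //; lra.
apply: le_trans (hK x y (le_trans xr r1) (le_trans yr r1)) _; apply: ler_wpM2r => //.
apply: (@le_trans _ _ (K * (2 * (4 * (K + 1))^-1))); first by apply: ler_wpM2l => //; lra.
rewrite mulrA ler_pdivrMr //; lra.
Qed.

End SmallMaps.

Section LocalProduct.
Variables (R : realType) (n : nat) (g0 : 'M[R]_n).
Variables a w c : {linear 'M[R]_n -> 'M[R]_n}.

(* With x = a(x) g0 + w(x) + g0 c(x), the map x |-> (1 + a x)(g0 + w x)(1 + c x) - g0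
   is a perturbation of the identity by the quadratic term below. *)
Definition quad_term x := a x *m w x + a x *m g0 *m c x + w x *m c x + a x *m w x *m c x.

Lemma quad_termE x : x = a x *m g0 + w x + g0 *m c x ->
  x + quad_term x = (1%:M + a x) *m (g0 + w x) *m (1%:M + c x) - g0.
Proof.
move=> E; rewrite {1}E /quad_term !(mulmxDl, mulmxDr, mul1mx, mulmx1).
set p := a x *m g0; set q := w x; set s := g0 *m c x; set u := a x *m w x.
set y := w x *m c x; set z := _ *m c x; set t := _ *m c x.
by apply/matrixP => i j; rewrite !mxE; ring.
Qed.

Lemma quad_term_small : exists2 r, 0 < r <= 1 &
  forall x y, `|x| <= r -> `|y| <= r -> `|quad_term x - quad_term y| <= 2^-1 * `|x - y|.
Proof.
apply: small2_small; have ha := linear_small1 a; have hw := linear_small1 w;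
  have hc := linear_small1 c.
have hag : small1 (fun x => a x *m g0).
  by have := linear_small1 (mulmxr g0 \o a); apply.
apply: small2_add; last by apply: small1_mul => //; exact: small2_small1 (small1_mul ha hw).
by apply: small2_add; [apply: small2_add|]; exact: small1_mul.
Qed.

Lemma quad_term0 : quad_term 0 = 0.
Proof. by rewrite /quad_term !linear0 ?(mul0mx, mulmx0) ?addr0. Qed.

End LocalProduct.

(** * Coordinate subspaces and transversal slices *)

Section CoordinateSubspaces.
Variables (F : fieldType) (n : nat).
Local Notation M := 'M[F]_n.
Implicit Types (S : pred ('I_n * 'I_n)) (A : M).

Definition supported S A := forall i j, ~~ S (i, j) -> A i j = 0.

Definition unit_family S : #|S|.-tuple M :=
  [tuple delta_mx (enum_val i).1 (enum_val i).2 | i < #|S|].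

Definition coord_space S : {vspace M} := <<unit_family S>>%VS.

Lemma unit_family_nth S (i : 'I_#|S|) :
  (unit_family S)`_i = delta_mx (enum_val i).1 (enum_val i).2.
Proof. by rewrite -tnth_nth tnth_mktuple. Qed.

Lemma unit_family_free S : free (unit_family S).
Proof.
apply/freeP => k /matrixP E i; have := E (enum_val i).1 (enum_val i).2.
rewrite summxE mxE (bigD1 i) //= big1 ?addr0; last first.
  move=> j ji; rewrite unit_family_nth !mxE.
  case: andP => [[/eqP e1 /eqP e2]|_]; last by rewrite mulr0.
  case/eqP: ji; apply: enum_val_inj; move: e1 e2.
  by case: (enum_val i) => a b; case: (enum_val j) => a' b' /= -> ->.
by rewrite unit_family_nth !mxE !eqxx mulr1.
Qed.

Lemma coord_space_dim S : \dim (coord_space S) = #|S|.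
Proof. by have /eqP := unit_family_free S; rewrite size_tuple. Qed.

Lemma coord_spaceP S A : reflect (supported S A) (A \in coord_space S).
Proof.
apply: (iffP idP) => [/coord_span -> i j Sij|sA].
  rewrite summxE big1 // => l _; rewrite unit_family_nth !mxE.
  case: andP => [[/eqP e1 /eqP e2]|_]; last by rewrite mulr0.
  move: Sij; rewrite e1 e2 -surjective_pairing => /negP[].
  exact: (enum_valP l).
rewrite [A]matrix_sum_delta; apply: memv_suml => i _; apply: memv_suml => j _.
have [Sij|Sij] := boolP (S (i, j)); last by rewrite sA // scale0r mem0v.
apply: memvZ; apply: memv_span; have Sij' : (i, j) \in S by [].
rewrite (_ : delta_mx i j = tnth (unit_family S) (enum_rank_in Sij' (i, j))).
  exact: mem_tnth.
by rewrite tnth_mktuple enum_rankK_in.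
Qed.

Definition combination d (X : d.-tuple M) (t : 'rV[F]_d) : M := \sum_i t 0 i *: X`_i.

Lemma combination_is_linear d (X : d.-tuple M) : linear (combination X).
Proof.
move=> c s t; rewrite /combination scaler_sumr -big_split /=; apply: eq_bigr => i _.
by rewrite !mxE scalerDl scalerA.
Qed.

HB.instance Definition _ d (X : d.-tuple M) :=
  GRing.isLinear.Build F 'rV[F]_d M *:%R (combination X) (combination_is_linear X).

Definition coords d (X : d.-tuple M) (A : M) : 'rV[F]_d := \row_i coord X i A.

Lemma coords_is_linear d (X : d.-tuple M) : linear (coords X).
Proof. by move=> c A B; apply/matrixP => i j; rewrite !mxE linearP. Qed.

HB.instance Definition _ d (X : d.-tuple M) :=
  GRing.isLinear.Build F M 'rV[F]_d *:%R (coords X) (coords_is_linear X).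

End CoordinateSubspaces.

Section Transversal.
Variables (F : fieldType) (n d : nat) (Su Sv Sg : pred ('I_n * 'I_n)) (g0 : 'M[F]_n).
Hypothesis ug0 : g0 \in unitmx.
Hypothesis mulU : forall u, supported Su u -> supported Sg (u *m g0).
Hypothesis mulV : forall v, supported Sv v -> supported Sg (g0 *m v).
Hypothesis free_action : forall u v, supported Su u -> supported Sv v -> u *m g0 = g0 *m v -> u = 0.
Hypothesis dim_eq : #|Sg| = (#|Su| + #|Sv| + d)%N.

Let mr : 'End('M[F]_n) := linfun (mulmxr g0).
Let ml : 'End('M[F]_n) := linfun (mulmx g0).
Let E1 := (mr @: coord_space F Su)%VS.
Let E2 := (ml @: coord_space F Sv)%VS.
Let G := coord_space F Sg.

Let E1P x : reflect (exists2 u, supported Su u & x = u *m g0) (x \in E1).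
Proof.
apply: (iffP memv_imgP) => [[u /coord_spaceP us ->]|[u us ->]].
  by exists u => //; rewrite lfunE.
by exists u; [apply/coord_spaceP|rewrite lfunE].
Qed.

Let E2P x : reflect (exists2 v, supported Sv v & x = g0 *m v) (x \in E2).
Proof.
apply: (iffP memv_imgP) => [[u /coord_spaceP us ->]|[u us ->]].
  by exists u => //; rewrite lfunE.
by exists u; [apply/coord_spaceP|rewrite lfunE].
Qed.

Let dim1 : \dim E1 = #|Su|.
Proof.
rewrite limg_dim_eq ?coord_space_dim //; apply/eqP; rewrite -subv0; apply/subvP => x.
rewrite memv_cap memv_ker => /andP[_]; rewrite lfunE /= => /eqP E.
by rewrite -(mulmxK ug0 x) E mul0mx mem0v.
Qed.

Let dim2 : \dim E2 = #|Sv|.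
Proof.
rewrite limg_dim_eq ?coord_space_dim //; apply/eqP; rewrite -subv0; apply/subvP => x.
rewrite memv_cap memv_ker => /andP[_]; rewrite lfunE /= => /eqP E.
by rewrite -(mulKmx ug0 x) E mulmx0 mem0v.
Qed.

Let E12 : (E1 :&: E2 = 0)%VS.
Proof.
apply/eqP; rewrite -subv0; apply/subvP => x; rewrite memv_cap => /andP[/E1P[u us ->] /E2P[v vs E]].
by rewrite (free_action us vs E) mul0mx mem0v.
Qed.

Let W := (G :\: (E1 + E2))%VS.

Let sub12 : (E1 + E2 <= G)%VS.
Proof.
rewrite subv_add; apply/andP; split; apply/subvP => x.
  by move=> /E1P[u us ->]; apply/coord_spaceP; exact: mulU.
by move=> /E2P[u us ->]; apply/coord_spaceP; exact: mulV.
Qed.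

Let W12 : (W :&: (E1 + E2) = 0)%VS.
Proof. by rewrite capv_diff. Qed.

Let sumG : (E1 + E2 + W)%VS = G.
Proof. by rewrite addvC addv_diff; apply/eqP; rewrite eqEsubv subv_add subvv sub12 addvSl. Qed.

Let dimW : \dim W = d.
Proof.
have := dimv_disjoint_sum W12; rewrite addvC sumG (dimv_disjoint_sum E12) dim1 dim2
  coord_space_dim dim_eq.
by lia.
Qed.

Let D1 : (E1 :&: (E2 + W) = 0)%VS.
Proof.
apply/eqP; rewrite -subv0; apply/subvP => x; rewrite memv_cap =>
  /andP[x1 /memv_addP[y y2 [w wW E]]].
have w0 : w = 0.
  apply/eqP; rewrite -memv0 -W12 memv_cap wW /=.
  have -> : w = x - y by rewrite E addrAC subrr add0r.
  by apply: memv_add => //; rewrite memvN.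
by rewrite -E12 memv_cap x1 E w0 addr0.
Qed.

Let D2 : (E2 :&: (E1 + W) = 0)%VS.
Proof.
apply/eqP; rewrite -subv0; apply/subvP => x; rewrite memv_cap =>
  /andP[x1 /memv_addP[y y2 [w wW E]]].
have w0 : w = 0.
  apply/eqP; rewrite -memv0 -W12 memv_cap wW /=.
  have -> : w = - y + x by rewrite E addrA addNr add0r.
  by apply: memv_add => //; rewrite memvN.
by rewrite -E12 memv_cap x1 E w0 addr0 y2.
Qed.

(** Each projection is along the sum of the other two summands. These maps are linear on all
    matrices, but they add up to the identity only on G, whence the support condition in
    [tr_sum]. *)
Let p1 := daddv_pi E1 (E2 + W).
Let p2 := daddv_pi E2 (E1 + W).
Let p3 := daddv_pi W (E1 + E2).

Let ker_pi (A B : {vspace 'M[F]_n}) x : (A :&: B = 0)%VS -> x \in B -> daddv_pi A B x = 0.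
Proof.
move=> AB xB; have BA : (B :&: A = 0)%VS by rewrite capvC.
have := daddv_pi_add AB (w := x); rewrite (daddv_pi_id BA xB) => E.
have : daddv_pi A B x + x = x by apply: E; rewrite -[x]add0r memv_add ?mem0v.
by move/(canRL (addrK _)); rewrite subrr.
Qed.

Let pieces x1 x2 x3 : x1 \in E1 -> x2 \in E2 -> x3 \in W ->
  [/\ p1 (x1 + x3 + x2) = x1, p2 (x1 + x3 + x2) = x2 & p3 (x1 + x3 + x2) = x3].
Proof.
move=> h1 h2 h3; rewrite !linearD /=.
have l (A B : {vspace 'M[F]_n}) x : x \in A -> x \in (A + B)%VS by apply: subvP; exact: addvSl.
have r (A B : {vspace 'M[F]_n}) x : x \in B -> x \in (A + B)%VS by apply: subvP; exact: addvSr.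
split.
- by rewrite /p1 (daddv_pi_id D1 h1) (ker_pi D1 (r _ _ _ h3)) (ker_pi D1 (l _ _ _ h2)) !addr0.
- by rewrite /p2 (daddv_pi_id D2 h2) (ker_pi D2 (r _ _ _ h3)) (ker_pi D2 (l _ _ _ h1)) !add0r.
- by rewrite /p3 (daddv_pi_id W12 h3) (ker_pi W12 (l _ _ _ h1)) (ker_pi W12 (r _ _ _ h2)) add0r
    addr0.
Qed.

Let sum_pieces x : x \in G -> x = p1 x + p3 x + p2 x.
Proof.
rewrite -sumG => /memv_addP[y /memv_addP[x1 h1 [x2 h2 ->]] [x3 h3 ->]].
by rewrite addrAC; have [-> -> ->] := pieces h1 h2 h3.
Qed.

Definition tr_left : {linear 'M[F]_n -> 'M[F]_n} := mulmxr (invmx g0) \o p1.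
Definition tr_right : {linear 'M[F]_n -> 'M[F]_n} := mulmx (invmx g0) \o p2.
Definition tr_slice : {linear 'M[F]_n -> 'M[F]_n} := p3.

Lemma tr_left_supp x : supported Su (tr_left x).
Proof.
have /E1P[u us E] : p1 x \in E1 by exact: memv_pi.
by rewrite /= E mulmxK.
Qed.

Lemma tr_right_supp x : supported Sv (tr_right x).
Proof.
have /E2P[u us E] : p2 x \in E2 by exact: memv_pi.
by rewrite /= E mulKmx.
Qed.

Lemma tr_sum x : supported Sg x -> x = tr_left x *m g0 + tr_slice x + g0 *m tr_right x.
Proof. by move=> /coord_spaceP /sum_pieces E; rewrite /= mulmxKV // mulKVmx. Qed.

Lemma tr_basis : exists (io : {linear 'rV[F]_d -> 'M[F]_n}) (ka : {linear 'M[F]_n -> 'rV[F]_d}),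
  [/\ forall t, supported Sg (io t), forall t, ka (io t) = t,
      forall x, io (ka (tr_slice x)) = tr_slice x &
      forall u v t, supported Su u -> supported Sv v ->
        let x := u *m g0 + io t + g0 *m v in
        [/\ tr_left x = u, tr_right x = v & tr_slice x = io t]].
Proof.
(* Replacing d by the dimension of W gives the basis of W the required length definitionally. *)
case: d / dimW; exists (combination (vbasis W)), (coords (vbasis W)).
have ioW t : combination (vbasis W) t \in W.
  by apply: memv_suml => i _; apply: memvZ; apply: vbasis_mem; apply: mem_nth; rewrite size_tuple.
split.
- by move=> t; apply/coord_spaceP; apply: (subvP (diffvSl _ _)); exact: ioW.
- move=> t; apply/matrixP => i j; rewrite (ord1 i) mxE.
  by rewrite /combination coord_sum_free // (basis_free (vbasisP W)).
- move=> x; have xW : p3 x \in W by exact: memv_pi.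
  by rewrite /tr_slice /= [RHS](coord_vbasis xW); apply: eq_bigr => i _; rewrite mxE.
- move=> u v t us vs x.
  have u1 : u *m g0 \in E1 by apply/E1P; exists u.
  have v2 : g0 *m v \in E2 by apply/E2P; exists v.
  have [h1 h2 h3] := pieces u1 v2 (ioW t).
  by rewrite /tr_left /tr_right /tr_slice /= h1 h2 h3 mulmxK // mulKmx.
Qed.

End Transversal.

(** * Charts of Richardson varieties *)

(** Purely topological: intersecting each domain with the preimage of the other makes the images
    match exactly. *)
Lemma local_chart (R : realType) (n d : nat) (S : set 'M[R]_n) (X0 : 'M[R]_n)
    (f : 'M[R]_n -> 'rV[R]_d) (g : 'rV[R]_d -> 'M[R]_n) U1 V1 :
  open U1 -> U1 X0 -> (forall X, U1 X -> {for X, continuous f}) ->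
  open V1 -> V1 (f X0) -> (forall v, V1 v -> {for v, continuous g}) ->
  (forall X, S X -> U1 X -> V1 (f X) -> g (f X) = X) ->
  (forall v, V1 v -> S (g v) /\ (U1 (g v) -> f (g v) = v)) ->
  exists (U : set 'M[R]_n) (V : set 'rV[R]_d) (f : 'M[R]_n -> 'rV[R]_d)
         (g : 'rV[R]_d -> 'M[R]_n),
    open U /\ U X0 /\ open V /\ f @` (S `&` U) = V /\ g @` V = S `&` U /\
    (forall y, (S `&` U) y -> g (f y) = y) /\ (forall v, V v -> f (g v) = v) /\
    {within S `&` U, continuous f} /\ {within V, continuous g}.
Proof.
move=> oU UX0 cf oV Vf cg gf fg.
pose U := [set X | U1 X /\ V1 (f X)]; pose V := [set v | V1 v /\ U1 (g v)].
have oU' : open U.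
  rewrite openE => X [UX VX]; apply: filterI; first exact: open_nbhs_nbhs.
  by apply: (cf X UX); exact: open_nbhs_nbhs.
have oV' : open V.
  rewrite openE => v [Vv Uv]; apply: filterI; first exact: open_nbhs_nbhs.
  by apply: (cg v Vv); exact: open_nbhs_nbhs.
exists U, V, f, g; split => //; split; first by split.
split => //; split; [|split; [|split; [|split; [|split]]]].
- apply/seteqP; split => [v [X [SX [UX VX]] <-]|v [Vv Uv]].
    by split => //; rewrite gf.
  have [Sg fgv] := fg v Vv; exists (g v); last exact: fgv.
  by split => //; split => //; rewrite fgv.
- apply/seteqP; split => [X [v [Vv Uv] <-]|X [SX [UX VX]]].
    by have [Sg fgv] := fg v Vv; split => //; split => //; rewrite fgv.
  by exists (f X); [split => //|]; rewrite gf.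
- by move=> X [SX [UX VX]]; exact: gf.
- by move=> v [Vv Uv]; apply: (fg v Vv).2.
- by apply: continuous_in_subspaceT => X /set_mem[SX [UX VX]]; exact: cf.
- by apply: continuous_in_subspaceT => v /set_mem[Vv Uv]; exact: cg.
Qed.

(** * A continuous frame from spectral projectors *)

Section SpectralLift.
Variables (R : realType) (n k : nat) (lam : 'I_k -> R) (blk : {ffun 'I_n -> 'I_k}).
Hypothesis lam_injective : injective lam.
Let d : 'rV[R]_n := \row_i lam (blk i).
Variable P0 : 'M[R]_n.

Definition spectral_factors (r : seq 'I_k) (X : 'M[R]_n) : 'M[R]_n :=
  foldr (fun l A => (X - (lam l)%:M) *m A) 1%:M r.

(** Lagrange interpolation in X: the eigenprojector of lam j on the orbit, and a polynomial in the
    entries of X everywhere, hence continuous. *)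
Definition spectral_projector (j : 'I_k) (X : 'M[R]_n) : 'M[R]_n :=
  (\prod_(l | l != j) (lam j - lam l))^-1 *: spectral_factors [seq l <- enum 'I_k | l != j] X.

(* Each column of P0 is projected on the eigenspace of X for its block, giving
   a continuous choice of a frame adapted to the flag of X. *)
Definition spectral_lift (X : 'M[R]_n) : 'M[R]_n :=
  \matrix_(i, j) (spectral_projector (blk j) X *m P0) i j.

Lemma spectral_factors_conj P r : P *m P^T = 1%:M ->
  spectral_factors r (conjL (diag_mx d) P) = P *m spectral_factors r (diag_mx d) *m P^T.
Proof.
move=> o; rewrite conjL_orth //; elim: r => [|l r IH] /=; first by rewrite mulmx1.
rewrite IH !mulmxA; congr (_ *m _ *m _).
by rewrite mulmxBl mulmxBr -!mulmxA (orthT o) mulmx1 mul_scalar_mx mul_mx_scalar.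
Qed.

Lemma spectral_factors_diag r i j :
  spectral_factors r (diag_mx d) i j = (i == j)%:R * \prod_(l <- r) (lam (blk i) - lam l).
Proof.
elim: r i j => [|l r IH] i j /=; first by rewrite big_nil mulr1 mxE.
have -> : diag_mx d - (lam l)%:M = diag_mx (\row_i (lam (blk i) - lam l)).
  by apply/matrixP => a c; rewrite !mxE; case: eqP => _; rewrite ?subr0.
by rewrite mul_diag_mx mxE IH big_cons mxE mulrCA.
Qed.

Lemma spectral_projector_diag j a b :
  spectral_projector j (diag_mx d) a b = ((a == b) && (blk a == j))%:R.
Proof.
rewrite mxE spectral_factors_diag big_filter big_enum_cond /=.
case: eqP => _ /=; last by rewrite mul0r mulr0.
rewrite mul1r; have [->|ja] := eqVneq (blk a) j.
  rewrite mulVf //; apply/prodf_neq0 => l lj; rewrite subr_eq0.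
  by apply: contra lj => /eqP/lam_injective ->.
by rewrite [X in _ * X](bigD1 (blk a)) //= subrr mul0r mulr0.
Qed.

(** In the frame P the projectors are coordinate projections, so the lift is P times the block
    diagonal part of P^T P0. Thus it has the flag of P wherever it is invertible, and it returns P0
    at the base point. *)
Lemma spectral_lift_orth P : P *m P^T = 1%:M -> spectral_lift (conjL (diag_mx d) P) =
  P *m \matrix_(i, j) if blk i == blk j then (P^T *m P0) i j else 0.
Proof.
move=> o; apply/matrixP => i j; rewrite mxE /spectral_projector spectral_factors_conj //.
rewrite scalemxAl scalemxAr -/(spectral_projector (blk j) (diag_mx d)) -!mulmxA.
rewrite [LHS]mxE [RHS]mxE; apply: eq_bigr => m _; congr (_ * _).
rewrite [LHS]mxE [RHS]mxE (bigD1 m) //= spectral_projector_diag eqxx big1 ?addr0.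
  by case: eqP => _; rewrite ?mul1r ?mul0r.
by move=> l lm; rewrite spectral_projector_diag eq_sym (negbTE lm) mul0r.
Qed.

Lemma spectral_lift_pat P : P *m P^T = 1%:M -> exists2 H,
  pat (level blk) (level blk) H & spectral_lift (conjL (diag_mx d) P) = P *m H.
Proof.
move=> o; eexists; last exact: spectral_lift_orth.
move=> i j ij; rewrite mxE; case: eqP => // E.
by move: ij; rewrite /level E ltnn.
Qed.

Lemma spectral_lift_base : P0 *m P0^T = 1%:M -> spectral_lift (conjL (diag_mx d) P0) = P0.
Proof.
move=> o; rewrite spectral_lift_orth // (orthT o) -[RHS]mulmx1; congr (_ *m _).
apply/matrixP => i j; rewrite !mxE; have [->|ij] := eqVneq i j; first by rewrite eqxx.
by case: ifP.
Qed.

Lemma spectral_lift_continuous : continuous spectral_lift.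
Proof.
move=> X; have G := regular_class_continuous R X.
have gid : good_mx (fun f : 'M[R]_n -> R => {for X, continuous f}) id.
  by apply: continuous_good_mx.
apply: good_mx_continuous => i j.
have gf r : good_mx (fun f : 'M[R]_n -> R => {for X, continuous f}) (spectral_factors r).
  elim: r => [|l r IH] /=; first exact: (good_cmx G).
  apply: (good_mulmx G) => //; apply: (good_addmx G) => //; exact: (good_cmx G).
have gp : good_mx (fun f : 'M[R]_n -> R => {for X, continuous f}) (spectral_projector (blk j)).
  move=> a b; have := reg_mul G (reg_cst G (\prod_(l | l != blk j) (lam (blk j) - lam l))^-1) (gf
    [seq l <- enum 'I_k | l != blk j] a b).
  by apply: good_ext => Y; rewrite [RHS]mxE.
have := good_mulmx G gp (good_cmx G P0) i j.
by apply: good_ext => Y; rewrite [RHS]mxE.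
Qed.

End SpectralLift.

Lemma unitmx_near (R : realType) (T : topologicalType) (x : T) n (A : T -> 'M[R]_n) :
  good_mx (fun f : T -> R => {for x, continuous f}) A ->
  A x \in unitmx -> \forall y \near x, A y \in unitmx.
Proof.
move=> gA; rewrite unitmxE unitfE => dA.
have cd := good_det (regular_class_continuous R x) gA.
have : \forall t \near \det (A x), t != 0 by apply: open_nbhs_nbhs; split => //; exact: open_neq.
move=> /cd h; apply: (@filterS _ (nbhs x) _ (fun y => \det (A y) != 0)) => [y|]; last exact: h.
by rewrite unitmxE unitfE.
Qed.

(** * Unipotent triangular matrices and row reduction *)

Section TriangularUnipotent.
Variables (F : fieldType) (n : nat) (b : bool).
Local Notation e := (@rank_dir n b).
Implicit Types A B : 'M[F]_n.

Definition unip A := pat e e A /\ forall i, A i i = 1.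

Lemma tri_unit A : pat e e A -> (forall i, A i i != 0) -> A \in unitmx.
Proof.
move=> pA dA; rewrite unitmxE unitfE.
have trig (B : 'M[F]_n) : is_trig_mx B -> (forall i, B i i != 0) -> \det B != 0.
  by move=> tB dB; rewrite det_trig //; apply/prodf_neq0 => i _.
case: b pA => pA; first by apply: trig => //; apply/is_trig_mxP => i j ij; exact: pA.
rewrite -det_tr; apply: trig => [|i]; last by rewrite mxE.
by apply/is_trig_mxP => i j ij; rewrite mxE pA // (rank_dirC false).
Qed.

Lemma unip_unit A : unip A -> A \in unitmx.
Proof. by move=> [pA dA]; apply: tri_unit => // i; rewrite dA oner_neq0. Qed.

Lemma unip_mul A B : unip A -> unip B -> unip (A *m B).
Proof.
move=> [pA dA] [pB dB]; split; first exact: pat_mul pA pB.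
by move=> i; rewrite (pat_mul_diag i (@rank_dir_inj n b) pA pB) dA dB mulr1.
Qed.

Lemma unip_inv A : unip A -> unip (invmx A).
Proof.
move=> uA; have uu := unip_unit uA; have [pA dA] := uA; have pV := pat_inv uu pA.
split=> // i; have := pat_mul_diag i (@rank_dir_inj n b) pA pV.
by rewrite mulmxV // mxE eqxx dA mul1r.
Qed.

Lemma unip_conj A B : B \in unitmx -> pat e e B -> unip A -> unip (B *m A *m invmx B).
Proof.
move=> uB pB [pA dA]; have pV := pat_inv uB pB; have pBA := pat_mul pB pA.
split; first exact: pat_mul pBA pV.
move=> i; rewrite (pat_mul_diag i (@rank_dir_inj n b) pBA pV) (pat_mul_diag i (@rank_dir_inj n b)
  pB pA).
by rewrite dA mulr1 -(pat_mul_diag i (@rank_dir_inj n b) pB pV) mulmxV // mxE eqxx.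
Qed.

(** The source of uniqueness for factorizations into opposite triangular factors. *)
Lemma unip_opposite A : unip A -> pat (@rank_dir n (~~ b)) (rank_dir (~~ b)) A -> A = 1%:M.
Proof.
move=> [pA dA] pA'; apply/matrixP => i j; rewrite mxE.
have [->|ij] := eqVneq i j; first exact: dA.
case: (ltngtP (e i) (e j)) => h; first exact: pA.
  by apply: pA'; rewrite -rank_dirC.
by move/(@rank_dir_inj n b): h => E; rewrite E eqxx in ij.
Qed.

End TriangularUnipotent.

Section RowReduction.
Variables (R : realType) (n k : nat) (b : bool) (tau : {ffun 'I_n -> 'I_k}).
Local Notation e := (@rank_dir n b).
Implicit Types z : 'M[R]_n.

(** The entries of row i that direction [b] allows and the pattern of [tau] forbids: the directions
    transverse to the stabilizer of the coordinate flag. *)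
Definition pivots (i : 'I_n) : pred 'I_n := [pred j | (e j < e i)%N &&
  (level tau i < level tau j)%N].

(** Padding by the identity keeps the size n. Invertibility of this block is an open condition that
    permits cancelling the factor [q] below. *)
Definition pivot_block (i : 'I_n) z : 'M[R]_n :=
  \matrix_(p, q) if pivots i p && pivots i q then z p q else (p == q)%:R.

(* The unipotent matrix c, supported on the pivots, such that c z has no entry
   at the pivot positions. *)
Definition row_reducer z : 'M[R]_n :=
  \matrix_(i, j) cramer (mixrows [pred j | ~~ pivots i j] z^T) j i.

Definition reducible_by_rows z :=
  forall i, mixrows [pred j | ~~ pivots i j] z^T \in unitmx /\ pivot_block i z \in unitmx.

Lemma row_reducer_eq z i : reducible_by_rows z ->
  (forall j, ~~ pivots i j -> row_reducer z i j = (i == j)%:R) /\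
  (forall j, pivots i j -> (row_reducer z *m z) i j = 0).
Proof.
move=> /(_ i)[uA _]; set A := mixrows _ _ in uA *.
have AE : A *m (row i (row_reducer z))^T = col i 1%:M.
  have -> : (row i (row_reducer z))^T = cramer A *m col i 1%:M.
    by rewrite [in RHS]colE mul1mx -colE; apply/matrixP => x y; rewrite !mxE.
  by rewrite cramerE // mulKVmx.
split=> j pj; have /matrixP/(_ j 0) := AE; rewrite mixrows_mul /= pj.
  by rewrite !mxE eq_sym => ->.
rewrite /= -trmx_mul -row_mul [X in X = _ -> _]mxE [X in X = _ -> _]mxE => ->.
rewrite !mxE; case: eqP => // E.
by move: pj; rewrite E /pivots /= ltnn.
Qed.

Lemma row_reducer_unip z : reducible_by_rows z -> unip b (row_reducer z).
Proof.
move=> rz; split=> [i j ij|i]; have [h _] := row_reducer_eq i rz.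
  rewrite h; last by rewrite /pivots /= ltnNge (ltnW ij).
  by case: eqP => // E; move: ij; rewrite E ltnn.
by rewrite h ?eqxx // /pivots /= ltnn.
Qed.

(** If z = N q, the rows of c N times q vanish at the pivots. The pivot block of q is invertible, so
    c N itself vanishes at the pivots; being triangular, it then has the pattern of [tau], and so
    does c z = (c N) q. *)
Lemma row_reducer_pat z N q : reducible_by_rows z -> pat e e N ->
  pat (level tau) (level tau) q -> z = N *m q ->
  pat (level tau) (level tau) (row_reducer z *m z).
Proof.
move=> rz pN pq zE; have [pc _] := row_reducer_unip rz.
pose E1 := row_reducer z *m N; have pE1 : pat e e E1 by exact: pat_mul pc pN.
have czE : row_reducer z *m z = E1 *m q by rewrite {2}zE mulmxA.
have e0 i m : pivots i m -> E1 i m = 0.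
  have [_ uz] := rz i.
  (* An index outside the pivots contributes nothing to the product: either N vanishes by
     triangularity, or the level of the index is at most that of i and q vanishes. *)
  have ss : pivot_block i z = pivot_block i N *m pivot_block i q.
    apply/matrixP => a c; rewrite [LHS]mxE [RHS]mxE.
    have [pa|pa] := boolP (pivots i a); last first.
      rewrite (bigD1 a) //= big1 ?addr0 => [|m' ma];
        last by rewrite !mxE (negbTE pa) eq_sym (negbTE ma) mul0r.
      by rewrite !mxE (negbTE pa) /= eqxx mul1r.
    have [pc'|pc'] := boolP (pivots i c) => /=; last first.
      rewrite (bigD1 c) //= big1 ?addr0 => [|m' mc]; last first.
        by rewrite [X in _ * X]mxE (negbTE pc') andbF (negbTE mc) mulr0.
      by rewrite !mxE (negbTE pc') !andbF eqxx mulr1.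
    rewrite zE mxE; apply: eq_bigr => m' _.
    have [pm|pm] := boolP (pivots i m'); first by rewrite !mxE pa pc' pm.
    rewrite ![pivot_block _ _ _ _]mxE (negbTE pm) andbF.
    have -> : (a == m') = false by apply/eqP => E; rewrite -E pa in pm.
    rewrite mul0r; have [h|h] := ltnP (e a) (e m'); first by rewrite pN ?mul0r.
    rewrite [q m' c]pq ?mulr0 //; move: pa pc' pm; rewrite /pivots /= => /andP[a1 a2] /andP[c1 c2].
    by rewrite (leq_ltn_trans h a1) /= -leqNgt => h2; exact: leq_ltn_trans h2 c2.
  have uq : pivot_block i q \in unitmx by move: uz; rewrite ss unitmx_mul => /andP[].
  pose x : 'rV_n := \row_m' if pivots i m' then E1 i m' else 0.
  have xE m' : x 0 m' = if pivots i m' then E1 i m' else 0 by rewrite mxE.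
  suff x0 : x = 0 by move=> pm; have /matrixP/(_ 0 m) := x0; rewrite !mxE pm.
  rewrite -[x](mulmxK uq); suff -> : x *m pivot_block i q = 0 by rewrite mul0mx.
  apply/matrixP => o j; rewrite (ord1 o) [RHS]mxE mxE.
  have [pj|pj] := boolP (pivots i j); last first.
    rewrite (bigD1 j) //= big1 ?addr0 => [|m' mj]; first by rewrite mxE (negbTE pj) mul0r.
    by rewrite [pivot_block _ _ _ _]mxE (negbTE pj) andbF (negbTE mj) mulr0.
  have [_ /(_ j pj)] := row_reducer_eq i rz; rewrite czE mxE => H; rewrite -[RHS]H.
  apply: eq_bigr => m' _; rewrite xE [pivot_block _ _ _ _]mxE pj andbT.
  have [pm|pm] := boolP (pivots i m') => //; rewrite mul0r.
  have [h|h] := ltnP (e i) (e m'); first by rewrite pE1 ?mul0r.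
  have [tm|tm] := ltnP (level tau m') (level tau j); first by rewrite pq ?mulr0.
  move: pj pm; rewrite /pivots /= => /andP[j1 j2]; rewrite (leq_trans j2 tm) andbT -leqNgt => h'.
  have E : i = m' by apply: (@rank_dir_inj n b); apply/eqP; rewrite eqn_leq h' h.
  by move: j2; rewrite E ltnNge tm.
rewrite czE => i j ij; rewrite mxE big1 // => m _.
have [tm|tm] := ltnP (level tau m) (level tau j); first by rewrite pq ?mulr0.
have [h|h] := ltnP (e i) (e m); first by rewrite pE1 ?mul0r.
suff pm : pivots i m by rewrite e0 ?mul0r.
rewrite /pivots /= (leq_trans ij tm) andbT ltn_neqAle h andbT (inj_eq (@rank_dir_inj n b)).
by apply/eqP => E; move: ij; rewrite -E ltnNge tm.
Qed.

Lemma reducible_near z : reducible_by_rows z -> \forall z' \near z, reducible_by_rows z'.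
Proof.
move=> rz; apply: (@filter_forall _ _ (fun i z' =>
  mixrows [pred j | ~~ pivots i j] z'^T \in unitmx /\ pivot_block i z' \in unitmx) (nbhs z)) => i.
have [u1 u2] := rz i; have G := regular_class_continuous R z.
have gid : good_mx (fun f : 'M[R]_n -> R => {for z, continuous f}) id.
  by apply: continuous_good_mx.
have h1 : \forall z' \near z, mixrows [pred j | ~~ pivots i j] z'^T \in unitmx.
  apply: (unitmx_near (A := fun z' => mixrows [pred j | ~~ pivots i j] z'^T)) => //.
  by apply: (good_mixrows G); exact: good_trmx.
have h2 : \forall z' \near z, pivot_block i z' \in unitmx.
  apply: unitmx_near => // p q; case: (boolP (pivots i p && pivots i q)) => h.
    by apply: good_ext (gid p q) => z'; rewrite mxE h.
  by apply: good_ext (reg_cst G (p == q)%:R) => z'; rewrite mxE (negbTE h).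
exact: filterI h1 h2.
Qed.

Lemma row_reducer_continuous z : reducible_by_rows z -> {for z, continuous row_reducer}.
Proof.
move=> rz; have G := regular_class_continuous R z.
have gid : good_mx (fun f : 'M[R]_n -> R => {for z, continuous f}) id.
  by apply: continuous_good_mx.
apply: good_mx_continuous => i j.
have := good_cramer G (good_mixrows G [pred j | ~~ pivots i j] (good_trmx gid)) (rz i).1 j i.
by apply: good_ext => z'; rewrite [RHS]mxE.
Qed.

Lemma reducible1 : reducible_by_rows 1%:M.
Proof.
move=> i; rewrite trmx1 mixrows1 unitmx1; split => //.
rewrite (_ : pivot_block i 1%:M = 1%:M) ?unitmx1 //.
by apply/matrixP => p q; rewrite !mxE; case: ifP.
Qed.

Lemma row_reducer1 : row_reducer 1%:M = 1%:M.
Proof.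
apply/matrixP => i j; rewrite mxE trmx1 mixrows1 cramerE ?unitmx1 // invmx1 !mxE.
by rewrite eq_sym.
Qed.

End RowReduction.

(** * Counting the entries of the patterns *)

Definition upper_support (n k : nat) (psi : {ffun 'I_n -> 'I_k}) : pred ('I_n * 'I_n) :=
  [pred ij : 'I_n * 'I_n | (ij.1 < ij.2)%N && (level psi ij.2 <= level psi ij.1)%N].

(** The diagonal is included here and not in [upper_support], so that the torus acts only once and
    the two infinitesimal actions on g0 meet trivially. *)
Definition lower_support (n k : nat) (omega : {ffun 'I_n -> 'I_k}) : pred ('I_n * 'I_n) :=
  [pred ij : 'I_n * 'I_n | (ij.2 <= ij.1)%N && (level omega ij.2 <= level omega ij.1)%N].

Definition pattern_support (n k : nat) (psi omega : {ffun 'I_n -> 'I_k}) : pred ('I_n * 'I_n) :=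
  [pred ij : 'I_n * 'I_n | (level omega ij.2 <= level psi ij.1)%N].

Lemma card_pairs (n : nat) (S : pred ('I_n * 'I_n)) :
  #|S| = (\sum_(i < n) \sum_(j < n) (S (i, j) : nat))%N.
Proof.
rewrite -sum1_card big_mkcond /= pair_big /=; apply: eq_bigr => -[i j] _.
by rewrite unfold_in; case: (S (i, j)).
Qed.

(** The pattern has as many entries as there are pairs with t j <= t i, a number that depends only
    on the content. Splitting these into inversions a, ties e, diagonal N and noninversions c, the
    excess over the two supports is c psi - c omega; since a + c counts all pairs, this is the
    difference of inversions. *)
Lemma support_count (n k d : nat) (psi omega : {ffun 'I_n -> 'I_k}) :
  same_content psi omega -> inversions omega = (inversions psi + d)%N ->
  #|pattern_support psi omega| = (#|upper_support psi| + #|lower_support omega| + d)%N.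
Proof.
move=> /same_content_perm[s hs] inv; rewrite !card_pairs /=.
pose a (t : {ffun 'I_n -> 'I_k}) := (\sum_(i < n) \sum_(j < n) ((i < j)%N &&
  (t j < t i)%N : nat))%N.
pose e (t : {ffun 'I_n -> 'I_k}) :=
  (\sum_(i < n) \sum_(j < n) ((i < j)%N && (t j == t i :> nat) : nat))%N.
pose c (t : {ffun 'I_n -> 'I_k}) := (\sum_(i < n) \sum_(j < n) ((j < i)%N &&
  (t j <= t i)%N : nat))%N.
pose N := (\sum_(i < n) \sum_(j < n) ((i == j :> nat) : nat))%N.
pose B := (\sum_(i < n) \sum_(j < n) ((i < j)%N : nat))%N.
pose T (t : {ffun 'I_n -> 'I_k}) := (\sum_(i < n) \sum_(j < n) ((t j <= t i)%N : nat))%N.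
have TE t : T t = (a t + e t + N + c t)%N.
  rewrite /T /a /e /N /c -!big_split /=; apply: eq_bigr => i _.
  rewrite -!big_split /=; apply: eq_bigr => j _.
  by case: (ltngtP i j) => [h|h|/val_inj ->]; lia.
have acB t : (a t + c t = B)%N.
  rewrite /c exchange_big /= /a /B -big_split /=; apply: eq_bigr => i _.
  by rewrite -big_split /=; apply: eq_bigr => j _; lia.
have Tpo : T psi = T omega.
  rewrite /T [RHS](reindex_inj (@perm_inj _ s)) /=; apply: eq_bigr => i _.
  by rewrite [RHS](reindex_inj (@perm_inj _ s)) /=; apply: eq_bigr => j _; rewrite !hs.
have -> : (\sum_(i < n) \sum_(j < n) ((level omega j <= level psi i)%N : nat) = T omega)%N.
  rewrite /T [RHS](reindex_inj (@perm_inj _ s)) /=; apply: eq_bigr => i _.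
  by apply: eq_bigr => j _; rewrite /level hs.
have -> : (\sum_(i < n) \sum_(j < n) ((i < j)%N && (level psi j <= level psi i)%N : nat)
    = a psi + e psi)%N.
  rewrite /a /e -big_split /=; apply: eq_bigr => i _.
  by rewrite -big_split /=; apply: eq_bigr => j _; rewrite /level; lia.
have -> : (\sum_(i < n) \sum_(j < n) ((j <= i)%N && (level omega j <= level omega i)%N : nat)
    = N + c omega)%N.
  rewrite /N /c -big_split /=; apply: eq_bigr => i _.
  rewrite -big_split /=; apply: eq_bigr => j _; rewrite /level.
  by case: (ltngtP i j) => // /val_inj ->; rewrite leqnn.
have h1 := TE psi; have h2 := TE omega; have h3 := acB psi; have h4 := acB omega.
have h5 : a omega = (a psi + d)%N by exact: inv.
by lia.
Qed.

Lemma upper_supportP (F : fieldType) (n k : nat) (psi : {ffun 'I_n -> 'I_k}) (u : 'M[F]_n) :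
  supported (upper_support psi) u <-> unip false (1%:M + u) /\ pat (level psi) (level psi) u.
Proof.
split=> [h|[[pu du] pp] i j].
  split; [split|].
  - move=> i j ij; rewrite mxE [u i j]h ?addr0; last first.
      have ji : (j < i)%N by rewrite -[(j < i)%N](rank_dirC false).
      by rewrite /upper_support /= ltnNge (ltnW ji).
    by rewrite mxE; case: eqP => // E; move: ij; rewrite E ltnn.
  - by move=> i; rewrite mxE [u i i]h ?addr0 ?mxE ?eqxx // /upper_support /= ltnn.
  - by move=> i j ij; rewrite h // /upper_support /= negb_and -(ltnNge (level psi i)) ij orbT.
rewrite /upper_support /= negb_and => /orP[ij|ij]; last by apply: pp; rewrite ltnNge.
have [<-|ne] := eqVneq i j.
  by have := du i; rewrite !mxE eqxx => /eqP; rewrite -[X in _ == X]addr0 (inj_eq (addrI _)) =>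
    /eqP.
have := pu i j; rewrite !mxE (negbTE ne) add0r; apply.
rewrite (rank_dirC false) /= ltn_neqAle leqNgt ij andbT eq_sym.
by rewrite (inj_eq val_inj).
Qed.

Lemma lower_supportP (F : fieldType) (n k : nat) (omega : {ffun 'I_n -> 'I_k}) (v : 'M[F]_n) :
  supported (lower_support omega) v <->
  pat (rank_dir true) (rank_dir true) v /\ pat (level omega) (level omega) v.
Proof.
split=> [h|[pv pp] i j].
  by split=> i j ij; rewrite h // /lower_support /= negb_and -!ltnNge ij ?orbT.
by rewrite /lower_support /= negb_and => /orP[ij|ij]; [apply: pv|apply: pp]; rewrite ltnNge.
Qed.

Lemma pattern_supportP (F : fieldType) (n k : nat) (psi omega : {ffun 'I_n -> 'I_k}) (g : 'M[F]_n) :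
  supported (pattern_support psi omega) g <-> pat (level psi) (level omega) g.
Proof.
split=> [h i j ij|h i j]; first by rewrite h // /pattern_support /= -ltnNge.
by rewrite /pattern_support /= -ltnNge; exact: h.
Qed.

Lemma linear_good (R : realType) (m n p q : nat) (T : Type) (x0 : T) (good : (T -> R) -> Prop)
    (G : regular_class x0 good) (f : {linear 'M[R]_(m, n) -> 'M[R]_(p, q)}) (A : T ->
      'M[R]_(m, n)) :
  good_mx good A -> good_mx good (fun t => f (A t)).
Proof.
move=> gA a b.
have E t : \sum_i \sum_j A t i j * f (delta_mx i j) a b = f (A t) a b.
  rewrite {2}[A t]matrix_sum_delta linear_sum summxE; apply: eq_bigr => i _.
  rewrite linear_sum summxE; apply: eq_bigr => j _.
  by rewrite linearZ mxE.
apply: good_ext E _; apply: (good_sum G) => i; apply: (good_sum G) => j.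
by apply: (reg_mul G) => //; exact: (reg_cst G).
Qed.

Lemma good_comp (R : realType) (T : topologicalType) (x0 : T) m n p q
    (A : T -> 'M[R]_(m, n)) (f : 'M[R]_(m, n) -> 'M[R]_(p, q)) :
  good_mx (fun f : T -> R => {for x0, continuous f}) A -> {for A x0, continuous f} ->
  good_mx (fun f : T -> R => {for x0, continuous f}) (fun t => f (A t)).
Proof.
move=> gA cf; apply: continuous_good_mx; apply: continuous_comp => //.
exact: good_mx_continuous.
Qed.

(** The inverse of K is again block triangular and equals the transpose, so K is block diagonal and
    Lambda is scalar on its blocks. *)
Lemma block_orth_comm (R : realType) (n k : nat) (lam : 'I_k -> R) (blk : {ffun 'I_n -> 'I_k})
    (K : 'M[R]_n) : pat (level blk) (level blk) K -> K *m K^T = 1%:M ->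
  K *m diag_mx (\row_i lam (blk i)) = diag_mx (\row_i lam (blk i)) *m K.
Proof.
move=> pK oK; have [uK KV] := invmx_orth oK; have := pat_inv uK pK; rewrite KV => pKT.
apply/matrixP => i j; rewrite mul_mx_diag mul_diag_mx !mxE.
case: (ltngtP (blk i) (blk j)) => h.
- by rewrite pK // mul0r mulr0.
- by have := pKT j i h; rewrite mxE => ->; rewrite mul0r mulr0.
- by rewrite (val_inj h) mulrC.
Qed.

Lemma invmx_mul (F : fieldType) n (A B : 'M[F]_n) : A \in unitmx -> B \in unitmx ->
  invmx (A *m B) = invmx B *m invmx A.
Proof.
move=> uA uB; have [] // := @unitmx_left _ _ (A *m B) (invmx B *m invmx A).
by rewrite mulmxA mulmxK // mulmxV.
Qed.

Lemma invmx_conj (F : fieldType) n (A B : 'M[F]_n) : A \in unitmx -> B \in unitmx ->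
  invmx (invmx A *m invmx B *m A) = invmx A *m B *m A.
Proof.
move=> uA uB; have [] // := @unitmx_left _ _ (invmx A *m invmx B *m A) (invmx A *m B *m A).
by rewrite !mulmxA mulmxK // mulmxKV // mulVmx.
Qed.

Lemma row_reducer_factor (R : realType) (n k : nat) b (tau : {ffun 'I_n ->
  'I_k}) (z N q : 'M[R]_n) :
  reducible_by_rows b tau z -> pat (rank_dir b) (rank_dir b) N -> q \in unitmx ->
  pat (level tau) (level tau) q -> z = N *m q ->
  pat (level tau) (level tau) (row_reducer b tau z *m N).
Proof.
move=> rz pN uq pq E; have := pat_mul (row_reducer_pat rz pN pq E) (pat_inv uq pq).
by rewrite {2}E -mulmxA mulmxK.
Qed.

(** In the cell, the frame relative to the base factors n0 and Y0 is a triangular matrix times one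
    preserving levels, the form [row_reducer_pat] asks for. H absorbs the block triangular ambiguity
    of the lifted frame. *)
Lemma row_reduced_cell (R : realType) (n k : nat) b (blk tau : {ffun 'I_n -> 'I_k})
    (n0 Y0 P H : 'M[R]_n) :
  same_content tau blk -> n0 \in unitmx -> pat (rank_dir b) (rank_dir b) n0 ->
  Y0 \in unitmx -> pat (level tau) (level blk) Y0 ->
  in_cell b blk tau P -> pat (level blk) (level blk) H ->
  reducible_by_rows b tau (invmx n0 *m (P *m H) *m invmx Y0) ->
  pat (level tau) (level tau)
    (row_reducer b tau (invmx n0 *m (P *m H) *m invmx Y0) *m (invmx n0 *m (P *m H) *m invmx Y0)).
Proof.
move=> tc un pn uY pY [C [Y [uC pC uY' pY' PE]]] pH rz.
have [s hs] := same_content_perm tc.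
have pYV : pat (level blk) (level tau) (invmx Y0).
  by apply: (pat_inv_perm (s := s)) => // i; rewrite /level hs.
apply: (row_reducer_pat rz (pat_mul (pat_inv un pn) pC) (q := Y *m H *m invmx Y0)).
  by apply: pat_mul pYV; exact: pat_mul pY' pH.
by rewrite PE !mulmxA.
Qed.

Lemma block_orth_conj (R : realType) (n k : nat) (lam : 'I_k -> R) (blk : {ffun 'I_n -> 'I_k})
    (P K : 'M[R]_n) : P *m P^T = 1%:M -> pat (level blk) (level blk) K ->
  (P *m K) *m (P *m K)^T = 1%:M ->
  (P *m K) *m diag_mx (\row_i lam (blk i)) *m (P *m K)^T =
  P *m diag_mx (\row_i lam (blk i)) *m P^T.
Proof.
move=> oP pK; rewrite trmx_mul => E.
have oK : K *m K^T = 1%:M.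
  have KE : K *m K^T = P^T *m (P *m K *m (K^T *m P^T)) *m P.
    by rewrite !mulmxA (orthT oP) mul1mx -mulmxA (orthT oP) mulmx1.
  by rewrite KE E mulmx1 (orthT oP).
rewrite -(mulmxA P K) (block_orth_comm lam pK oK).
by rewrite !mulmxA -(mulmxA _ K K^T) oK mulmx1.
Qed.

Lemma reduced_quotient_identity (F : fieldType) n (c1 c2 g z : 'M[F]_n) :
  c1 \in unitmx -> c2 *m g *m invmx c1 *m (c1 *m z) = c2 *m (g *m z).
Proof. by move=> uc; rewrite !mulmxA mulmxKV. Qed.

Lemma slice_quotient_identity (F : fieldType) n (b0 n0 g N c1 c2 : 'M[F]_n) :
  b0 \in unitmx -> n0 \in unitmx -> b0 *m g *m invmx n0 *m N \in unitmx ->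
  (c2 *m invmx b0 *m invmx (b0 *m g *m invmx n0 *m N) *m b0) *m g *m
    (invmx n0 *m N *m n0 *m invmx c1) = c2 *m (invmx b0 *m n0) *m invmx c1.
Proof.
move=> ub un uU; set U := b0 *m g *m invmx n0 *m N in uU *.
have -> : c2 *m invmx b0 *m invmx U *m b0 *m g *m (invmx n0 *m N *m n0 *m invmx c1) =
    c2 *m invmx b0 *m (invmx U *m U) *m n0 *m invmx c1 by rewrite /U !mulmxA.
by rewrite mulVmx // mulmx1 !mulmxA.
Qed.

Lemma good_qr_factor (R : realType) n (T : Type) (x0 : T) (good : (T -> R) -> Prop)
    (G : regular_class x0 good) (A : T -> 'M[R]_n) :
  A x0 \in unitmx -> good_mx good A -> good_mx good (fun t => qr_factor (A t)).
Proof.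
rewrite -unitmx_tr => uA gA i j.
have opp (x y : 'I_n) :
  (rank_dir false x < rank_dir false y)%N = (rank_dir true y < rank_dir true x)%N.
  exact: (rank_dirC false).
have := good_gram_schmidt (@rank_dir_inj n false) opp G uA (good_trmx gA) j i.
by apply: good_ext => t; rewrite [RHS]mxE trmxK.
Qed.

Lemma slice_UL_identity (F : fieldType) n (b0 n0 A C c1 c2 : 'M[F]_n) :
  b0 *m (invmx A *m (c2 *m (invmx b0 *m n0) *m invmx c1) *m invmx C) *m invmx n0 =
  (b0 *m (invmx A *m c2) *m invmx b0) *m (n0 *m invmx c1 *m invmx C *m invmx n0).
Proof. by rewrite !mulmxA. Qed.

Lemma frame_change_identity (F : fieldType) n (n0 Y0 z c C : 'M[F]_n) :
  n0 \in unitmx -> Y0 \in unitmx -> z \in unitmx -> c \in unitmx ->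
  (n0 *m invmx c *m invmx C *m invmx n0) *m (n0 *m Y0) =
  (n0 *m z *m Y0) *m (invmx Y0 *m invmx (c *m z) *m invmx C *m Y0).
Proof.
by move=> un uY uz uc; rewrite invmx_mul // !mulmxA mulmxKV // mulmxK // mulmxK.
Qed.

(** * The chart around a given point *)

Section Chart.
Variables (R : realType) (n k d : nat) (lam : 'I_k -> R) (blk psi omega : {ffun 'I_n -> 'I_k}).
Hypothesis lam_incr : forall a b : 'I_k, (a < b)%N -> lam a < lam b.
Hypothesis blk_mono : forall i j : 'I_n, (i <= j)%N -> (blk i <= blk j)%N.
Hypotheses (psi_content : same_content psi blk) (omega_content : same_content omega blk).
Let dd : 'rV[R]_n := \row_i lam (blk i).
Let D := diag_mx dd.

Variables P0 n0 Y0 b0 Y1 : 'M[R]_n.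
Hypothesis o0 : P0 *m P0^T = 1%:M.
Hypotheses (un0 : n0 \in unitmx) (pn0 : pat (rank_dir true) (rank_dir true) n0).
Hypotheses (uY0 : Y0 \in unitmx) (pY0 : pat (level omega) (level blk) Y0) (P0E : P0 = n0 *m Y0).
Hypotheses (ub0 : b0 \in unitmx) (pb0 : pat (rank_dir false) (rank_dir false) b0).
Hypotheses (uY1 : Y1 \in unitmx) (pY1 : pat (level psi) (level blk) Y1) (P0E' : P0 = b0 *m Y1).
Let g0 := invmx b0 *m n0.

Variables (a w c : {linear 'M[R]_n -> 'M[R]_n}) (io : {linear 'rV[R]_d -> 'M[R]_n}).
Variable ka : {linear 'M[R]_n -> 'rV[R]_d}.
Hypothesis a_unip : forall x : 'M[R]_n, unip false (1%:M + a x).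
Hypothesis a_pat : forall x : 'M[R]_n, pat (level psi) (level psi) (a x).
Hypothesis c_tri : forall x : 'M[R]_n, pat (rank_dir true) (rank_dir true) (c x).
Hypothesis c_pat : forall x : 'M[R]_n, pat (level omega) (level omega) (c x).
Hypothesis decomp : forall x : 'M[R]_n, pat (level psi) (level omega) x ->
  x = a x *m g0 + w x + g0 *m c x.
Hypothesis io_pat : forall t, pat (level psi) (level omega) (io t).
Hypothesis ioK : cancel io ka.
Hypothesis ka_slice : forall x : 'M[R]_n, io (ka (w x)) = w x.
Hypothesis decomp_uniq : forall (u v : 'M[R]_n) t, unip false (1%:M + u) ->
  pat (level psi) (level psi) u ->
  pat (rank_dir true) (rank_dir true) v -> pat (level omega) (level omega) v ->
  let x := u *m g0 + io t + g0 *m v in [/\ a x = u, c x = v & w x = io t].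

Variables (r : R) (G : 'M[R]_n -> 'M[R]_n).
Hypothesis r0 : 0 < r.
Hypothesis G0 : G 0 = 0.
Hypothesis GK : forall y : 'M[R]_n, `|y| <= r / 2 -> G y + quad_term g0 a w c (G y) = y.
Hypothesis KG : forall x : 'M[R]_n, `|x| <= r -> `|x + quad_term g0 a w c x| <= r / 2 ->
  G (x + quad_term g0 a w c x) = x.
Hypothesis Gcont : forall y : 'M[R]_n, `|y| < r / 2 -> {for y, continuous G}.

Let X0 := conjL D P0.
Let Zl X := spectral_lift lam blk P0 X.
Let z1 X := invmx n0 *m Zl X *m invmx Y0.
Let z2 X := invmx b0 *m Zl X *m invmx Y1.
Let c1 X := row_reducer true omega (z1 X).
Let c2 X := row_reducer false psi (z2 X).
(** The normalized matrix of the flag of X. On the variety z2 g0 = g0 z1, and row reduction of both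
    sides forces the pattern of (psi, omega) on [gX X]. *)
Let gX X := c2 X *m g0 *m cramer (c1 X).
Let f X : 'rV[R]_d := ka (w (G (gX X - g0))).
Let condU X := [/\ Zl X \in unitmx, reducible_by_rows true omega (z1 X),
  reducible_by_rows false psi (z2 X) & `|gX X - g0| < r / 2].

(** The inverse chart: g0 + io v is transported to a matrix near 1, split into triangular factors,
    and the lower one moves the frame P0, which is then made orthogonal. *)
Let h v := b0 *m (g0 + io v) *m invmx n0.
Let N v := tri_factor (rank_dir true) (h v).
Let U v := h v *m N v.
Let Zv v := cramer (N v) *m P0.
Let Pv v := Zv v *m qr_factor (Zv v).
Let Xv v := Pv v *m D *m (Pv v)^T.
(** These factors satisfy e2 (g0 + io v) e1 = gX (Xv v). Thus [gam v] is the candidate for G (gX (Xv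
    v) - g0), and its smallness in [condV] lets uniqueness of the local inverse identify the two. *)
Let e2 v := c2 (Xv v) *m invmx b0 *m cramer (U v) *m b0.
Let e1 v := invmx n0 *m N v *m n0 *m cramer (c1 (Xv v)).
Let gam v := (e2 v - 1%:M) *m g0 + io v + g0 *m (e1 v - 1%:M).
Let condN v := forall j : 'I_n, mixrows [pred x | (rank_dir true x < rank_dir true j)%N] (h v) \in
  unitmx.
Let condV v := condN v /\ `|gam v| < r.

Let g0E : g0 = Y1 *m invmx Y0.
Proof. by rewrite /g0 -[n0](mulmxK uY0) -P0E P0E' -!mulmxA mulKmx. Qed.

Let ug0 : g0 \in unitmx.
Proof. by rewrite unitmx_mul unitmx_inv ub0. Qed.

Let pYV0 : pat (level blk) (level omega) (invmx Y0).
Proof.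
have [s hs] := same_content_perm omega_content.
by apply: (pat_inv_perm (s := s)) => // i; rewrite /level hs.
Qed.

Let pYV1 : pat (level blk) (level psi) (invmx Y1).
Proof.
have [s hs] := same_content_perm psi_content.
by apply: (pat_inv_perm (s := s)) => // i; rewrite /level hs.
Qed.

Let pg0 : pat (level psi) (level omega) g0.
Proof. by rewrite g0E; exact: pat_mul pY1 pYV0. Qed.

(** G inverts a map on all matrices, whereas [decomp] holds only on the pattern. Solving GK for G y
    keeps the pattern, because the quadratic term has it for every argument. *)
Let G_pat y : `|y| <= r / 2 -> pat (level psi) (level omega) y ->
  pat (level psi) (level omega) (G y).
Proof.
move=> yr py; have w_pat x : pat (level psi) (level omega) (w x).
  by rewrite -ka_slice; exact: io_pat.
have -> : G y = y - quad_term g0 a w c (G y) by rewrite -{2}(GK yr) addrK.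
apply: pat_add py _; apply: pat_opp; apply: pat_add.
  apply: pat_add; last exact: pat_mul (w_pat _) (c_pat _).
  apply: pat_add; first exact: pat_mul (a_pat _) (w_pat _).
  exact: pat_mul (pat_mul (a_pat _) pg0) (c_pat _).
exact: pat_mul (pat_mul (a_pat _) (w_pat _)) (c_pat _).
Qed.

Let U_unip v : condN v -> unip false (U v) /\ N v \in unitmx.
Proof.
move=> cN; have UE i j : (rank_dir true j <= rank_dir true i)%N -> U v i j = (i == j)%:R.
  exact: tri_factor_mul.
have uU : unip false (U v).
  split=> [i j|i]; last by rewrite UE // eqxx.
  rewrite (rank_dirC false) /= => ij; rewrite UE ?(ltnW ij) //.
  by case: eqP => // E; move: ij; rewrite E ltnn.
by split=> //; have := unip_unit uU; rewrite unitmx_mul => /andP[].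
Qed.

Let N_pat v : condN v -> pat (rank_dir true) (rank_dir true) (N v).
Proof. exact: tri_factor_pat. Qed.

Let h_unit v : condN v -> h v \in unitmx.
Proof. by move=> /U_unip[/unip_unit]; rewrite unitmx_mul => /andP[]. Qed.

Let gio_unit v : condN v -> g0 + io v \in unitmx.
Proof. by move=> /h_unit; rewrite !unitmx_mul => /andP[/andP[]]. Qed.

Let uP0 : P0 \in unitmx := (invmx_orth o0).1.

Let Zv_unit v : condN v -> Zv v \in unitmx.
Proof. by move=> cN; have [_ uN] := U_unip cN; rewrite unitmx_mul cramerE // unitmx_inv uN. Qed.

(** The same frame read through the other base factorization, which exhibits it in the upper
    cell. *)
Let ZvE v : condN v -> Zv v = invmx (U v) *m b0 *m ((g0 + io v) *m Y0).
Proof.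
move=> cN; have [/unip_unit uU uN] := U_unip cN.
have E : U v *m (invmx (N v) *m n0) = b0 *m (g0 + io v).
  by rewrite /U mulmxA mulmxK // /h mulmxKV.
rewrite /Zv cramerE // P0E; apply: (can_inj (mulKmx uU)).
by rewrite !mulmxA mulmxV // mul1mx -E !mulmxA.
Qed.

Let Zv_cells v : condN v -> in_cell true blk omega (Zv v) /\ in_cell false blk psi (Zv v).
Proof.
move=> cN; have [uU uN] := U_unip cN; split.
  exists (invmx (N v) *m n0), Y0; split => //.
  - by rewrite unitmx_mul unitmx_inv uN.
  - exact: pat_mul (pat_inv uN (N_pat cN)) pn0.
  - by rewrite /Zv cramerE // P0E mulmxA.
exists (invmx (U v) *m b0), ((g0 + io v) *m Y0); split; last exact: ZvE.
- by rewrite unitmx_mul unitmx_inv (unip_unit uU).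
- by apply: pat_mul pb0; exact: (unip_inv uU).1.
- by rewrite unitmx_mul gio_unit.
- by apply: pat_mul pY0; apply: pat_add.
Qed.

Let Pv_orth v : condN v -> Pv v *m (Pv v)^T = 1%:M.
Proof. by move=> cN; exact: qr_factor_orth (Zv_unit cN). Qed.

Let XvE v : condN v -> Xv v = conjL D (Pv v).
Proof. by move=> cN; rewrite conjL_orth // Pv_orth. Qed.

Let Xv_richardson v : condN v -> richardson dd blk psi omega (Xv v).
Proof.
move=> cN; have [k1 k2] := Zv_cells cN; rewrite XvE //.
exact: (richardson_of_cells _ blk_mono (Zv_unit cN) k1 k2).
Qed.

(** Writing gX as (1 + a)(g0 + w)(1 + c) factors h (f X) as U' W' with opposite triangular factors.
    Uniqueness makes W' the inverse of the computed N, so the rebuilt frame differs from that of X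
    by a block triangular matrix. *)
Let chart_inverse_left X : richardson dd blk psi omega X -> condU X -> condN (f X) -> Xv (f X) = X.
Proof.
move=> [P [[oP _] k1 k2 XE]] [uZ rz1 rz2 gr] cN.
have [H pH ZE] := spectral_lift_pat blk (lam_inj lam_incr) P0 oP.
have ZE' : Zl X = P *m H by rewrite /Zl XE ZE.
have q1P : pat (level omega) (level omega) (c1 X *m z1 X).
  by move: rz1; rewrite /c1 /z1 ZE'; apply: row_reduced_cell pY0 k1 pH.
have q2P : pat (level psi) (level psi) (c2 X *m z2 X).
  by move: rz2; rewrite /c2 /z2 ZE'; apply: row_reduced_cell pY1 k2 pH.
have uc1 := unip_unit (row_reducer_unip rz1); rewrite -/(c1 X) in uc1.
have uc2 := unip_unit (row_reducer_unip rz2); rewrite -/(c2 X) in uc2.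
have uz1 : z1 X \in unitmx by rewrite !unitmx_mul !unitmx_inv un0 uZ.
have uz2 : z2 X \in unitmx by rewrite !unitmx_mul !unitmx_inv ub0 uZ.
have uq1 : c1 X *m z1 X \in unitmx by rewrite unitmx_mul uc1.
have Zz1 : Zl X = n0 *m z1 X *m Y0 by rewrite /z1 !mulmxA mulmxV // mul1mx mulmxKV.
have Zz2 : Zl X = b0 *m z2 X *m Y1 by rewrite /z2 !mulmxA mulmxV // mul1mx mulmxKV.
(* Both sides are b0^-1 Z Y0^-1 with Z the lifted frame. *)
have gz : z2 X *m g0 = g0 *m z1 X.
  apply: (can_inj (mulKmx ub0)); apply: (can_inj (mulmxK uY0)).
  rewrite {1}g0E (mulmxA (z2 X)) (mulmxA b0 _ (invmx Y0)) mulmxKV // (mulmxA b0) -Zz2.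
  by rewrite /g0 -(mulmxA (invmx b0)) mulKVmx // -Zz1.
have gXq : gX X *m (c1 X *m z1 X) = c2 X *m z2 X *m g0.
  rewrite /gX cramerE //; apply: etrans (reduced_quotient_identity _ _ _ uc1) _.
  by rewrite -gz mulmxA.
have gXp : pat (level psi) (level omega) (gX X).
  rewrite -[gX X](mulmxK uq1) gXq.
  exact: pat_mul (pat_mul q2P pg0) (pat_inv uq1 q1P).
have ugX : gX X \in unitmx by rewrite unitmx_mul cramerE // unitmx_inv uc1 andbT unitmx_mul uc2;
  exact: ug0.
set x := G (gX X - g0).
have px : pat (level psi) (level omega) x.
  by apply: G_pat; [exact: ltW|apply: pat_add gXp _; exact: pat_opp].
have gXE : gX X = (1%:M + a x) *m (g0 + w x) *m (1%:M + c x).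
  have := quad_termE (decomp px); rewrite (GK (ltW gr)).
  by move=> /(congr1 (+%R^~ g0)); rewrite !subrK.
have iof : io (f X) = w x by rewrite /f ka_slice.
have uc : 1%:M + c x \in unitmx by move: ugX; rewrite gXE !unitmx_mul => /andP[].
have ua := unip_unit (a_unip x).
set U' := b0 *m (invmx (1%:M + a x) *m c2 X) *m invmx b0.
set W' := n0 *m invmx (c1 X) *m invmx (1%:M + c x) *m invmx n0.
have hE : h (f X) = U' *m W'.
  have E : g0 + w x = invmx (1%:M + a x) *m gX X *m invmx (1%:M + c x).
    by rewrite gXE -(mulmxA (1%:M + a x)) mulKmx // mulmxK.
  by rewrite /h iof E /gX cramerE //; exact: slice_UL_identity.
have U'_unip : unip false U'.
  apply: unip_conj ub0 pb0 _; apply: unip_mul; first exact: unip_inv.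
  exact: row_reducer_unip.
have W'_pat : pat (rank_dir true) (rank_dir true) W'.
  have c1p : pat (rank_dir true) (rank_dir true) (invmx (c1 X)).
    by apply: pat_inv uc1 _; exact: (row_reducer_unip rz1).1.
  have cp : pat (rank_dir true) (rank_dir true) (invmx (1%:M + c x)).
    by apply: pat_inv uc _; apply: pat_add (c_tri _); exact: pat1.
  exact: pat_mul (pat_mul (pat_mul pn0 c1p) cp) (pat_inv un0 pn0).
have [uU uN] := U_unip cN.
have W'N : W' *m N (f X) = 1%:M.
  have E : invmx U' *m U (f X) = W' *m N (f X).
    by rewrite /U hE -(mulmxA U') mulKmx //; exact: unip_unit U'_unip.
  rewrite -E; apply: (@unip_opposite _ _ false); first exact: unip_mul (unip_inv U'_unip) uU.
  by rewrite E; exact: pat_mul W'_pat (N_pat cN).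
have NV : invmx (N (f X)) = W' by have [] := unitmx_left (mulmx1C W'N).
set p := invmx Y0 *m invmx (c1 X *m z1 X) *m invmx (1%:M + c x) *m Y0.
have pp : pat (level blk) (level blk) p.
  apply: pat_mul pY0; apply: pat_mul.
    exact: pat_mul pYV0 (pat_inv uq1 q1P).
  by apply: pat_inv uc _; apply: pat_add (c_pat _); exact: pat1.
have ZvZ : Zv (f X) = Zl X *m p.
  by rewrite /Zv cramerE // NV P0E Zz1; exact: frame_change_identity.
have PvE : Pv (f X) = P *m (H *m p *m qr_factor (Zv (f X))).
  by rewrite /Pv {1}ZvZ ZE' !mulmxA.
set K := H *m p *m _ in PvE.
have pK : pat (level blk) (level blk) K.
  exact: pat_mul (pat_mul pH pp) (qr_factor_pat blk_mono (Zv_unit cN)).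
have oPK : (P *m K) *m (P *m K)^T = 1%:M by rewrite -PvE; exact: Pv_orth.
by rewrite /Xv PvE (block_orth_conj lam oP pK oPK) XE conjL_orth.
Qed.

(** Row reduction of the rebuilt frame shows that e1 and e2 have the levels and triangularity
    demanded by [decomp_uniq], so the slice component of [gam v] is io v. Injectivity near 0 then
    gives G (gX - g0) = gam v. *)
Let chart_inverse_right v : condV v -> condU (Xv v) -> f (Xv v) = v.
Proof.
move=> [cN gr] [uZ rz1 rz2 gX_small].
have oP := Pv_orth cN; have [uU uN] := U_unip cN; have uUU := unip_unit uU.
have [H pH ZE] := spectral_lift_pat blk (lam_inj lam_incr) P0 oP.
set p := qr_factor (Zv v) *m H.
have ZE' : Zl (Xv v) = Zv v *m p by rewrite /Zl XvE // ZE /Pv /p mulmxA.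
have pp : pat (level blk) (level blk) p.
  by apply: pat_mul pH; exact: (qr_factor_pat blk_mono (Zv_unit cN)).
have up : p \in unitmx by move: uZ; rewrite ZE' unitmx_mul => /andP[].
have uc1 := unip_unit (row_reducer_unip rz1); rewrite -/(c1 (Xv v)) in uc1.
have uc2 := row_reducer_unip rz2; rewrite -/(c2 (Xv v)) in uc2.
pose nu1 := invmx n0 *m invmx (N v) *m n0.
have nu1_pat : pat (rank_dir true) (rank_dir true) nu1.
  exact: pat_mul (pat_mul (pat_inv un0 pn0) (pat_inv uN (N_pat cN))) pn0.
have z1E : z1 (Xv v) = nu1 *m (Y0 *m p *m invmx Y0).
  by rewrite /z1 ZE' /Zv cramerE // P0E /nu1 !mulmxA.
have E1p : pat (level omega) (level omega) (c1 (Xv v) *m nu1).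
  apply: (row_reducer_factor rz1 nu1_pat _ _ z1E).
    by rewrite unitmx_mul unitmx_inv uY0 andbT unitmx_mul uY0; exact: up.
  exact: pat_mul (pat_mul pY0 pp) pYV0.
have unu1 : nu1 \in unitmx by rewrite !unitmx_mul !unitmx_inv un0 uN.
have uE1 : c1 (Xv v) *m nu1 \in unitmx by rewrite unitmx_mul uc1.
have e1E : e1 v = invmx (c1 (Xv v) *m nu1).
  rewrite invmx_mul // /e1 cramerE //; congr (_ *m _).
  by rewrite invmx_conj.
have e1_pat : pat (level omega) (level omega) (e1 v) by rewrite e1E; exact: pat_inv.
have e1_tri : pat (rank_dir true) (rank_dir true) (e1 v).
  by rewrite e1E; apply: pat_inv uE1 _; apply: pat_mul nu1_pat; exact: (row_reducer_unip rz1).1.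
pose nu2 := invmx b0 *m invmx (U v) *m b0.
have nu2_unip : unip false nu2.
  have := unip_conj (b := false) (B := invmx b0) _ (pat_inv ub0 pb0) (unip_inv uU).
  by rewrite unitmx_inv invmxK; apply.
have z2E : z2 (Xv v) = nu2 *m ((g0 + io v) *m Y0 *m p *m invmx Y1).
  by rewrite /z2 ZE' ZvE // /nu2 !mulmxA.
have e2E : e2 v = c2 (Xv v) *m nu2 by rewrite /e2 cramerE // /nu2 !mulmxA.
have e2_pat : pat (level psi) (level psi) (e2 v).
  rewrite e2E; apply: (row_reducer_factor rz2 nu2_unip.1 _ _ z2E).
    by rewrite unitmx_mul unitmx_inv uY1 andbT unitmx_mul up andbT unitmx_mul uY0 andbT gio_unit.
  apply: pat_mul pYV1; apply: pat_mul pp; apply: pat_mul pY0; exact: pat_add.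
have e2_unip : unip false (e2 v) by rewrite e2E; exact: unip_mul.
pose u := e2 v - 1%:M; pose vv := e1 v - 1%:M.
have u1 : 1%:M + u = e2 v by rewrite /u addrC subrK.
have v1 : 1%:M + vv = e1 v by rewrite /vv addrC subrK.
have [ax cx wx] : [/\ a (gam v) = u, c (gam v) = vv & w (gam v) = io v].
  apply: decomp_uniq.
  - by rewrite u1.
  - by apply: pat_add e2_pat _; apply: pat_opp; exact: pat1.
  - by apply: pat_add e1_tri _; apply: pat_opp; exact: pat1.
  - by apply: pat_add e1_pat _; apply: pat_opp; exact: pat1.
have gamE : gam v + quad_term g0 a w c (gam v) = gX (Xv v) - g0.
  rewrite quad_termE ax cx wx // u1 v1; congr (_ - g0).
  by rewrite /e2 /e1 /gX !cramerE //; apply: slice_quotient_identity.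
have := KG (ltW gr); rewrite gamE => /(_ (ltW gX_small)) Gx.
by rewrite /f Gx wx ioK.
Qed.

Local Notation cont_mx x := (good_mx (fun g => {for x, continuous g})).

Let good_Zl X : cont_mx X Zl.
Proof. by apply: continuous_good_mx; exact: spectral_lift_continuous. Qed.

Let good_z1 X : cont_mx X z1.
Proof.
have GX := regular_class_continuous R X.
exact: (good_mulmx GX (good_mulmx GX (good_cmx GX _) (@good_Zl X)) (good_cmx GX _)).
Qed.

Let good_z2 X : cont_mx X z2.
Proof.
have GX := regular_class_continuous R X.
exact: (good_mulmx GX (good_mulmx GX (good_cmx GX _) (@good_Zl X)) (good_cmx GX _)).
Qed.

Let good_c1 X : reducible_by_rows true omega (z1 X) -> cont_mx X c1.
Proof. by move=> rz; exact: good_comp (@good_z1 X) (row_reducer_continuous rz). Qed.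

Let good_c2 X : reducible_by_rows false psi (z2 X) -> cont_mx X c2.
Proof. by move=> rz; exact: good_comp (@good_z2 X) (row_reducer_continuous rz). Qed.

Let good_gX X : reducible_by_rows true omega (z1 X) -> reducible_by_rows false psi (z2 X) ->
  cont_mx X gX.
Proof.
move=> rz1 rz2; have GX := regular_class_continuous R X.
have h1 := good_mulmx GX (@good_c2 X rz2) (good_cmx GX g0).
exact: (good_mulmx GX h1 (good_cramer GX (@good_c1 X rz1) (unip_unit (row_reducer_unip rz1)))).
Qed.

Let f_cont X : condU X -> {for X, continuous f}.
Proof.
move=> [uZ rz1 rz2 gr]; have GX := regular_class_continuous R X.
have gd : cont_mx X (fun X => gX X - g0).
  exact: (good_addmx GX (@good_gX X rz1 rz2) (good_cmx GX (- g0))).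
apply: good_mx_continuous; apply: (linear_good GX ka); apply: (linear_good GX w).
exact: (good_comp gd (Gcont gr)).
Qed.

Let base_z : [/\ Zl X0 = P0, z1 X0 = 1%:M & z2 X0 = 1%:M].
Proof.
have ZE : Zl X0 = P0 by exact: (spectral_lift_base blk (lam_inj lam_incr) o0).
split=> //.
  by rewrite /z1 ZE P0E mulKmx // mulmxV.
by rewrite /z2 ZE P0E' mulKmx // mulmxV.
Qed.

Let base_c : [/\ c1 X0 = 1%:M, c2 X0 = 1%:M & gX X0 = g0].
Proof.
have [_ z1E z2E] := base_z.
have E1 : c1 X0 = 1%:M by rewrite /c1 z1E row_reducer1.
have E2 : c2 X0 = 1%:M by rewrite /c2 z2E row_reducer1.
by split=> //; rewrite /gX E1 E2 cramerE ?unitmx1 // invmx1 mul1mx mulmx1.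
Qed.

Let base_f : f X0 = 0.
Proof. by have [_ _ E] := base_c; rewrite /f E subrr G0 !linear0. Qed.

Let condU_near : \forall X \near X0, condU X.
Proof.
have [ZE z1E z2E] := base_z; have [_ _ gE] := base_c.
have rz1 : reducible_by_rows true omega (z1 X0) by rewrite z1E; exact: reducible1.
have rz2 : reducible_by_rows false psi (z2 X0) by rewrite z2E; exact: reducible1.
have n1 : \forall X \near X0, Zl X \in unitmx.
  by apply: unitmx_near (@good_Zl X0) _; rewrite ZE.
have n2 : \forall X \near X0, reducible_by_rows true omega (z1 X).
  exact: (good_mx_continuous (@good_z1 X0) (reducible_near rz1)).
have n3 : \forall X \near X0, reducible_by_rows false psi (z2 X).
  exact: (good_mx_continuous (@good_z2 X0) (reducible_near rz2)).
have n4 : \forall X \near X0, `|gX X - g0| < r / 2.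
  have cg := good_mx_continuous (@good_gX X0 rz1 rz2).
  have r2 : 0 < r / 2 by rewrite divr_gt0.
  have /cvgrPdistC_lt/(_ _ r2) := cg; rewrite gE; apply: filterS => X; exact.
near=> X; split; near: X => //.
Unshelve. all: by end_near. Qed.

Let good_h v : cont_mx v h.
Proof.
have GV := regular_class_continuous R v.
have gid : cont_mx v (@id 'rV[R]_d) by apply: continuous_good_mx.
have h1 := good_addmx GV (good_cmx GV g0) (linear_good GV io gid).
exact: (good_mulmx GV (good_mulmx GV (good_cmx GV b0) h1) (good_cmx GV (invmx n0))).
Qed.

Let good_N v : condN v -> cont_mx v N.
Proof. by move=> cN; exact: (good_tri_factor (regular_class_continuous R v) (@good_h v) cN). Qed.

Let good_Zv v : condN v -> cont_mx v Zv.
Proof.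
move=> cN; have GV := regular_class_continuous R v; have [_ uN] := U_unip cN.
exact: (good_mulmx GV (good_cramer GV (@good_N v cN) uN) (good_cmx GV P0)).
Qed.

Let good_Xv v : condN v -> cont_mx v Xv.
Proof.
move=> cN; have GV := regular_class_continuous R v.
have gP : cont_mx v Pv.
  exact: (good_mulmx GV (@good_Zv v cN) (good_qr_factor GV (Zv_unit cN) (@good_Zv v cN))).
exact: (good_mulmx GV (good_mulmx GV gP (good_cmx GV D)) (good_trmx gP)).
Qed.

Let base_h : h 0 = 1%:M.
Proof. by rewrite /h linear0 addr0 /g0 mulmxA mulmxV // mul1mx mulmxV. Qed.

Let base_condN : condN 0.
Proof. by move=> j; rewrite base_h mixrows1 unitmx1. Qed.

Let base_N : N 0 = 1%:M.
Proof.
apply/matrixP => i j; rewrite mxE base_h mixrows1 cramerE ?unitmx1 //.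
by rewrite invmx1.
Qed.

Let base_X : Xv 0 = X0.
Proof.
have Z0 : Zv 0 = P0 by rewrite /Zv base_N cramerE ?unitmx1 // invmx1 mul1mx.
have P0' : Pv 0 = P0 by rewrite /Pv Z0 /qr_factor (orthT o0) gram_schmidt1 trmx1 mulmx1.
by rewrite /Xv P0' /X0 conjL_orth.
Qed.

Let base_gam : gam 0 = 0.
Proof.
have [E1 E2 _] := base_c.
have e20 : e2 0 = 1%:M.
  by rewrite /e2 base_X E2 /U base_h base_N !mul1mx cramerE ?unitmx1 // invmx1 mulmx1 mulVmx.
have e10 : e1 0 = 1%:M.
  by rewrite /e1 base_X E1 base_N cramerE ?unitmx1 // invmx1 !mulmx1 mulVmx.
by rewrite /gam e20 e10 subrr linear0 mul0mx mulmx0 !addr0.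
Qed.

Let condN_near : \forall v \near (0 : 'rV[R]_d), condN v.
Proof.
apply: (@filter_forall _ _ (fun (j : 'I_n) v =>
  mixrows [pred x | (rank_dir true x < rank_dir true j)%N] (h v) \in unitmx) (nbhs (0 :
    'rV[R]_d))) => j.
apply: (unitmx_near (A := fun v => mixrows [pred x | (rank_dir true x < rank_dir true j)%N] (h v))).
  exact: (good_mixrows (regular_class_continuous R _) _ (@good_h 0)).
exact: base_condN.
Qed.

Let good_gam : cont_mx (0 : 'rV[R]_d) gam.
Proof.
have GV := regular_class_continuous R (0 : 'rV[R]_d).
have [z0 z1E z2E] := base_z.
have gX0 := @good_Xv 0 base_condN.
have rz1 : reducible_by_rows true omega (z1 (Xv 0)) by rewrite base_X z1E; exact: reducible1.
have rz2 : reducible_by_rows false psi (z2 (Xv 0)) by rewrite base_X z2E; exact: reducible1.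
have gc1 := good_comp gX0 (good_mx_continuous (@good_c1 _ rz1)).
have gc2 := good_comp gX0 (good_mx_continuous (@good_c2 _ rz2)).
have [uU uN] := U_unip base_condN.
have gN := @good_N 0 base_condN.
have gU : cont_mx (0 : 'rV[R]_d) U by exact: (good_mulmx GV (@good_h 0) gN).
have ge2 : cont_mx (0 : 'rV[R]_d) e2.
  have k1 := good_mulmx GV gc2 (good_cmx GV (invmx b0)).
  have k2 := good_mulmx GV k1 (good_cramer GV gU (unip_unit uU)).
  exact: (good_mulmx GV k2 (good_cmx GV b0)).
have ge1 : cont_mx (0 : 'rV[R]_d) e1.
  have k1 := good_mulmx GV (good_cmx GV (invmx n0)) gN.
  have k2 := good_mulmx GV k1 (good_cmx GV n0).
  exact: (good_mulmx GV k2 (good_cramer GV gc1 (unip_unit (row_reducer_unip rz1)))).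
have gid : cont_mx (0 : 'rV[R]_d) (@id 'rV[R]_d) by apply: continuous_good_mx.
have k1 := good_mulmx GV (good_addmx GV ge2 (good_cmx GV (- 1%:M))) (good_cmx GV g0).
have k2 := good_addmx GV k1 (linear_good GV io gid).
have k3 := good_mulmx GV (good_cmx GV g0) (good_addmx GV ge1 (good_cmx GV (- 1%:M))).
exact: (good_addmx GV k2 k3).
Qed.

Let condV_near : \forall v \near (0 : 'rV[R]_d), condV v.
Proof.
have n2 : \forall v \near (0 : 'rV[R]_d), `|gam v| < r.
  have /cvgrPdistC_lt/(_ _ r0) := good_mx_continuous good_gam; rewrite base_gam.
  by apply: filterS => v; rewrite subr0.
exact: filterI condN_near n2.
Qed.

Lemma richardson_chart : exists (U : set 'M[R]_n) (V : set 'rV[R]_d) (f : 'M[R]_n -> 'rV[R]_d)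
         (g : 'rV[R]_d -> 'M[R]_n),
    open U /\ U X0 /\ open V /\
    f @` (richardson dd blk psi omega `&` U) = V /\ g @` V = richardson dd blk psi omega `&` U /\
    (forall y, (richardson dd blk psi omega `&` U) y -> g (f y) = y) /\
    (forall v, V v -> f (g v) = v) /\
    {within richardson dd blk psi omega `&` U, continuous f} /\ {within V, continuous g}.
Proof.
(* The conditions are not open as stated; they hold near the base points, which therefore lie in
   their interiors. *)
apply: (@local_chart R n d _ X0 f Xv (interior condU) (interior condV)).
- exact: open_interior.
- exact: condU_near.
- by move=> X /interior_subset; exact: f_cont.
- exact: open_interior.
- by rewrite base_f; exact: condV_near.
- by move=> v /interior_subset[cN _]; exact: (good_mx_continuous (@good_Xv v cN)).
- by move=> X SX /interior_subset UX /interior_subset[cN _]; exact: chart_inverse_left.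
- move=> v /interior_subset Vv; split; first by case: Vv => cN _; exact: Xv_richardson.
  by move=> /interior_subset; exact: chart_inverse_right.
Qed.

End Chart.

(** * The dimension of open Richardson varieties *)

(** Lets square matrices be inferred as a complete normed space, as the fixed point argument
    requires. *)
HB.instance Definition _ (R : realType) (n : nat) := Complete.on 'M[R]_n.

Lemma lower_pattern_action (R : realType) (n k : nat) (blk psi omega : {ffun 'I_n -> 'I_k})
    (n0 Y0 b0 Y1 : 'M[R]_n) (g0 := invmx b0 *m n0) :
  same_content omega blk -> b0 \in unitmx -> Y0 \in unitmx ->
  pat (level omega) (level blk) Y0 -> pat (level psi) (level blk) Y1 ->
  n0 *m Y0 = b0 *m Y1 -> pat (level psi) (level omega) g0.
Proof.
move=> oc ub uY pY pY1 E; have [s hs] := same_content_perm oc.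
have pYV : pat (level blk) (level omega) (invmx Y0).
  by apply: (pat_inv_perm (s := s)) => // i; rewrite /level hs.
by rewrite /g0 -[n0](mulmxK uY) E -!mulmxA mulKmx //; exact: pat_mul pY1 pYV.
Qed.

(** Conjugating by b0 and n0 turns the equation into the equality of an upper unipotent and a lower
    triangular matrix, so both are the identity. *)
Lemma triangular_action_free (F : fieldType) (n : nat) (n0 b0 u v : 'M[F]_n) :
  n0 \in unitmx -> pat (rank_dir true) (rank_dir true) n0 ->
  b0 \in unitmx -> pat (rank_dir false) (rank_dir false) b0 ->
  unip false (1%:M + u) -> pat (rank_dir true) (rank_dir true) v ->
  u *m (invmx b0 *m n0) = invmx b0 *m n0 *m v -> u = 0.
Proof.
move=> un pn ub pb uu pv E.
have E' : b0 *m u *m invmx b0 = n0 *m v *m invmx n0.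
  have := congr1 (fun x => b0 *m x *m invmx n0) E.
  by rewrite !mulmxA mulmxK // mulmxV // mul1mx.
have H : b0 *m (1%:M + u) *m invmx b0 = 1%:M + n0 *m v *m invmx n0.
  by rewrite mulmxDr mulmx1 mulmxDl mulmxV // E'.
have : b0 *m (1%:M + u) *m invmx b0 = 1%:M.
  apply: (unip_opposite (unip_conj ub pb uu)); rewrite H.
  by apply: pat_add (@pat1 _ _ _) (pat_mul (pat_mul pn pv) (pat_inv un pn)).
rewrite mulmxDr mulmx1 mulmxDl mulmxV // -[X in _ = X -> _]addr0 => /addrI.
move=> /(congr1 (fun x => invmx b0 *m x *m b0)).
by rewrite -(mulmxA _ _ b0) mulmxKV // mulKmx // mulmx0 mul0mx => ->.
Qed.

Lemma richardson_manifold (R : realType) (n k d : nat) (lam : 'I_k -> R)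
    (blk psi omega : {ffun 'I_n -> 'I_k}) :
  (forall a b : 'I_k, (a < b)%N -> lam a < lam b) ->
  (forall i j : 'I_n, (i <= j)%N -> (blk i <= blk j)%N) ->
  same_content psi blk -> same_content omega blk ->
  inversions omega = (inversions psi + d)%N ->
  manifold_dim (richardson (\row_i lam (blk i)) blk psi omega) d.
Proof.
move=> lam_incr blk_mono pc oc inv X.
(* The chart is centred at the given point itself, with the factors witnessing its two cells as base
   factors. *)
move=> [P [[oP _] [n0 [Y0 [un pn uY pY PE]]] [b0 [Y1 [ub pb uY1 pY1 PE']]] ->]].
have po : same_content psi omega by move=> v; rewrite pc oc.
have pg := lower_pattern_action oc ub uY pY pY1 (etrans (esym PE) PE').
set g0 := invmx b0 *m n0 in pg.
have ug : g0 \in unitmx by rewrite unitmx_mul unitmx_inv ub.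
have mU (u : 'M[R]_n) : supported (upper_support psi) u ->
    supported (pattern_support psi omega) (u *m g0).
  by move=> /upper_supportP[_ pu]; apply/pattern_supportP; exact: pat_mul pu pg.
have mV (v : 'M[R]_n) : supported (lower_support omega) v ->
    supported (pattern_support psi omega) (g0 *m v).
  by move=> /lower_supportP[_ pv]; apply/pattern_supportP; exact: pat_mul pg pv.
have free (u v : 'M[R]_n) : supported (upper_support psi) u ->
    supported (lower_support omega) v -> u *m g0 = g0 *m v -> u = 0.
  move=> /upper_supportP[uu _] /lower_supportP[pv _].
  exact: triangular_action_free.
have dim := support_count po inv.
have [io [ka [io_s ioK slK uniq]]] := tr_basis ug mU mV free dim.
pose a := tr_left (upper_support psi) (lower_support omega) (pattern_support psi omega) g0.
pose c := tr_right (upper_support psi) (lower_support omega) (pattern_support psi omega) g0.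
pose w := tr_slice (upper_support psi) (lower_support omega) (pattern_support psi omega) g0.
have ha x : supported (upper_support psi) (a x) by exact: tr_left_supp.
have hc x : supported (lower_support omega) (c x) by exact: tr_right_supp.
have [r /andP[r0 _] lip] := quad_term_small g0 a w c.
have [G [G0 GK KG Gc]] := perturbed_identity_inverse r0 (quad_term0 g0 a w c) lip.
apply: (richardson_chart lam_incr blk_mono pc oc oP un pn uY pY PE ub pb uY1 pY1 PE'
  (a := a) (w := w) (c := c) (io := io) (ka := ka) _ _ _ _ _ _ ioK slK _ r0 G0 GK KG Gc).
- by move=> x; have /upper_supportP[] := ha x.
- by move=> x; have /upper_supportP[] := ha x.
- by move=> x; have /lower_supportP[] := hc x.
- by move=> x; have /lower_supportP[] := hc x.
- by move=> x /pattern_supportP; exact: tr_sum.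
- by move=> t; apply/pattern_supportP; exact: io_s.
- move=> u v t uu pu tv pv x; have [] := uniq u v t => //.
    by apply/upper_supportP.
  by apply/lower_supportP.
Qed.

Theorem theorem4p2 (R : realType) (n k : nat) (I : 'I_k -> nat) (lam : 'I_k -> R)
    (hlam : forall a b : 'I_k, (a < b)%N -> lam a < lam b)
    (hIpos : forall j : 'I_k, (0 < I j)%N)
    (hIsum : (\sum_(j < k) I j)%N = n)
    (psi omega : {ffun 'I_n -> 'I_k})
    (hpsi : in_SnI I psi) (homega : in_SnI I omega) (hne : psi <> omega) :
  (connected_by_traj (Lam n I lam) (ptau lam psi) (ptau lam omega) <->
     (bruhat_le psi omega \/ bruhat_le omega psi)) /\
  (bruhat_le psi omega ->
     forall s : seq {ffun 'I_n -> 'I_k}, hasse_path I psi s omega ->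
       manifold_dim (swept (Lam n I lam) (ptau lam psi) (ptau lam omega)) (size s)).
Proof.
(* [Lam] becomes the diagonal of lam along the sorted word, with which both psi and omega share
   their content. *)
have [blk [hblk blk_mono ->]] := exists_blocks lam hIpos hIsum.
have pc := in_SnI_content hpsi hblk; have oc := in_SnI_content homega hblk.
split; first exact: connected_bruhat.
move=> le s path; rewrite (swept_richardson hlam pc oc hne le).
exact: richardson_manifold (hasse_path_inversions hpsi path).
Qed.
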